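(* Let $\Omega\subset\mathbb{R}^N$ be a smooth bounded domain and $1<\alpha<3$. Assume that there exist a subsolution $u_0$ and a supersolution $u^0$ of the problem $$-\Delta u=\frac{1}{u^\alpha}\ \text{ in }\Omega,\qquad u=0\ \text{ on }\partial\Omega,$$ and constants $c_1,c_2$ such that $$0<c_1 d(x)^{\frac{2}{1+\alpha}}\le u_0\le u^0\le c_2 d(x)^{\frac{2}{1+\alpha}}\quad\text{in }\Omega.$$ Then there is a unique solution of the problem in the interval $[u_0,u^0]$, and it is linearly asymptotically stable.
   Context: $d(x)=\mathrm{dist}(x,\partial\Omega)$. Functions $u_0,u^0\in H^1_0(\Omega)\cap L^\infty(\Omega)$ are called respectively a subsolution and a supersolution of the problem if $$\int_\Omega\nabla u_0\cdot\nabla v\,dx-\int_\Omega u_0^{-\alpha}v\,dx\le 0\le\int_\Omega\nabla u^0\cdot\nabla v\,dx-\int_\Omega (u^0)^{-\alpha}v\,dx\quad\text{for all }v\in H^1_0(\Omega),\ v\ge 0.$$ A (weak) solution $u$ in $[u_0,u^0]$ is a function $u\in H^1_0(\Omega)$ with $u_0\le u\le u^0$ a.e. in $\Omega$ and $\int_\Omega\nabla u\cdot\nabla v\,dx=\int_\Omega u^{-\alpha}v\,dx$ for all $v\in H^1_0(\Omega)$. The solution $u$ is called linearly asymptotically stable if the linearized eigenvalue problem $$-\Delta w+\alpha\frac{w}{u^{1+\alpha}}=\mu w\ \text{ in }\Omega,\qquad w=0\ \text{ on }\partial\Omega$$ (in the weak sense: $w\in H^1_0(\Omega)\setminus\{0\}$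 and $\int_\Omega\nabla w\cdot\nabla v\,dx+\alpha\int_\Omega\frac{wv}{u^{1+\alpha}}dx=\mu\int_\Omega wv\,dx$ for all $v\in H^1_0(\Omega)$) has a smallest eigenvalue $\mu_1$, and $\mu_1>0$. *)

(* Defs.v *)
From HB Require Import structures.
From mathcomp Require Import all_boot all_order all_algebra.
From mathcomp Require Import all_classical all_reals all_analysis.

Set Implicit Arguments.
Unset Strict Implicit.
Unset Printing Implicit Defensive.

Import Order.TTheory GRing.Theory Num.Theory.
Import numFieldNormedType.Exports.

Local Open Scope classical_set_scope.
Local Open Scope ring_scope.

(* Lebesgue measure on R^n. The sigma-algebra on row vectors is the one         *)
(* generated by the coordinate projections, i.e., the Borel sigma-algebra (this *)
(* mirrors the library's structure on n.-tuple T). The measure is defined by    *)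
(* recursion, R^(n+1) being identified with R * R^n.                            *)

Definition measure_rV_display : measure_display.
Proof. exact: default_measure_display. Qed.

Section measurable_rV.
Context {R : realType} {n : nat}.

Let coors : 'I_n -> 'rV[R]_n -> R := fun i x => x ord0 i.

Let rV_set0 : g_sigma_preimage coors set0.
Proof. exact: sigma_algebra0. Qed.

Let rV_setC A : g_sigma_preimage coors A -> g_sigma_preimage coors (~` A).
Proof. exact: sigma_algebraC. Qed.

Let rV_bigcup (F : (set 'rV[R]_n)^nat) :
  (forall i, g_sigma_preimage coors (F i)) ->
  g_sigma_preimage coors (\bigcup_i (F i)).
Proof. exact: sigma_algebra_bigcup. Qed.

HB.instance Definition _ := @isMeasurable.Build measure_rV_display
  'rV[R]_n (g_sigma_preimage coors) rV_set0 rV_setC rV_bigcup.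

Lemma measurable_coord (i : 'I_n) :
  measurable_fun [set: 'rV[R]_n] (fun x : 'rV[R]_n => x ord0 i).
Proof.
move=> _ Y mY; rewrite setTI; apply: sub_sigma_algebra => /=.
rewrite -bigcup_seq/=; exists i => /=; first by rewrite mem_index_enum.
by exists Y => //; rewrite setTI.
Qed.

Lemma measurable_fun_rV d (T : measurableType d) (f : T -> 'rV[R]_n) :
  (forall i, measurable_fun [set: T] (fun x => f x ord0 i)) ->
  measurable_fun [set: T] f.
Proof.
move=> mf.
suff H : g_sigma_preimage (fun i => coors i \o f) `<=` measurable.
  move=> _ A mA; rewrite setTI; apply: H.
  by rewrite g_sigma_preimage_comp; exists A => //; rewrite setTI.
apply: smallest_sub; first exact: sigma_algebra_measurable.
rewrite -bigcup_seq; apply: bigcup_sub => i _.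
by move=> A [B mB <-]; exact: mf.
Qed.

End measurable_rV.

Section lebesgue_measure_rV.
Context {R : realType}.

Definition rV_cons n (p : R * 'rV[R]_n) : 'rV[R]_n.+1 :=
  \row_i (if unlift ord0 i is Some j then p.2 ord0 j else p.1).

Definition rV_uncons n (x : 'rV[R]_n.+1) : R * 'rV[R]_n :=
  (x ord0 ord0, \row_j x ord0 (lift ord0 j)).

Lemma rV_consK n : cancel (@rV_cons n) (@rV_uncons n).
Proof.
move=> [a v]; rewrite /rV_uncons/= mxE unlift_none/=; congr pair.
by apply/rowP => j; rewrite !mxE liftK.
Qed.

Lemma measurable_rV_cons n : measurable_fun setT (@rV_cons n).
Proof.
apply: measurable_fun_rV => i.
case: (unliftP ord0 i) => [j ->|->].
  rewrite (_ : (fun _ => _) = (fun v : 'rV[R]_n => v ord0 j) \o snd); last first.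
    by apply/funext => p /=; rewrite mxE liftK.
  by apply: measurableT_comp => //; exact: measurable_coord.
rewrite (_ : (fun _ => _) = fst)//.
by apply/funext => p /=; rewrite mxE unlift_none.
Qed.

Lemma measurable_rV_uncons n : measurable_fun setT (@rV_uncons n).
Proof.
apply/measurable_fun_pairP; split; first exact: measurable_coord.
apply: measurable_fun_rV => i.
rewrite (_ : (fun _ => _) = (fun v : 'rV[R]_n.+1 => v ord0 (lift ord0 i))).
  exact: measurable_coord.
by apply/funext => p /=; rewrite mxE.
Qed.

Section step.
Variables (n : nat) (mu : {sigma_finite_measure set 'rV[R]_n -> \bar R}).

Definition lebesgue_rV_step : set 'rV[R]_n.+1 -> \bar R :=
  pushforward (lebesgue_measure \x mu)%E (@rV_cons n).

Let measurable_preimage_cons A :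
  measurable A -> measurable (@rV_cons n @^-1` A).
Proof.
by move=> mA; rewrite -[X in measurable X]setTI; exact: measurable_rV_cons.
Qed.

Let step0 : lebesgue_rV_step set0 = 0%E.
Proof. by rewrite /lebesgue_rV_step /pushforward preimage_set0 measure0. Qed.

Let step_ge0 A : (0 <= lebesgue_rV_step A)%E.
Proof. by rewrite /lebesgue_rV_step /pushforward; apply: measure_ge0. Qed.

Let step_sigma_additive : semi_sigma_additive lebesgue_rV_step.
Proof.
move=> F mF tF mUF; rewrite /lebesgue_rV_step /pushforward preimage_bigcup.
apply: measure_semi_sigma_additive.
- by move=> k; exact: measurable_preimage_cons.
- apply/trivIsetP => /= i j _ _ ij; rewrite -preimage_setI.
  by move/trivIsetP : tF => /(_ _ _ _ _ ij) ->//; rewrite preimage_set0.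
- by rewrite -preimage_bigcup; exact: measurable_preimage_cons.
Qed.

HB.instance Definition _ := isMeasure.Build _ _ _ lebesgue_rV_step
  step0 step_ge0 step_sigma_additive.

Let step_sigma_finite : sigma_finite setT lebesgue_rV_step.
Proof.
have /sigma_finiteP[F [FT ndF Foo]] := sigma_finiteT (@lebesgue_measure R).
have /sigma_finiteP[G [GT ndG Goo]] := sigma_finiteT mu.
exists (fun k => @rV_uncons n @^-1` (F k `*` G k)).
  rewrite -preimage_bigcup (_ : \bigcup_k (F k `*` G k) = setT) ?preimage_setT//.
  rewrite -setXTT FT GT predeqE => -[x y]; split.
    by move=> [k _ []/= ? ?]; split; exists k.
  move=> [/= [k _ Fkx] [l _ Gly]]; exists (maxn k l) => //; split.
  - by move: x Fkx; exact/subsetPset/ndF/leq_maxl.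
  - by move: y Gly; exact/subsetPset/ndG/leq_maxr.
move=> k; have [mFk Fk] := Foo k; have [mGk Gk] := Goo k; split.
  rewrite -[X in measurable X]setTI; apply: measurable_rV_uncons => //.
  exact: measurableX.
rewrite /lebesgue_rV_step /pushforward -comp_preimage.
rewrite (_ : _ \o _ = id) ?preimage_id; last first.
  by apply/funext => p; exact: rV_consK.
by rewrite product_measure1E// lte_mul_pinfty// ge0_fin_numE.
Qed.

HB.instance Definition _ :=
  Measure_isSigmaFinite.Build _ _ _ lebesgue_rV_step step_sigma_finite.

End step.

Fixpoint lebesgue_rV (n : nat) : {sigma_finite_measure set 'rV[R]_n -> \bar R} :=
  if n is k.+1 then lebesgue_rV_step (lebesgue_rV k)
  else dirac (0 : 'rV[R]_0).

Lemma lebesgue_rV_box n (A : 'I_n -> set R) :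
  (forall i, measurable (A i)) ->
  lebesgue_rV n [set x : 'rV[R]_n | forall i, A i (x ord0 i)] =
  (\prod_(i < n) lebesgue_measure (A i))%E.
Proof.
elim: n A => [|n IHn] A mA.
  by rewrite big_ord0 /= diracE mem_set//= => -[].
rewrite big_ord_recl -IHn//=.
rewrite /lebesgue_rV_step /pushforward.
rewrite (_ : _ @^-1` _ = A ord0 `*`
    [set x : 'rV[R]_n | forall i, A (lift ord0 i) (x ord0 i)]); last first.
  apply/seteqP; split => -[a v] /=.
    move=> Aav; split; first by have := Aav ord0; rewrite mxE unlift_none.
    by move=> i; have := Aav (lift ord0 i); rewrite mxE liftK.
  move=> [Aa Av] i; case: (unliftP ord0 i) => [j ->|->].
    by rewrite mxE liftK.
  by rewrite mxE unlift_none.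
rewrite product_measure1E//; first exact: mA.
rewrite (_ : [set _ | _] = \big[setI/setT]_(i < n)
    ((fun x : 'rV[R]_n => x ord0 i) @^-1` A (lift ord0 i))).
  apply: bigsetI_measurable => i _.
  by rewrite -[X in measurable X]setTI; exact: measurable_coord.
apply/seteqP; split => [x Ax|x]; rewrite -bigcap_seq.
  by move=> i _; exact: Ax.
by move=> Ax i; apply: Ax; rewrite /= mem_index_enum.
Qed.

End lebesgue_measure_rV.

Section euclidean.
Context {R : realType} {n : nat}.
Implicit Types (x y : 'rV[R]_n) (A : set 'rV[R]_n) (f : 'rV[R]_n -> R).

(* The library's norm on 'rV[R]_n is the sup norm, which is why the Euclidean   *)
(* one is needed to define dist(x, boundary).                                   *)
Definition enorm x : R := Num.sqrt (\sum_(i < n) x ord0 i ^+ 2).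

Definition boundary A : set 'rV[R]_n := closure A `\` A°.

Definition dist_boundary A x : R := inf [set enorm (x - y) | y in boundary A].

Definition partial (i : 'I_n) f : 'rV[R]_n -> R :=
  fun x => 'D_(delta_mx ord0 i) f x.

Fixpoint is_Ck (k : nat) f : Prop :=
  if k is k'.+1 then
    [/\ continuous f,
        forall (i : 'I_n) x, derivable f x (delta_mx ord0 i) &
        forall i : 'I_n, is_Ck k' (partial i f)]
  else continuous f.

Definition smooth f : Prop := forall k, is_Ck k f.

Definition test_function A f : Prop :=
  let supp := closure [set x | f x != 0] in
  [/\ smooth f, compact supp & supp `<=` A].

End euclidean.

(* Near each boundary point A lies strictly on one side of the graph of a       *)
(* smooth function of all the coordinates but one; col' i x is x without its    *)
(* i-th coordinate, and s tells on which side of the graph A lies.              *)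
Definition smooth_boundary {R : realType} {n : nat} (A : set 'rV[R]_n) : Prop :=
  forall x0, boundary A x0 ->
  exists (i : 'I_n) (s : bool) (r : R) (gamma : 'rV[R]_n.-1 -> R),
    [/\ 0 < r, smooth gamma &
        forall x, enorm (x - x0) < r ->
          (A x <-> gamma (col' i x) < (-1) ^+ s * x ord0 i)].

Definition smooth_bounded_domain {R : realType} {n : nat}
    (A : set 'rV[R]_n) : Prop :=
  [/\ A !=set0, open A, connected A, bounded_set A & smooth_boundary A].

(* Elements of Lebesgue and Sobolev spaces on Omega are represented by          *)
(* functions on R^n, of which only the restriction to Omega, up to equality     *)
(* almost everywhere, is meaningful.                                            *)
Section sobolev.
Context {R : realType} {n : nat}.
Variable Omega : set 'rV[R]_n.
Implicit Types (f g u v : 'rV[R]_n -> R) (P : 'rV[R]_n -> Prop).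

Local Notation leb := (@lebesgue_rV R n).

Definition ae_in P : Prop := {ae leb, forall x, Omega x -> P x}.

Definition integrable_in f : Prop := leb.-integrable Omega (EFin \o f).

Definition integral_in f : R := \int[leb]_(x in Omega) f x.

(* For nonnegative integrands, with values in [0, +oo].                         *)
Definition eintegral_in f : \bar R := (\int[leb]_(x in Omega) (f x)%:E)%E.

Definition is_L2 f : Prop :=
  measurable_fun Omega f /\ integrable_in (fun x => f x ^+ 2).

Definition is_Linfty f : Prop :=
  measurable_fun Omega f /\ exists M : R, ae_in (fun x => `|f x| <= M).

Definition weak_partial_of (i : 'I_n) f g : Prop :=
  is_L2 g /\
  forall phi, test_function Omega phi ->
    integral_in (fun x => f x * partial i phi x) =
    - integral_in (fun x => g x * phi x).

Definition is_H1 f : Prop :=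
  is_L2 f /\ forall i, exists g, weak_partial_of i f g.

(* A representative of the i-th weak derivative, when there is one.             *)
Definition weak_partial (i : 'I_n) f : 'rV[R]_n -> R :=
  xget (cst 0) (weak_partial_of i f).

(* H^1_0(Omega): closure in H^1(Omega) of the set of test functions.            *)
Definition is_H10 f : Prop :=
  is_H1 f /\
  exists phi : nat -> 'rV[R]_n -> R,
    [/\ forall k, test_function Omega (phi k),
        integral_in (fun x => (phi k x - f x) ^+ 2) @[k --> \oo] --> (0 : R) &
        forall i, integral_in
          (fun x => (partial i (phi k) x - weak_partial i f x) ^+ 2)
            @[k --> \oo] --> (0 : R)].

Definition dirichlet u v : R :=
  integral_in (fun x => \sum_(i < n) weak_partial i u x * weak_partial i v x).

Section singular_problem.
Variable alpha : R.

(* In the next two definitions the last integral is in [0, +oo]; it is used     *)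
(* only for u positive a.e. in Omega, powR being total.                         *)
Definition subsolution u : Prop :=
  [/\ is_H10 u, is_Linfty u &
    forall v, is_H10 v -> ae_in (fun x => 0 <= v x) ->
      ((dirichlet u v)%:E - eintegral_in (fun x => u x `^ (- alpha) * v x)%R
         <= 0)%E].

Definition supersolution u : Prop :=
  [/\ is_H10 u, is_Linfty u &
    forall v, is_H10 v -> ae_in (fun x => 0 <= v x) ->
      (0 <= (dirichlet u v)%:E
            - eintegral_in (fun x => u x `^ (- alpha) * v x)%R)%E].

(* Rintegral is total (it is 0 when the integral is infinite or undefined),     *)
(* hence the explicit integrability requirements here and in is_eigenvalue.     *)
Definition solution_in_interval usub usup u : Prop :=
  [/\ is_H10 u, ae_in (fun x => usub x <= u x <= usup x) &
    forall v, is_H10 v ->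
      integrable_in (fun x => u x `^ (- alpha) * v x) /\
      dirichlet u v = integral_in (fun x => u x `^ (- alpha) * v x)].

Definition is_eigenvalue u (mu : R) : Prop :=
  exists w,
    [/\ is_H10 w, ~ ae_in (fun x => w x = 0) &
      forall v, is_H10 v ->
        integrable_in (fun x => w x * v x / u x `^ (1 + alpha)) /\
        dirichlet w v
          + alpha * integral_in (fun x => w x * v x / u x `^ (1 + alpha)) =
        mu * integral_in (fun x => w x * v x)].

Definition linearly_asymptotically_stable u : Prop :=
  exists mu1,
    [/\ is_eigenvalue u mu1, forall mu, is_eigenvalue u mu -> mu1 <= mu &
        0 < mu1].

End singular_problem.
End sobolev.

(* Main.v *)
Require Import Defs.
From mathcomp Require Import all_boot all_order all_algebra.
From mathcomp Require Import all_classical all_reals all_analysis.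
From mathcomp Require Import measurable_realfun ring lra.

(** The nonlinearity [- u `^ (- alpha)] is an increasing function of [u], so
    that existence, uniqueness and stability would be standard facts of convex
    minimization if it were not for its singularity. The sub- and
    supersolution tame it. Being squeezed between multiples of the same power of
    the distance to the boundary, [usub] and [usup] are positive and
    comparable; testing the supersolution inequality with [`|v|] therefore
    bounds the integral of [usub `^ (- alpha) * `|v|] by a multiple of the
    Dirichlet norm of [v] ([singular_bound]).

    Existence. Truncated below [usub], the nonlinearity is dominated by
    [usub `^ (- alpha)], and the associated energy is finite, convex and
    coercive on H10. The parallelogram identity makes near minimizers a
    Cauchy sequence ([nested_midconvex_cauchy]), so that completeness of H10
    gives a minimizer, which solves the truncated equation
    ([semilinear_solution]). Testing the differences with [usub] and [usup]
    with their positive parts shows that the minimizer lies between them,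
    where the truncation is inactive ([weak_maximum_principle],
    [singular_solution]).

    Uniqueness. The equations of two solutions, tested with their difference,
    show by monotonicity that this difference has no energy
    ([singular_unique]).

    Stability. A solution [u] is positive and satisfies
    [- Laplacian u = rho * u] with [rho = u `^ (- (1 + alpha))]. Testing this
    equation with [w ^ 2 / u] and Picone's inequality give the Hardy
    inequality: the integral of [rho * w ^ 2] is at most the Dirichlet form of
    [w] ([hardy]). Hence the quadratic form of the linearized operator is
    equivalent to the Dirichlet form. Its minimum over the unit sphere of L2
    is attained, because of the compactness of the embedding of H10 into L2,
    and it is the least eigenvalue ([least_eigenvector]); it is positive by
    the Poincare inequality ([linearly_stable]). Compactness is stated without
    subsequences: the L2 norm is bounded by finitely many linear functionals
    and a small multiple of the energy ([rellich_line], [rellich_H10]).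

    The facts on H10 that this requires are obtained from the Riesz-Fischer
    theorem ([L2_complete]): uniqueness of weak derivatives
    ([fundamental_lemma]), completeness for the Dirichlet form
    ([H10_complete]) and contraction of the energy by the absolute value
    ([dirichlet_abs]). The last one involves a weak limit, which is again
    replaced by near minimizers of the energy ([H10_closure]). *)

Set Implicit Arguments.
Unset Strict Implicit.
Unset Printing Implicit Defensive.

Import Order.TTheory GRing.Theory Num.Theory.
Import numFieldNormedType.Exports.

Local Open Scope classical_set_scope.
Local Open Scope ring_scope.

(** * Positive semidefinite forms on a subspace *)

Section forms.
Context {R : realType} {V : lmodType R}.
Implicit Types (S : set V) (b q s : V -> V -> R) (x : nat -> V).

Definition lin_closed S := S 0 /\ forall a u v, S u -> S v -> S (a *: u + v).

(** The axioms are relative to [S] because the forms of interest are built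
    from total integrals, and are bilinear only on functions for which these
    converge. They are semidefinite because functions equal almost everywhere
    are not identified. *)
Definition psd_form S b :=
  [/\ forall u v, S u -> S v -> b u v = b v u,
      forall a u v w, S u -> S v -> S w -> b (a *: u + v) w = a * b u w + b v w &
      forall u, S u -> 0 <= b u u].

Definition form_cauchy b x := forall e : R, 0 < e ->
  exists N, forall j k, (N <= j)%N -> (N <= k)%N -> b (x j - x k) (x j - x k) <= e.

Definition form_lim b x l := forall e : R, 0 < e ->
  exists N, forall k, (N <= k)%N -> b (x k - l) (x k - l) <= e.

Definition form_complete S b := forall x, (forall k, S (x k)) -> form_cauchy b x ->
  exists2 l, S l & form_lim b x l.

Section closed.
Variables (S : set V) (S_lin : lin_closed S).

Lemma lin_closedZ a u : S u -> S (a *: u).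
Proof. by move=> Su; rewrite -[_ *: _]addr0; apply: S_lin.2 => //; exact: S_lin.1. Qed.

Lemma lin_closedD u v : S u -> S v -> S (u + v).
Proof. by move=> Su Sv; rewrite -[u]scale1r; exact: S_lin.2. Qed.

Lemma lin_closedN u : S u -> S (- u).
Proof. by move=> Su; rewrite -scaleN1r; exact: lin_closedZ. Qed.

Lemma lin_closedB u v : S u -> S v -> S (u - v).
Proof. by move=> Su Sv; apply: lin_closedD => //; exact: lin_closedN. Qed.

Section form.
Variables (b : V -> V -> R) (hb : psd_form S b).

Lemma form_sym u v : S u -> S v -> b u v = b v u.
Proof. by case: hb => + _ _; exact. Qed.

Lemma form_ge0 u : S u -> 0 <= b u u.
Proof. by case: hb => _ _; exact. Qed.

Lemma formPl a u v w : S u -> S v -> S w -> b (a *: u + v) w = a * b u w + b v w.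
Proof. by case: hb => _ + _; exact. Qed.

Lemma form0l w : S w -> b 0 w = 0.
Proof.
move=> Sw; have S0 := S_lin.1.
by have := formPl (-1) S0 S0 Sw; rewrite scaler0 addr0 mulN1r addNr.
Qed.

Lemma formZl a u w : S u -> S w -> b (a *: u) w = a * b u w.
Proof.
move=> Su Sw; have S0 := S_lin.1.
by rewrite -[a *: u]addr0 formPl// form0l// addr0.
Qed.

Lemma formDl u v w : S u -> S v -> S w -> b (u + v) w = b u w + b v w.
Proof. by move=> *; rewrite -[u in LHS]scale1r formPl// mul1r. Qed.

Lemma formBl u v w : S u -> S v -> S w -> b (u - v) w = b u w - b v w.
Proof.
move=> Su Sv Sw; rewrite formDl//; last exact: lin_closedN.
by rewrite -scaleN1r formZl// mulN1r.
Qed.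

Lemma formZr a u w : S u -> S w -> b u (a *: w) = a * b u w.
Proof. by move=> Su Sw; rewrite form_sym ?formZl 1?form_sym//; exact: lin_closedZ. Qed.

Lemma formDr u v w : S u -> S v -> S w -> b w (u + v) = b w u + b w v.
Proof.
move=> Su Sv Sw; rewrite form_sym ?formDl//; last exact: lin_closedD.
by rewrite !(form_sym _ Sw).
Qed.

Lemma formBr u v w : S u -> S v -> S w -> b w (u - v) = b w u - b w v.
Proof.
move=> Su Sv Sw; rewrite form_sym ?formBl//; last exact: lin_closedB.
by rewrite !(form_sym _ Sw).
Qed.

Lemma form_sqr u v t : S u -> S v ->
  b (u + t *: v) (u + t *: v) = b u u + 2 * t * b u v + t ^+ 2 * b v v.
Proof.
move=> Su Sv; have Stv := lin_closedZ t Sv.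
rewrite formDl ?formDr//; last exact: lin_closedD.
rewrite !formZl ?formZr// (form_sym Sv Su); ring.
Qed.

Lemma form_sqrD u v : S u -> S v ->
  b (u + v) (u + v) = b u u + 2 * b u v + b v v.
Proof.
by move=> Su Sv; have := form_sqr 1 Su Sv; rewrite scale1r mulr1 expr1n mul1r.
Qed.

Lemma form_sqrB u v : S u -> S v ->
  b (u - v) (u - v) = b u u - 2 * b u v + b v v.
Proof.
by move=> Su Sv; have := form_sqr (-1) Su Sv; rewrite scaleN1r mulrN1 sqrrN expr1n mul1r mulNr.
Qed.

Lemma form_sqrZ a u : S u -> b (a *: u) (a *: u) = a ^+ 2 * b u u.
Proof. by move=> Su; rewrite formZl ?formZr ?mulrA//; exact: lin_closedZ. Qed.

Lemma form_sqrC u v : S u -> S v -> b (u - v) (u - v) = b (v - u) (v - u).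
Proof. by move=> Su Sv; rewrite !form_sqrB// (form_sym Sv Su); ring. Qed.

Lemma form_parallelogram u v : S u -> S v ->
  b (u - v) (u - v) = 2 * b u u + 2 * b v v - b (u + v) (u + v).
Proof. by move=> Su Sv; rewrite form_sqrB// form_sqrD//; ring. Qed.

Lemma form_young u v (t : R) : S u -> S v -> 0 < t ->
  2 * `|b u v| <= t * b u u + b v v / t.
Proof.
move=> Su Sv t0.
have bvE : b v v = t * (b v v / t) by rewrite mulrCA mulfV ?gt_eqF// mulr1.
have [bp|bn] := leP 0 (b u v).
  have := form_ge0 (lin_closedB (lin_closedZ t Su) Sv).
  rewrite form_sqrB; [|exact: lin_closedZ|by[]].
  rewrite form_sqrZ// formZl// {1}bvE.
  have -> : t ^+ 2 * b u u - 2 * (t * b u v) + t * (b v v / t) =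
    t * (t * b u u + b v v / t - 2 * b u v) by ring.
  by rewrite pmulr_rge0// subr_ge0 ger0_norm.
have := form_ge0 (lin_closedD (lin_closedZ t Su) Sv).
rewrite form_sqrD; [|exact: lin_closedZ|by[]].
rewrite form_sqrZ// formZl// {1}bvE.
have -> : t ^+ 2 * b u u + 2 * (t * b u v) + t * (b v v / t) =
  t * (t * b u u + b v v / t - 2 * - b u v) by ring.
by rewrite pmulr_rge0// subr_ge0 ltr0_norm.
Qed.

(** Nonnegativity of the form at [b u u *: v - b u v *: u]; when [b u u = 0],
    Young's inequality with an arbitrarily large weight. *)
Lemma form_cauchy_schwarz u v : S u -> S v -> b u v ^+ 2 <= b u u * b v v.
Proof.
move=> Su Sv; have := form_ge0 Su; rewrite le_eqVlt => /orP[/eqP bu0|bu0].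
  have -> : b u v = 0; last by rewrite -bu0 mul0r expr0n.
  apply/eqP; rewrite -normr_eq0 eq_le normr_ge0 andbT.
  apply/ler_addgt0Pr => e e0; rewrite add0r.
  have bv := form_ge0 Sv.
  have t0 : 0 < (b v v + 1) / e by rewrite divr_gt0// ltr_wpDl.
  have := form_young Su Sv t0; rewrite -bu0 mulr0 add0r invf_div.
  have -> : b v v * (e / (b v v + 1)) = e * (b v v / (b v v + 1)) by ring.
  have h : b v v / (b v v + 1) <= 1 by rewrite ler_pdivrMr ?ltr_wpDl//; lra.
  have : e * (b v v / (b v v + 1)) <= e by rewrite ger_pMr.
  have := normr_ge0 (b u v); lra.
have : 0 <= b (b u u *: v - b u v *: u) (b u u *: v - b u v *: u).
  by apply: form_ge0; apply: lin_closedB; exact: lin_closedZ.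
rewrite form_sqrB; [|exact: lin_closedZ..].
rewrite !form_sqrZ// formZl ?formZr//; last exact: lin_closedZ.
rewrite (form_sym Sv Su).
have -> : b u u ^+ 2 * b v v - 2 * (b u u * (b u v * b u v)) + b u v ^+ 2 * b u u
  = b u u * (b u u * b v v - b u v ^+ 2) by ring.
by rewrite pmulr_rge0// subr_ge0.
Qed.

Lemma form_null u v : S u -> S v -> b u u = 0 -> b u v = 0.
Proof.
move=> Su Sv bu0; have := form_cauchy_schwarz Su Sv.
by rewrite bu0 mul0r real_exprn_even_le0//= => /eqP.
Qed.

Lemma form_small (A d : R) : 0 < d -> exists2 e : R, 0 < e &
  forall u v, S u -> S v -> b u u <= e -> b v v <= A -> `|b u v| <= d.
Proof.
move=> d0; have A0 : 0 < `|A| + 1 by rewrite ltr_wpDl.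
exists (d ^+ 2 / (`|A| + 1)); first by rewrite divr_gt0// exprn_gt0.
move=> u v Su Sv ue vA; rewrite -(@ler_pXn2r _ 2) ?nnegrE ?(ltW d0)//.
rewrite real_normK ?num_real//; apply: le_trans (form_cauchy_schwarz Su Sv) _.
apply: (@le_trans _ _ (d ^+ 2 / (`|A| + 1) * (`|A| + 1))).
  apply: ler_pM => //; [exact: form_ge0|exact: form_ge0|].
  by rewrite (le_trans vA)// (le_trans (ler_norm A))// lerDl.
by rewrite divfK// gt_eqF.
Qed.

(** The functional [u |-> b u u] is continuous for the topology it defines. *)
Lemma form_lim_sqr x l : (forall k, S (x k)) -> S l -> form_lim b x l ->
  forall e : R, 0 < e -> exists N, forall k, (N <= k)%N -> `|b (x k) (x k) - b l l| <= e.
Proof.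
move=> Sx Sl xl e e0; have bl := form_ge0 Sl.
pose t := e / (2 * (b l l + 1)).
have t0 : 0 < t by rewrite divr_gt0// mulr_gt0// ltr_wpDl.
pose d := e / 2 / (1 + t^-1).
have t1 : 0 < 1 + t^-1 by rewrite addr_gt0// invr_gt0.
have d0 : 0 < d by rewrite !divr_gt0.
have [N hN] := xl _ d0; exists N => k /hN h.
have Sd := lin_closedB (Sx k) Sl.
have -> : b (x k) (x k) - b l l = 2 * b l (x k - l) + b (x k - l) (x k - l).
  by have := form_sqrD Sl Sd; rewrite (addrC l) subrK => ->; ring.
have h1 := form_young Sl Sd t0.
have h2 : `|2 * b l (x k - l) + b (x k - l) (x k - l)| <=
    2 * `|b l (x k - l)| + b (x k - l) (x k - l).
  by apply: le_trans (ler_normD _ _) _; rewrite normrM (ger0_norm (form_ge0 Sd)) ger0_norm.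
apply: (le_trans h2).
have h3 : b (x k - l) (x k - l) * (1 + t^-1) <= e / 2 by rewrite -ler_pdivlMr.
have h4 : t * b l l <= e / 2.
  have -> : e / 2 = t * (b l l + 1) by rewrite /t; field; rewrite gt_eqF// ltr_wpDl.
  by rewrite ler_pM2l// lerDl.
rewrite mulrDr mulr1 in h3; lra.
Qed.

Lemma form_lim_cvg x l : (forall k, S (x k)) -> S l -> form_lim b x l ->
  b (x k) (x k) @[k --> \oo] --> b l l.
Proof.
move=> Sx Sl xl; apply/cvgrPdist_le => e e0.
have [N hN] := form_lim_sqr Sx Sl xl e0.
by exists N => // k /hN; rewrite distrC.
Qed.

Lemma form_lim_cvgl u x l : S u -> (forall k, S (x k)) -> S l -> form_lim b x l ->
  b u (x k) @[k --> \oo] --> b u l.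
Proof.
move=> Su Sx Sl xl; apply/cvgrPdist_le => e e0.
have [d d0 hd] := form_small (b u u) e0.
have [N hN] := xl _ d0; exists N => // k /hN h.
have Sd := lin_closedB (Sx k) Sl.
rewrite distrC -formBr// form_sym//; exact: hd.
Qed.

(** Almost minimizers of [b] over the sets of a decreasing sequence of midpoint
    convex sets form a Cauchy sequence, by the parallelogram identity: the
    infima increase to a finite limit, and the midpoint of two of these points
    cannot do better than the infimum over the larger set. *)
Lemma nested_midconvex_cauchy (A : nat -> set V) (M : R) :
  (forall k, A k `<=` S) ->
  (forall j k, (j <= k)%N -> A k `<=` A j) ->
  (forall k, A k !=set0) ->
  (forall k u v, A k u -> A k v -> A k (2^-1 *: (u + v))) ->
  (forall u, A 0%N u -> b u u <= M) ->
  exists2 x, forall k, A k (x k) & form_cauchy b x.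
Proof.
move=> AS Adec A0 Amid AM.
pose E k := [set b u u | u in A k].
have Elb k : has_lbound (E k).
  by exists 0 => _ [u Au <-]; apply: form_ge0; exact: AS Au.
have Einf k : has_inf (E k) by split=> //; have [u Au] := A0 k; exists (b u u), u.
pose m k := inf (E k).
pose F := range m.
have Fsup : has_sup F.
  split; first by exists (m 0%N), 0%N.
  exists M => _ [k _ <-]; have [u Au] := A0 k.
  apply: (@le_trans _ _ (b u u)); first by apply: ge_inf => //; exists u.
  by apply: AM; exact: Adec Au.
pose inv (k : nat) : R := k.+1%:R^-1.
have xP k : exists u, A k u /\ b u u <= m k + inv k.
  have [|_ [u Au <-] h] := @inf_adherent _ (E k) (inv k) _ (Einf k).
    by rewrite invr_gt0.
  by exists u; split=> //; exact: ltW.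
have [x hx] := choice xP.
exists x; first by move=> k; exact: (hx k).1.
have Sx k : S (x k) by apply: AS; exact: (hx k).1.
move=> e e0.
have [|_ [N1 _ <-] hN1] := @sup_adherent _ F (e / 8) _ Fsup; first by rewrite divr_gt0.
pose N2 := (Num.truncn (8 / e)).+1.
exists (maxn N1 N2) => j k; rewrite !geq_max => /andP[j1 j2] /andP[k1 k2].
have small i : (N2 <= i)%N -> inv i <= e / 8.
  move=> i2; rewrite -[e / 8]invf_div lef_pV2 ?posrE ?divr_gt0//.
  apply: (@le_trans _ _ N2%:R); last by rewrite ler_nat (leq_trans i2).
  by apply/ltW/truncnS_gt.
have msup i : m i <= sup F by apply: sup_upper_bound => //; exists i.
have mid := Amid N1 _ _ (Adec _ _ j1 _ (hx j).1) (Adec _ _ k1 _ (hx k).1).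
have hmid : m N1 <= b (2^-1 *: (x j + x k)) (2^-1 *: (x j + x k)).
  by apply: ge_inf => //; exists (2^-1 *: (x j + x k)).
rewrite form_sqrZ in hmid; last exact: lin_closedD.
rewrite form_parallelogram//.
have := (hx j).2; have := (hx k).2; have := small _ j2; have := small _ k2.
have := msup j; have := msup k.
have -> : b (x j + x k) (x j + x k) = 4 * (2^-1 ^+ 2 * b (x j + x k) (x j + x k)).
  by field.
set Z := _ ^+ 2 * _ in hmid *; lra.
Qed.

End form.
End closed.

Lemma psd_form_sub S S' b : S' `<=` S -> psd_form S b -> psd_form S' b.
Proof.
move=> sub [h1 h2 h3]; split.
- by move=> u v /sub Su /sub Sv; exact: h1.
- by move=> a u v w /sub Su /sub Sv /sub Sw; exact: h2.
- by move=> u /sub; exact: h3.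
Qed.

(** Compactness of the cube [[-C, C] ^ M]. *)
Lemma bounded_vec_cluster M (y : nat -> 'I_M -> R) (C : R) :
  (forall k i, `|y k i| <= C) ->
  exists z : 'I_M -> R, forall (e : R) N, 0 < e ->
    exists2 k, (N <= k)%N & forall i, `|y k i - z i| <= e.
Proof.
move=> yC; pose Y k : 'rV[R]_M := \row_i y k i.
pose A : set 'rV[R]_M := [set v | forall i, `[-C, C]%classic (v ord0 i)].
have cA : compact A by apply: (@rV_compact _ _ (fun=> _)) => i; exact: segment_compact.
have [|z [_ zc]] := cA (Y @ \oo) _.
  by exists 0%N => // k _ i; rewrite mxE/= in_itv/= -ler_norml.
exists (fun i => z ord0 i) => e N e0.
have [||_ [[k /= Nk <-] B]] := zc [set Y k | k in [set k | (N <= k)%N]]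
    [set v : 'rV[R]_M | forall i j, ball (z i j) e (v i j)].
- by exists N => // k /= Nk; exists k.
- by exists (fun i j => ball (z i j) e) => // i j; exact: nbhsx_ballx.
exists k => // i; rewrite distrC.
by have /ltW := B ord0 i; rewrite mxE.
Qed.

(** A quadratic form [q] that is complete and relatively compact with respect
    to [s] has a least generalized eigenvalue, the minimum of [q] over the unit
    sphere of [s]. Only finitely many functionals are involved, those that
    control [s] up to a small multiple of [q]: once they converge along a
    minimizing sequence, the parallelogram identity makes the sequence Cauchy. *)
Theorem least_eigenvector S q s (C : R) :
  lin_closed S -> psd_form S q -> psd_form S s -> form_complete S q ->
  (forall v, S v -> s v v <= C * q v v) ->
  (forall e : R, 0 < e -> exists M (l : 'I_M -> V -> R) (K : R),
    [/\ forall i a u v, S u -> S v -> l i (a *: u + v) = a * l i u + l i v,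
        forall i v, S v -> l i v ^+ 2 <= K * s v v &
        forall v, S v -> s v v <= \sum_i l i v ^+ 2 + e * q v v]) ->
  (exists2 v, S v & 0 < s v v) ->
  exists w m, [/\ S w, s w w = 1, forall v, S v -> q w v = m * s w v &
    forall v, S v -> m * s v v <= q v v].
Proof.
move=> SL hq hs qc sCq comp [v0 Sv0 v00].
pose inv (k : nat) : R := k.+1%:R^-1.
pose E := [set q v v | v in [set v | S v /\ s v v = 1]].
have nrm v : S v -> 0 < s v v -> s ((Num.sqrt (s v v))^-1 *: v) ((Num.sqrt (s v v))^-1 *: v) = 1.
  move=> Sv sv; rewrite (form_sqrZ SL hs)// exprVn sqr_sqrtr ?ltW// mulVf// gt_eqF//.
have Elb : has_lbound E by exists 0 => _ [u [Su _] <-]; exact: (form_ge0 hq).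
have Einf : has_inf E.
  split=> //; exists (q ((Num.sqrt (s v0 v0))^-1 *: v0) ((Num.sqrt (s v0 v0))^-1 *: v0)).
  by exists ((Num.sqrt (s v0 v0))^-1 *: v0) => //; split; [exact: lin_closedZ|exact: nrm].
pose m := inf E.
have m0 : 0 <= m by apply: lb_le_inf; [exact: Einf.1|move=> _ [u [Su _] <-]; exact: (form_ge0 hq)].
have mle v : S v -> m * s v v <= q v v.
  move=> Sv; have := form_ge0 hs Sv; rewrite le_eqVlt => /orP[/eqP <-|sv].
    by rewrite mulr0; exact: (form_ge0 hq).
  rewrite -ler_pdivlMr//.
  have -> : q v v / s v v = q ((Num.sqrt (s v v))^-1 *: v) ((Num.sqrt (s v v))^-1 *: v).
    by rewrite (form_sqrZ SL hq)// exprVn sqr_sqrtr ?ltW// mulrC.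
  apply: ge_inf => //; exists ((Num.sqrt (s v v))^-1 *: v) => //.
  by split; [exact: lin_closedZ|exact: nrm].
have xP k : exists u, [/\ S u, s u u = 1 & q u u <= m + inv k].
  have [|_ [u [Su su] <-] h] := @inf_adherent _ E (inv k) _ Einf.
    by rewrite invr_gt0.
  by exists u; split=> //; exact: ltW.
have [x0 hx0] := choice xP.
(* With [m * eps <= 1 / 2] the energy term of the compactness estimate can be
   absorbed. *)
pose eps := (2 * (m + 1))^-1.
have eps0 : 0 < eps by rewrite invr_gt0 mulr_gt0// ltr_wpDl.
have [M [l [K [llin lK lcomp]]]] := comp _ eps0.
have lB i u v : S u -> S v -> l i (u - v) = l i u - l i v.
  by move=> Su Sv; rewrite addrC -scaleN1r llin// mulN1r addrC.
have [z hz] : exists z : 'I_M -> R, forall (e : R) N, 0 < e ->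
    exists2 k, (N <= k)%N & forall i, `|l i (x0 k) - z i| <= e.
  apply: (@bounded_vec_cluster _ (fun k i => l i (x0 k)) (1 + `|K|)) => k i.
  have [Sx sx _] := hx0 k; have := lK i _ Sx; rewrite sx mulr1 => h.
  have : `|l i (x0 k)| ^+ 2 <= `|K| by rewrite real_normK ?num_real//; apply: le_trans h (ler_norm _).
  have := normr_ge0 K; have := normr_ge0 (l i (x0 k)); nra.
have nP j : exists k, (j <= k)%N /\ forall i, `|l i (x0 k) - z i| <= inv j.
  by have [|k jk h] := hz (inv j) j; [rewrite invr_gt0|exists k].
have [n hn] := choice nP.
pose x j := x0 (n j).
have Sx j : S (x j) by have [] := hx0 (n j).
have sx j : s (x j) (x j) = 1 by have [] := hx0 (n j).
have qx j : q (x j) (x j) <= m + inv j.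
  have [_ _ h] := hx0 (n j); apply: (le_trans h); rewrite lerD2l lef_pV2 ?posrE//.
  by rewrite ler_nat ltnS (hn j).1.
have qcau : form_cauchy q x.
  move=> e e0.
  pose D := 8 + 8 * m * M%:R.
  have D0 : 0 < D by rewrite ltr_pwDl// !mulr_ge0.
  pose N := (Num.truncn (D / e)).+1.
  exists N => j k Nj Nk.
  have N0 : 0 < inv N :> R by rewrite invr_gt0.
  have small i : (N <= i)%N -> inv i <= inv N :> R.
    by move=> Ni; rewrite lef_pV2 ?posrE// ler_nat.
  have hl i : l i (x j - x k) ^+ 2 <= 4 * inv N.
    have h1 := (hn j).2 i; have h2 := (hn k).2 i.
    have h3 : `|l i (x j - x k)| <= 2 * inv N.
      rewrite lB//; rewrite [_ - _](_ : _ = (l i (x j) - z i) - (l i (x k) - z i)); last by ring.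
      apply: le_trans (ler_normB _ _) _.
      by have := small _ Nj; have := small _ Nk; rewrite /x; lra.
    rewrite -real_normK ?num_real//.
    have N1 : inv N <= 1 :> R by rewrite invf_le1// ler1n.
    have := normr_ge0 (l i (x j - x k)); nra.
  have hsum : \sum_i l i (x j - x k) ^+ 2 <= M%:R * (4 * inv N).
    apply: (le_trans (ler_sum _ (fun i _ => hl i))).
    by rewrite sumr_const card_ord -[leLHS]mulr_natl.
  have Sd := lin_closedB SL (Sx j) (Sx k).
  have h1 := lcomp _ Sd.
  have h2 := form_parallelogram SL hq (Sx j) (Sx k).
  have h3 := form_parallelogram SL hs (Sx j) (Sx k).
  rewrite !sx in h3.
  have h4 := mle _ (lin_closedD SL (Sx j) (Sx k)).
  have h5 := qx j; have h6 := qx k; have := small _ Nj; have := small _ Nk.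
  have q0 := form_ge0 hq Sd.
  set Q := q (x j - x k) (x j - x k) in h1 h2 q0 *.
  set s1 := s (x j - x k) _ in h1 h3.
  set s2 := s (x j + x k) _ in h3 h4.
  move=> h7 h8.
  have h9 : m * (eps * Q) <= Q / 2.
    rewrite mulrA mulrC ler_wpM2l// /eps ler_pdivrMr ?mulr_gt0 ?ltr_wpDl//; lra.
  have h10 : m * s1 <= m * (M%:R * (4 * inv N)) + Q / 2.
    apply: (@le_trans _ _ (m * (M%:R * (4 * inv N) + eps * Q))).
      rewrite ler_wpM2l//; lra.
    by rewrite mulrDr lerD2l.
  have h11 : m * s2 = m * 4 - m * s1 by rewrite -mulrBr; congr (_ * _); lra.
  have h12 : Q <= D * inv N.
    have -> : D * inv N = 2 * (4 * inv N + m * (M%:R * (4 * inv N))).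
      by rewrite /D; ring.
    lra.
  apply: (le_trans h12); rewrite ler_pdivrMr// mulrC -ler_pdivrMr//.
  apply: (@le_trans _ _ N%:R); last by rewrite ler_nat.
  by apply/ltW/truncnS_gt.
have [w Sw xw] := qc x Sx qcau.
have C0 : form_lim s x w.
  move=> e e0; have [|N hN] := xw (e / (`|C| + 1)); first by rewrite divr_gt0// ltr_wpDl.
  exists N => k /hN; rewrite ler_pdivlMr ?ltr_wpDl// => h.
  have Sd := lin_closedB SL (Sx k) Sw.
  apply: le_trans (sCq _ Sd) _.
  have := form_ge0 hq Sd; have := ler_norm C; nra.
have sw : s w w = 1.
  apply/eqP; rewrite eq_sym -subr_eq0 -normr_eq0 eq_le normr_ge0 andbT.
  apply/ler_addgt0Pr => e e0; rewrite add0r.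
  by have [N /(_ N (leqnn _))] := form_lim_sqr SL hs Sx Sw C0 e0; rewrite sx.
have qw : q w w = m.
  apply/eqP; rewrite eq_le; apply/andP; split; last by have := mle _ Sw; rewrite sw mulr1.
  apply/ler_addgt0Pr => e e0.
  have e20 : 0 < e / 2 by rewrite divr_gt0.
  have [N hN] := form_lim_sqr SL hq Sx Sw xw e20.
  pose k := maxn N (Num.truncn (2 / e)).+1.
  have := hN k (leq_maxl _ _); rewrite distrC ler_norml => /andP[_ h].
  have : inv k <= e / 2.
    rewrite -[e / 2]invf_div lef_pV2 ?posrE ?divr_gt0//.
    apply: (@le_trans _ _ (Num.truncn (2 / e)).+1%:R); first by apply/ltW/truncnS_gt.
    by rewrite ler_nat (leq_trans (leq_maxr N _)).
  have := qx k; lra.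
exists w, m; split=> //.
(* The form [q - m * s] is nonnegative and vanishes at [w], so that [w] is in
   its kernel. *)
pose b u v := q u v - m * s u v.
have hb : psd_form S b.
  split.
  - by move=> u v Su Sv; rewrite /b (form_sym hq)// (form_sym hs).
  - by move=> a u v t Su Sv St; rewrite /b (formPl hq)// (formPl hs)//; ring.
  - by move=> u Su; rewrite /b subr_ge0; exact: mle.
move=> v Sv; have := form_null SL hb Sw Sv.
by rewrite /b qw sw mulr1 subrr => /(_ erefl)/eqP; rewrite subr_eq0 => /eqP.
Qed.

End forms.

(** * Square integrable functions *)

Section real_integral.
Context d {T : measurableType d} {R : realType}.
Variables (mu : {measure set T -> \bar R}) (D : set T).
Hypothesis mD : measurable D.
Implicit Types f g : T -> R.

Local Notation ae P := {ae mu, forall x, D x -> P x}.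
Local Notation intg f := (mu.-integrable D (EFin \o f)).
Local Notation I f := (\int[mu]_(x in D) f x).

Lemma ae_all (P : T -> Prop) : (forall x, D x -> P x) -> ae P.
Proof. by move=> h; apply: nearW. Qed.

Lemma ae_and (P Q : T -> Prop) : ae P -> ae Q -> ae (fun x => P x /\ Q x).
Proof. by apply: filterS2 => x h k Dx; split; [exact: h|exact: k]. Qed.

Lemma ae_imp (P Q : T -> Prop) : (forall x, D x -> P x -> Q x) -> ae P -> ae Q.
Proof. by move=> PQ; apply: filterS => x h Dx; apply: PQ => //; exact: h. Qed.

Lemma ae_imp2 (P Q S : T -> Prop) : (forall x, D x -> P x -> Q x -> S x) ->
  ae P -> ae Q -> ae S.
Proof. by move=> PQ; apply: filterS2 => x h k Dx; apply: PQ => //; [exact: h|exact: k]. Qed.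

Lemma ae_nat (P : nat -> T -> Prop) : (forall k, ae (P k)) -> ae (fun x => forall k, P k x).
Proof.
move=> h; have [N [mN muN hN]] : mu.-negligible (\bigcup_k [set x | ~ (D x -> P k x)]).
  by apply: negligible_bigcup => k; exact: h.
exists N; split=> // x /= /existsNP[Dx /existsNP[k nP]]; apply: hN.
by exists k => //= /(_ Dx).
Qed.

Lemma integrable_measurable f : intg f -> measurable_fun D f.
Proof. by move=> /measurable_int/measurable_EFinP. Qed.

Lemma integrable_ae_le f g : measurable_fun D f -> intg g ->
  ae (fun x => `|f x| <= g x) -> intg f.
Proof.
move=> mf /integrableP[mg ig] fg; apply/integrableP; split; first exact/measurable_EFinP.
apply: le_lt_trans ig; apply: ae_ge0_le_integral => //.
- by apply: measurableT_comp => //; exact/measurable_EFinP.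
- exact: measurableT_comp.
by apply: filterS fg => x h Dx /=; rewrite lee_fin (le_trans (h Dx))// ler_norm.
Qed.

Lemma integrable_eq_ae f g : measurable_fun D g -> ae (fun x => f x = g x) ->
  intg f -> intg g.
Proof.
move=> mg fg iF; apply: (integrable_ae_le mg (integrable_norm iF)).
by apply: ae_imp fg => x _ /= ->.
Qed.

Lemma integrable_add f g : intg f -> intg g -> intg (fun x => f x + g x).
Proof. by move=> iF ig; exact: (integrableD mD iF ig). Qed.

Lemma integrable_scale a f : intg f -> intg (fun x => a * f x).
Proof. by move=> iF; exact: (integrableZl mD a iF). Qed.

Lemma integrable_sub f g : intg f -> intg g -> intg (fun x => f x - g x).
Proof. by move=> iF ig; exact: (integrableB mD iF ig). Qed.

Lemma eq_Rintegral_ae f g : intg f -> intg g -> ae (fun x => f x = g x) -> I f = I g.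
Proof.
move=> iF ig fg; rewrite /Rintegral; congr fine; apply: ae_eq_integral => //.
- exact: measurable_int iF.
- exact: measurable_int ig.
by apply: filterS fg => x h Dx /=; rewrite h.
Qed.

Lemma Rintegral_ge0_ae f : intg f -> ae (fun x => 0 <= f x) -> 0 <= I f.
Proof.
move=> iF f0.
have -> : I f = I (fun x => `|f x|).
  apply: eq_Rintegral_ae => //; first exact: integrable_norm.
  by apply: ae_imp f0 => x _ h; rewrite ger0_norm.
exact: Rintegral_ge0.
Qed.

Lemma Rintegral_le_ae f g : intg f -> intg g -> ae (fun x => f x <= g x) -> I f <= I g.
Proof.
move=> iF ig fg; rewrite -subr_ge0 -RintegralB//.
by apply: Rintegral_ge0_ae; [exact: integrable_sub|apply: ae_imp fg => x _; rewrite subr_ge0].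
Qed.

Lemma integrable_bigsum (J : Type) (s : seq J) (F : J -> T -> R) :
  (forall j, intg (F j)) -> intg (fun x => \sum_(j <- s) F j x).
Proof.
move=> iF; elim: s => [|j s IH].
  under [X in _.-integrable _ X]funext do rewrite /= big_nil; exact: integrable0.
by under [X in _.-integrable _ X]funext do rewrite /= big_cons; exact: integrable_add.
Qed.

Lemma Rintegral_bigsum (J : Type) (s : seq J) (F : J -> T -> R) :
  (forall j, intg (F j)) -> I (fun x => \sum_(j <- s) F j x) = \sum_(j <- s) I (F j).
Proof.
move=> iF; elim: s => [|j s IH].
  under eq_Rintegral do rewrite big_nil.
  by rewrite big_nil (Rintegral_cst mu mD) mul0r.
under eq_Rintegral do rewrite big_cons.
by rewrite big_cons RintegralD// ?IH//; exact: integrable_bigsum.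
Qed.

Lemma normr_Rintegral_le f g : intg f -> intg g -> ae (fun x => `|f x| <= g x) ->
  `|I f| <= I g.
Proof.
move=> iF ig fg; apply: le_trans (le_normr_Rintegral mD iF) _.
by apply: Rintegral_le_ae => //; exact: integrable_norm.
Qed.

Lemma Rintegral_EFin f : intg f -> (\int[mu]_(x in D) (f x)%:E)%E = (I f)%:E.
Proof. by move=> iF; rewrite /Rintegral fineK//; exact: integrable_fin_num. Qed.

(** For an almost everywhere nonnegative integrand, integrability is finiteness
    of the extended integral. *)
Lemma integrable_lee f c : measurable_fun D f -> ae (fun x => 0 <= f x) ->
  (\int[mu]_(x in D) (f x)%:E <= c%:E)%E -> intg f /\ I f <= c.
Proof.
move=> mf f0 fc.
have iF : intg f.
  apply/integrableP; split; first exact/measurable_EFinP.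
  rewrite (@ae_eq_integral _ _ _ mu D (EFin \o f) _)//.
  - by apply: le_lt_trans fc _; rewrite ltry.
  - by apply: measurableT_comp => //; exact/measurable_EFinP.
  - exact/measurable_EFinP.
  - by apply: filterS f0 => x h Dx /=; rewrite ger0_norm// h.
by split => //; rewrite -lee_fin -Rintegral_EFin.
Qed.

Lemma Rintegral_eq0_ae f : intg f -> ae (fun x => 0 <= f x) -> I f = 0 ->
  ae (fun x => f x = 0).
Proof.
move=> iF f0 If0.
have : (\int[mu]_(x in D) `|(f x)%:E| = 0)%E.
  rewrite (@ae_eq_integral _ _ _ mu D (EFin \o f) _)//.
  - by rewrite Rintegral_EFin// If0.
  - by apply: measurableT_comp => //; exact: measurable_int iF.
  - exact: measurable_int iF.
  - by apply: filterS f0 => x h Dx /=; rewrite ger0_norm// h.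
move/(ae_eq_integral_abs mu mD (measurable_int _ iF)).1.
by apply: filterS => x h Dx; have [] := h Dx.
Qed.

(** * The space L2 *)

Definition L2 f := measurable_fun D f /\ intg (fun x => f x ^+ 2).

Definition ip f g := I (fun x => f x * g x).

Lemma ipE f g : ip f g = I (fun x => f x * g x).
Proof. by []. Qed.

Lemma L2_measurable f : L2 f -> measurable_fun D f.
Proof. by case. Qed.

Lemma L2_le f g : measurable_fun D f -> L2 g -> ae (fun x => `|f x| <= `|g x|) -> L2 f.
Proof.
move=> mf [mg ig] fg; split => //.
apply: (integrable_ae_le _ ig); first exact: measurable_funX.
apply: ae_imp fg => x _ h; rewrite ger0_norm ?sqr_ge0//.
by rewrite -(real_normK (num_real (f x))) -(real_normK (num_real (g x))) ler_pXn2r ?nnegrE.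
Qed.

Lemma L2_eq_ae f g : measurable_fun D g -> ae (fun x => f x = g x) -> L2 f -> L2 g.
Proof. by move=> mg fg lf; apply: (L2_le mg lf); apply: ae_imp fg => x _ ->. Qed.

Lemma L2_mul f g : L2 f -> L2 g -> intg (fun x => f x * g x).
Proof.
move=> [mf iF] [mg ig]; apply: (integrable_ae_le _ (integrable_add iF ig)).
  exact: measurable_funM.
by apply: ae_all => x _; rewrite ler_norml; apply/andP; split; nra.
Qed.

Lemma L2_0 : L2 (0 : T -> R).
Proof.
split; first exact: measurable_cst.
rewrite (_ : _ \o _ = cst 0%E); first exact: integrable0.
by apply/funext => x /=; rewrite expr0n.
Qed.

Lemma L2P a f g : L2 f -> L2 g -> L2 (a *: f + g).
Proof.
move=> lf lg; have [mf iF] := lf; have [mg ig] := lg.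
have mfg : measurable_fun D (a *: f + g).
  by apply: measurable_funD => //; exact: measurable_funM.
split => //; apply: (integrable_ae_le _ (integrable_add (integrable_scale (2 * a ^+ 2) iF)
  (integrable_scale 2 ig))); first exact: measurable_funX.
apply: ae_all => x _; rewrite ger0_norm ?sqr_ge0//.
rewrite [(a *: f + g) x](_ : _ = a * f x + g x)//.
by have := sqr_ge0 (a * f x - g x); nra.
Qed.

Lemma L2_lin : lin_closed L2.
Proof. by split; [exact: L2_0|exact: L2P]. Qed.

Lemma L2_norm f : L2 f -> L2 (fun x => `|f x|).
Proof.
move=> lf; apply: (L2_le _ lf); first by apply: measurableT_comp => //; case: lf.
by apply: ae_all => x _; rewrite normr_id.
Qed.

Lemma ip_psd : psd_form L2 ip.
Proof.
split.
- by move=> f g _ _; rewrite /ip; under eq_Rintegral do rewrite mulrC.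
- move=> a f g h lf lg lh; have fh := L2_mul lf lh; have gh := L2_mul lg lh.
  rewrite /ip -RintegralZl// -RintegralD//; last exact: integrable_scale.
  by apply: eq_Rintegral => x _; rewrite mulrDl -mulrA.
- by move=> f _; apply: Rintegral_ge0 => x _; rewrite -expr2 sqr_ge0.
Qed.

Lemma ip_sqr f : ip f f = I (fun x => f x ^+ 2).
Proof. by rewrite /ip; apply: eq_Rintegral => x _; rewrite expr2. Qed.

Lemma ip_eq_ae f f' g g' : L2 f -> L2 f' -> L2 g -> L2 g' ->
  ae (fun x => f x = f' x) -> ae (fun x => g x = g' x) -> ip f g = ip f' g'.
Proof.
move=> lf lf' lg lg' ff' gg'; apply: eq_Rintegral_ae; [exact: L2_mul..|].
by apply: ae_imp2 ff' gg' => x _ -> ->.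
Qed.

Lemma ip_eq0 f : L2 f -> ip f f = 0 -> ae (fun x => f x = 0).
Proof.
move=> lf; rewrite ip_sqr => f0.
have h : ae (fun x => 0 <= f x ^+ 2) by apply: ae_all => x _; rewrite sqr_ge0.
by apply: ae_imp (Rintegral_eq0_ae lf.2 h f0) => x _ /eqP; rewrite sqrf_eq0 => /eqP.
Qed.

Lemma ip_le f g : L2 f -> L2 g -> ae (fun x => `|f x| <= `|g x|) -> ip f f <= ip g g.
Proof.
move=> lf lg fg; rewrite !ip_sqr; apply: Rintegral_le_ae; [exact: lf.2|exact: lg.2|].
apply: ae_imp fg => x _ h.
by rewrite -(real_normK (num_real (f x))) -(real_normK (num_real (g x))) ler_pXn2r ?nnegrE.
Qed.

End real_integral.

Section riesz_fischer.
Context d {T : measurableType d} {R : realType}.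
Variables (mu : {measure set T -> \bar R}) (D : set T).
Hypothesis mD : measurable D.

Local Notation ae P := {ae mu, forall x, D x -> P x}.
Local Notation intg f := (mu.-integrable D (EFin \o f)).
Local Notation I f := (\int[mu]_(x in D) f x).
Local Notation L2 := (L2 mu D).
Local Notation ip := (ip mu D).

(** Fatou's lemma as a closure property: an upper bound on integrals, possibly
    improving along the sequence, passes to the limit together with
    integrability. *)
Lemma fatou_ae (g : nat -> T -> R) (f : T -> R) (c : R) :
  (forall k, intg (g k)) -> (forall k x, D x -> 0 <= g k x) ->
  measurable_fun D f -> ae (fun x => g k x @[k --> \oo] --> f x) ->
  (forall e : R, 0 < e -> exists N, forall k, (N <= k)%N -> I (g k) <= c + e) ->
  intg f /\ I f <= c.
Proof.
move=> ig g0 mf gf gc.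
have f0 : ae (fun x => 0 <= f x).
  apply: ae_imp gf => x Dx h; rewrite -(cvg_lim _ h)//; apply: limr_ge.
    exact: cvgP h.
  by apply: nearW => k; exact: g0.
apply: (integrable_lee mD mf f0); apply/lee_addgt0Pr => e e0; rewrite -EFinD.
have [N hN] := gc _ e0.
pose u k x := (g (k + N)%N x)%:E.
have mu_ k : measurable_fun D (u k) by exact: measurable_int (ig _).
have -> : (\int[mu]_(x in D) (f x)%:E = \int[mu]_(x in D) limn_einf (u ^~ x))%E.
  apply: ae_eq_integral => //; first exact/measurable_EFinP.
    rewrite /limn_einf; apply: measurableT_comp => //.
    by apply: measurable_fun_limn_esup => k; exact: measurableT_comp.
  apply: filterS gf => x h Dx.
  have ux : u k x @[k --> \oo] --> (f x)%:E.
    apply: cvg_EFin; first exact: nearW.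
    by have := h Dx; rewrite -(cvg_shiftn N).
  by rewrite (is_cvg_limn_einfE (cvgP _ ux)); apply/esym/cvg_lim.
apply: le_trans (fatou _ _ _ _) _ => //.
  by move=> k x Dx; rewrite lee_fin g0.
rewrite limn_einf_lim; apply: lime_le; first exact: is_cvg_einfs.
apply: nearW => k; apply: (@le_trans _ _ (\int[mu]_(x in D) u k x)%E).
  by apply: ereal_inf_lbound; exists k => //=.
by rewrite Rintegral_EFin// lee_fin hN// leq_addl.
Qed.

(** Summability of [4 ^ k * |a k| ^ 2] in L1 forces almost everywhere geometric
    decay. *)
Lemma L2_fast_decay (a : nat -> T -> R) :
  (forall k, L2 (a k)) -> (forall k, ip (a k) (a k) <= 8^-1 ^+ k) ->
  ae (fun x => exists C, forall k, `|a k x| <= C * 2^-1 ^+ k).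
Proof.
move=> la ha; pose g k x := (4 ^+ k * a k x ^+ 2)%:E.
have ig k : mu.-integrable D (g k) by apply: (integrable_scale mD); exact: (la k).2.
have g0 k x : D x -> (0 <= g k x)%E.
  by move=> _; rewrite lee_fin; apply: mulr_ge0; [exact: exprn_ge0|exact: sqr_ge0].
have mg k : measurable_fun D (g k) by exact: measurable_int (ig k).
have fin : (\int[mu]_(x in D) (\sum_(k <oo) g k x) < +oo)%E.
  rewrite integral_nneseries//.
  apply: (@le_lt_trans _ _ (\sum_(k <oo) (2^-1 ^+ k)%:E)%E).
    apply: lee_nneseries => [k _ _|k _].
      by apply: integral_ge0 => x; exact: g0.
    rewrite Rintegral_EFin//; last exact: ig.
    rewrite lee_fin RintegralZl//; last exact: (la k).2.
    have := ha k; rewrite ip_sqr => h.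
    have -> : 2^-1 ^+ k = 4 ^+ k * 8^-1 ^+ k :> R.
      by rewrite -exprMn; congr (_ ^+ k); lra.
    by rewrite ler_wpM2l// exprn_ge0.
  apply: (@le_lt_trans _ _ 2%:E); last by rewrite ltry.
  apply: lime_le.
    by apply: is_cvg_nneseries => k _ _; rewrite lee_fin exprn_ge0.
  apply: nearW => n; rewrite sumEFin lee_fin.
  have := @geometric_le_lim R n 1 2^-1 ler01.
  rewrite invr_gt0 ger0_norm// invf_lt1// ltr1n => /(_ (ltr0n _ 2) isT).
  have -> : 1 / (1 - 2^-1) = 2 :> R by field.
  by apply: le_trans; rewrite /series/=; apply: ler_sum => k _; rewrite mul1r.
have mS : measurable_fun D (fun x => \sum_(k <oo) g k x)%E.
  apply: (@ge0_emeasurable_sum _ _ _ D g xpredT) => [k x Dx _|k _]; [exact: g0|exact: mg].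
have iS : mu.-integrable D (fun x => \sum_(k <oo) g k x)%E.
  apply/integrableP; split => //.
  rewrite (eq_integral (fun x => \sum_(k <oo) g k x)%E)// => x /set_mem Dx.
  by rewrite gee0_abs// nneseries_ge0// => k _ _; exact: g0.
have := integrable_ae mD iS; apply: filterS => x h Dx.
have /fineK hs := h Dx; set s := fine _ in hs.
have s0 : 0 <= s by rewrite -lee_fin hs nneseries_ge0// => k _ _; exact: g0.
exists (s + 1) => k.
have : (g k x <= s%:E)%E.
  rewrite hs; apply: le_trans (nneseries_lim_ge k.+1 _); last by move=> *; exact: g0.
  rewrite big_nat_recr//= leeDr// sume_ge0// => i _; exact: g0.
rewrite lee_fin => h1.
have p0 : 0 < 2^-1 ^+ k :> R by rewrite exprn_gt0// invr_gt0.
have h2 : 4 ^+ k = (2^-1 ^+ k) ^- 2 :> R.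
  by rewrite -exprM mulnC exprM -exprVn; congr (_ ^+ k); field.
rewrite h2 mulrC ler_pdivrMr ?exprn_gt0// in h1.
rewrite -(@ler_pXn2r _ 2) ?nnegrE ?mulr_ge0 ?addr_ge0 ?exprn_ge0//.
rewrite real_normK ?num_real//; apply: (le_trans h1).
by rewrite exprMn ler_wpM2r ?exprn_ge0//; nra.
Qed.

Lemma L2_fast_cvg (u : nat -> T -> R) (f : T -> R) : (forall k, L2 (u k)) -> L2 f ->
  (forall k, ip (u k - f) (u k - f) <= 8^-1 ^+ k) ->
  ae (fun x => u k x @[k --> \oo] --> f x).
Proof.
move=> lu lf h.
have := L2_fast_decay (fun k => lin_closedB (L2_lin mu mD) (lu k) lf) h.
apply: ae_imp => x Dx [C hC]; apply/cvgrPdist_le => e e0.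
have /cvgrPdist_le/(_ _ e0) : geometric (`|C|) (2^-1 : R) @ \oo --> (0 : R).
  by apply: cvg_geometric; rewrite ger0_norm// invf_lt1// ltr1n.
apply: filterS => k; rewrite sub0r normrN /= => hk; rewrite distrC.
apply: le_trans (hC k) _; apply: le_trans hk.
by rewrite normrM normr_id (ger0_norm (exprn_ge0 _ _))// ler_wpM2r ?exprn_ge0// ler_norm.
Qed.

(** Riesz-Fischer: a fast subsequence converges almost everywhere, and Fatou
    turns this into convergence in L2. *)
Theorem L2_complete : form_complete L2 ip.
Proof.
move=> u lu cu.
have hk k : exists N, forall i j, (N <= i)%N -> (N <= j)%N ->
    ip (u i - u j) (u i - u j) <= 8^-1 ^+ k by apply: cu; rewrite exprn_gt0.
have [N hN] := choice hk.
pose n k := (k + \max_(i < k.+1) N i)%N.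
have nN k i : (i <= k)%N -> (N i <= n k)%N.
  move=> ik; apply: leq_trans (leq_addl _ _).
  by exact: (@leq_bigmax _ (fun j : 'I_k.+1 => N j) (Ordinal (ik : (i < k.+1)%N))).
pose y k := u (n k).
have ly k : L2 (y k) by exact: lu.
pose f x := fine (limn_esup (fun k => (y k x)%:E)).
have mf : measurable_fun D f.
  apply: (measurableT_comp (fine_measurable measurableT)).
  by apply: measurable_fun_limn_esup => k; apply/measurable_EFinP; case: (ly k).
have yf : ae (fun x => y k x @[k --> \oo] --> f x).
  have : ae (fun x => exists C, forall k, `|(y k.+1 - y k) x| <= C * 2^-1 ^+ k).
    apply: (@L2_fast_decay (fun k => y k.+1 - y k)) => k; first exact: (lin_closedB (L2_lin mu mD)).
    by apply: hN; apply: nN.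
  apply: ae_imp => x Dx [C hC].
  have cy : cvgn (y ^~ x).
    have -> : y ^~ x = (fun n => y 0%N x + series (telescope (y ^~ x)) n).
      by apply/funext => j; rewrite -eq_sum_telescope.
    apply: is_cvgD; first exact: is_cvg_cst.
    apply: normed_cvg; apply: (@series_le_cvg _ _ (geometric `|C| 2^-1)) => //.
    - by move=> k; exact: normr_ge0.
    - by move=> k; exact: geometric_ge0.
    - move=> k; apply: le_trans (hC k) _.
      by rewrite /= ler_wpM2r ?exprn_ge0// ler_norm.
    - by apply: is_cvg_geometric_series; rewrite ger0_norm// invf_lt1// ltr1n.
  have ey : (y k x)%:E @[k --> \oo] --> (limn (y ^~ x))%:E.
    by apply: cvg_EFin => //; exact: nearW.
  by rewrite /f (cvg_limn_einf_sup ey).2.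
have key e : 0 < e -> exists M, forall k, (M <= k)%N ->
    intg (fun x => (f x - u k x) ^+ 2) /\ I (fun x => (f x - u k x) ^+ 2) <= e.
  move=> e0; have [M hM] := cu _ e0.
  exists M => k Mk.
  apply: (@fatou_ae (fun j x => (y j x - u k x) ^+ 2)).
  - by move=> j; exact: (lin_closedB (L2_lin mu mD) (ly j) (lu k)).2.
  - by move=> j x _; exact: sqr_ge0.
  - by apply: measurable_funX; apply: measurable_funB => //; case: (lu k).
  - apply: ae_imp yf => x _ h.
    by under eq_fun do rewrite expr2; rewrite expr2; apply: cvgM; apply: cvgB => //; exact: cvg_cst.
  - move=> d' d0; exists M => j Mj; rewrite -ip_sqr.
    apply: (@le_trans _ _ e); last by rewrite lerDl ltW.
    by apply: hM => //; apply: leq_trans Mj _; exact: leq_addr.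
have lf : L2 f.
  have [M hM] := key 1 ltr01.
  have lfu : L2 (f - u M).
    split; last exact: (hM _ (leqnn _)).1.
    by apply: measurable_funB => //; case: (lu M).
  by have := lin_closedD (L2_lin mu mD) lfu (lu M); rewrite subrK.
exists f => // e /key[M hM]; exists M => k Mk.
by rewrite (form_sqrC (L2_lin mu mD) (ip_psd mu mD))// ip_sqr; exact: (hM _ Mk).2.
Qed.
End riesz_fischer.

(** * Lebesgue measure on row vectors *)

Section rV_measurability.
Context {R : realType} {n : nat}.
Implicit Types (x y : 'rV[R]_n).

Lemma measurable_rect (A : 'I_n -> set R) : (forall i, measurable (A i)) ->
  measurable [set x : 'rV[R]_n | forall i, A i (x ord0 i)].
Proof.
move=> mA.
rewrite (_ : [set _ | _] = \big[setI/setT]_(i < n)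
    ((fun x : 'rV[R]_n => x ord0 i) @^-1` A i)).
  apply: bigsetI_measurable => i _.
  by rewrite -[X in measurable X]setTI; exact: measurable_coord.
apply/seteqP; split => [x Ax|x]; rewrite -bigcap_seq.
  by move=> i _; exact: Ax.
by move=> Ax i; apply: Ax; rewrite /= mem_index_enum.
Qed.

Lemma rV_ballP x y (e : R) : 0 < e ->
  ball x e y <-> forall i, `|x ord0 i - y ord0 i| < e.
Proof.
move=> e0; split=> [[_ h] i|h]; first exact: h.
by split => // i j; rewrite (ord1 i); exact: h.
Qed.

Definition rat_box (p : 'rV[rat]_n * nat) : set 'rV[R]_n :=
  [set x | forall i, `|ratr (p.1 ord0 i) - x ord0 i| < p.2.+1%:R^-1].

Definition rat_cbox (p : 'rV[rat]_n * nat) : set 'rV[R]_n :=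
  [set x | forall i, `|ratr (p.1 ord0 i) - x ord0 i| <= p.2.+1%:R^-1].

Lemma open_rat_box (U : set 'rV[R]_n) x : open U -> U x ->
  exists2 p, rat_box p x & rat_cbox p `<=` U.
Proof.
move=> oU Ux.
have /nbhs_ballP[e /= e0 eU] : nbhs x U by exact: open_nbhs_nbhs.
pose k := Num.truncn (2 / e); pose r : R := k.+1%:R^-1.
have r0 : 0 < r by rewrite invr_gt0.
have re : r < e / 2.
  by rewrite -[e / 2]invf_div ltf_pV2 ?posrE ?divr_gt0//; exact: truncnS_gt.
have hq i : exists q : rat, `|x ord0 i - ratr q| < r.
  have [a [h [q _ qa]]] := dense_rat (ex_intro _ _ (ballxx (x ord0 i) r0))
    (ball_open (x ord0 i) r).
  by exists q; rewrite qa.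
have [q hx] := choice hq.
exists (\row_i q i, k) => [i|y yb].
  by rewrite mxE distrC; exact: hx.
apply: eU; apply/rV_ballP => // i.
have := yb i; rewrite /= mxE -/r => h1.
have h2 := hx i; rewrite -(subrKA (ratr (q i))).
by apply: le_lt_trans (ler_normD _ _) _; lra.
Qed.

(** Measurability is defined through the coordinates, and an open set is the
    union of the rational boxes it contains, of which there are countably
    many. *)
Lemma open_measurable_rV (U : set 'rV[R]_n) : open U -> measurable U.
Proof.
move=> oU; pose F p := if `[< rat_cbox p `<=` U >] then rat_box p else set0.
have -> : U = \bigcup_p F p.
  apply/seteqP; split => [x Ux|x [p _]]; last first.
    rewrite /F; case: asboolP => // pU bx; apply: pU => i; exact/ltW/bx.
  have [p px pU] := open_rat_box oU Ux.
  by exists p => //; rewrite /F; case: asboolP.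
apply: countable_bigcupT_measurable; first exact: countableP.
move=> p; rewrite /F; case: ifP => // _.
apply: (@measurable_rect (fun i => ball (ratr (p.1 ord0 i) : R) p.2.+1%:R^-1)) => i.
exact: measurable_ball.
Qed.

Lemma continuous_measurable_rV (f : 'rV[R]_n -> R) : continuous f ->
  measurable_fun setT f.
Proof.
move=> /continuousP cf; apply: (measurability _ (RGenOpens.measurableE R)) => //.
move=> _ [_ [a [b ->] <-]]; rewrite setTI; apply: open_measurable_rV.
by apply: cf; exact: interval_open.
Qed.

End rV_measurability.

Section bounded_support.
Context {R : realType}.

(** Bounded measurable functions supported in a fixed interval, resp. cube: a
    class on which every integral below makes sense and which is stable under
    slicing and under partial integration. *)
Definition bdd1 (L : R) (u : R -> R) :=
  [/\ measurable_fun setT u, exists M, forall t, `|u t| <= M &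
      forall t, L < `|t| -> u t = 0].

Definition bddn n (L : R) (f : 'rV[R]_n -> R) :=
  [/\ measurable_fun setT f, exists M, forall x, `|f x| <= M &
      forall x : 'rV[R]_n, (exists i, L < `|x ord0 i|) -> f x = 0].

Lemma bdd1_integrable L u : bdd1 L u ->
  (@lebesgue_measure R).-integrable setT (EFin \o u).
Proof.
move=> [mu [M hM] u0].
have -> : u = u \_ `[-L, L].
  apply/funext => t; rewrite patchE; case: ifPn => //; rewrite notin_setE /= in_itv/=.
  by rewrite -ler_norml => /negP; rewrite -ltNge => /u0.
rewrite -restrict_EFin; have mI : measurable (`[-L, L]%classic : set (measurableTypeR R)) by [].
apply: (@integrable_mkcond _ _ _ (@lebesgue_measure R) _ (EFin \o u) mI).1.
apply: measurable_bounded_integrable => //.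
- pose J : set R := `[-L, L]%classic.
  have h : (lebesgue_measure J < +oo)%E.
    by rewrite lebesgue_measure_itv/=; case: ifP => _; rewrite ltry.
  exact: h.
- exact: measurable_funTS.
by exists M; split; [exact: num_real|move=> x Mx t _; exact: le_trans (hM _) (ltW Mx)].
Qed.

Lemma bdd1_Rintegral_le L u (M : R) : bdd1 L u -> (forall t, `|u t| <= M) ->
  `|\int[lebesgue_measure]_t u t| <= M * fine (lebesgue_measure (`[-L, L]%classic : set R)).
Proof.
move=> bu hM; have [mu _ u0] := bu; pose J : set (measurableTypeR R) := `[-L, L]%classic.
have mJ : measurable J by exact: measurable_itv.
have Jfin : (lebesgue_measure J < +oo)%E.
  by rewrite lebesgue_measure_itv/=; case: ifP => _; rewrite ltry.
have -> : \int[lebesgue_measure]_t u t = \int[lebesgue_measure]_(t in J) u t.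
  rewrite [RHS]Rintegral_mkcond; apply: eq_Rintegral => t _; rewrite patchE.
  case: ifPn => //; rewrite notin_setE /J /= in_itv/=.
  by rewrite -ler_norml => /negP; rewrite -ltNge => /u0.
have iJ : lebesgue_measure.-integrable J (EFin \o cst M).
  apply: measurable_bounded_integrable => //.
  by exists `|M|; split; [exact: num_real|move=> x Mx t _; exact: ltW].
have iu := integrableS measurableT mJ (@subsetT _ _) (bdd1_integrable bu).
rewrite -(Rintegral_cst lebesgue_measure mJ); apply: (normr_Rintegral_le mJ iu iJ).
by apply: ae_all => t _; exact: hM.
Qed.

Lemma lebesgue_rV_cube n (L : R) :
  (lebesgue_rV n [set x : 'rV[R]_n | forall i, (x ord0 i \in `[- L, L])%R] < +oo)%E.
Proof.
rewrite (@lebesgue_rV_box _ _ (fun=> `[-L, L]%classic))//.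
rewrite ltey_eq; apply/orP; left.
apply: (@big_ind _ (fun x : \bar R => x \is a fin_num)) => [//|x y|i _]; first exact: fin_numM.
by rewrite lebesgue_measure_itv/=; case: ifP.
Qed.

Lemma bddn_integrable n L f : bddn L f ->
  (lebesgue_rV n).-integrable setT (EFin \o f).
Proof.
move=> [mf [M hM] f0]; pose C := [set x : 'rV[R]_n | forall i, x ord0 i \in `[- L, L]].
have mC : measurable C by apply: (@measurable_rect _ _ (fun=> `[-L, L]%classic)).
have -> : f = f \_ C.
  apply/funext => x; rewrite patchE; case: ifPn => //; rewrite notin_setE /= => h.
  apply: f0; apply: contrapT => h'; apply: h => i; rewrite in_itv/= -ler_norml leNgt.
  by apply/negP => h; apply: h'; exists i.
rewrite -restrict_EFin; apply: (@integrable_mkcond _ _ _ (lebesgue_rV n) _ (EFin \o f) mC).1.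
apply: measurable_bounded_integrable => //.
- exact: lebesgue_rV_cube.
- exact: measurable_funTS.
by exists M; split; [exact: num_real|move=> x Mx t _; exact: le_trans (hM _) (ltW Mx)].
Qed.

Section closure.
Variables (n : nat) (L : R).
Implicit Types f g : 'rV[R]_n -> R.

Lemma bddnM f g : bddn L f -> bddn L g -> bddn L (fun x => f x * g x).
Proof.
move=> [mf [M hM] f0] [mg [K hK] _]; split; first exact: measurable_funM.
  by exists (M * K) => x; rewrite normrM ler_pM.
by move=> x /f0 ->; rewrite mul0r.
Qed.

Lemma bddn_mulb (chi f : 'rV[R]_n -> R) : measurable_fun setT chi -> (exists K, forall x, `|chi x| <= K) ->
  bddn L f -> bddn L (fun x => chi x * f x).
Proof.
move=> mc [K hK] [mf [M hM] f0]; split; first exact: measurable_funM.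
  by exists (K * M) => x; rewrite normrM ler_pM.
by move=> x /f0 ->; rewrite mulr0.
Qed.

Lemma bddnZ a f : bddn L f -> bddn L (fun x => a * f x).
Proof.
move=> [mf [M hM] f0]; split; first exact: measurable_funM.
  by exists (`|a| * M) => x; rewrite normrM ler_pM.
by move=> x /f0 ->; rewrite mulr0.
Qed.

Lemma bddnX f : bddn L f -> bddn L (fun x => f x ^+ 2).
Proof. by move=> bf; under eq_fun do rewrite expr2; exact: bddnM. Qed.

End closure.

End bounded_support.

Section slicing.
Context {R : realType}.
Local Notation leb := (@lebesgue_measure R).
Local Notation lebn n := (@lebesgue_rV R n).

Section slices.
Variables (n : nat) (L : R).
Implicit Types (f : 'rV[R]_n.+1 -> R).

Lemma rV_cons0 (t : R) (y : 'rV[R]_n) : rV_cons (t, y) ord0 ord0 = t.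
Proof. by rewrite mxE unlift_none. Qed.

Lemma rV_consS (t : R) (y : 'rV[R]_n) j : rV_cons (t, y) ord0 (lift ord0 j) = y ord0 j.
Proof. by rewrite mxE liftK. Qed.

Lemma rV_consD0 (t s : R) (y : 'rV[R]_n) :
  rV_cons (t, y) + s *: delta_mx ord0 ord0 = rV_cons (t + s, y).
Proof.
apply/rowP => i; rewrite !mxE/=; case: (unliftP ord0 i) => [j ->|->].
  by rewrite mulr0 addr0.
by rewrite mulr1.
Qed.

Lemma rV_consDS (t s : R) (y : 'rV[R]_n) j :
  rV_cons (t, y) + s *: delta_mx ord0 (lift ord0 j) =
  rV_cons (t, y + s *: delta_mx ord0 j).
Proof.
apply/rowP => i; rewrite !mxE/=; case: (unliftP ord0 i) => [k ->|->].
  by rewrite !mxE (inj_eq lift_inj).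
by rewrite mulr0 addr0.
Qed.

Lemma bddn_slice1 f y : bddn L f -> bdd1 L (fun t => f (rV_cons (t, y))).
Proof.
move=> [mf [M hM] f0]; split.
- apply: (measurableT_comp mf); apply: (measurableT_comp (@measurable_rV_cons R n)).
  exact: measurable_pair2.
- by exists M.
- by move=> t tL; apply: f0; exists ord0; rewrite rV_cons0.
Qed.

Lemma bddn_slicen f t : bddn L f -> bddn L (fun y => f (rV_cons (t, y))).
Proof.
move=> [mf [M hM] f0]; split.
- apply: (measurableT_comp mf); apply: (measurableT_comp (@measurable_rV_cons R n)).
  exact: measurable_pair1.
- by exists M.
- by move=> y [i yi]; apply: f0; exists (lift ord0 i); rewrite rV_consS.
Qed.

Let prod_integrable f : bddn L f ->
  (leb \x lebn n)%E.-integrable setT (EFin \o (f \o @rV_cons R n)).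
Proof.
move=> bf; have := bddn_integrable bf; have [mf _ _] := bf.
move=> /integrableP[_ hf]; apply/integrableP; split.
  apply/measurable_EFinP; apply: (measurableT_comp mf); exact: measurable_rV_cons.
move: hf; rewrite ge0_integral_pushforward//=.
- exact: measurable_rV_cons.
- by apply/measurable_EFinP; exact: measurableT_comp.
Qed.

Lemma bddn_fubini2 f : bddn L f ->
  \int[lebn n.+1]_x f x = \int[lebn n]_y (\int[leb]_t f (rV_cons (t, y))).
Proof.
move=> bf; have pf := prod_integrable bf.
have [mf _ _] := bf.
rewrite /Rintegral; congr fine.
rewrite integral_pushforward//=; [|exact: measurable_rV_cons|exact/measurable_EFinP].
rewrite preimage_setT -integral21_prod_meas1//; apply: eq_integral => y _.
by rewrite /fubini_G Rintegral_EFin// ; exact: bdd1_integrable (bddn_slice1 y bf).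
Qed.

Lemma bddn_fubini1 f : bddn L f ->
  \int[lebn n.+1]_x f x = \int[leb]_t (\int[lebn n]_y f (rV_cons (t, y))).
Proof.
move=> bf; have pf := prod_integrable bf.
have [mf _ _] := bf.
rewrite /Rintegral; congr fine.
rewrite integral_pushforward//=; [|exact: measurable_rV_cons|exact/measurable_EFinP].
rewrite preimage_setT -integral12_prod_meas1//; apply: eq_integral => y _.
by rewrite /fubini_F Rintegral_EFin// ; exact: bddn_integrable (bddn_slicen y bf).
Qed.

Lemma bddn_int1 f : bddn L f -> bddn L (fun y => \int[leb]_t f (rV_cons (t, y))).
Proof.
move=> bf; have pf := prod_integrable bf; have [mf [M hM] f0] := bf.
pose K := fine (leb `[-L, L]%classic).
have h y : `|\int[leb]_t f (rV_cons (t, y))| <= M * K.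
  by apply: bdd1_Rintegral_le; [exact: bddn_slice1|move=> t; exact: hM].
split.
- apply: (measurableT_comp (fine_measurable measurableT)).
  exact: (measurable_fubini_G pf).
- by exists (M * K).
- move=> y [i yi]; rewrite (_ : (fun t => _) = cst 0) ?Rintegral_cst ?mul0r//.
  by apply/funext => t /=; apply: f0; exists (lift ord0 i); rewrite rV_consS.
Qed.

End slices.

End slicing.

Section lines.
Context {R : realType}.
Local Notation leb := (@lebesgue_measure R).
Local Notation lebn n := (@lebesgue_rV R n).

Lemma itv_norm_le (a b s : R) : s \in `[a, b] -> `|s| <= Num.max `|a| `|b|.
Proof.
rewrite in_itv/= => /andP[as_ sb]; rewrite le_max; apply/orP.
have [s0|s0] := leP 0 s.
  by right; rewrite ger0_norm// (le_trans sb)// ler_norm.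
by left; rewrite ltr0_norm// -normrN (le_trans _ (ler_norm _))// lerN2.
Qed.

Lemma bdd1_patch (a b : R) (u : R -> R) :
  measurable_fun setT u -> (exists M, forall t, `|u t| <= M) ->
  bdd1 (Num.max `|a| `|b|) (u \_ `[a, b]).
Proof.
move=> mu [M hM]; split.
- by apply/(measurable_restrictT _ _).1; [exact: measurable_itv|exact: measurable_funTS].
- exists M => t; rewrite patchE; case: ifP => // _.
  by rewrite normr0 (le_trans _ (hM t)).
- move=> t tab; rewrite patchE memNset//= => /itv_norm_le.
  by rewrite leNgt tab.
Qed.

Lemma bdd2_fubini (L : R) (h : R * R -> R) :
  measurable_fun setT h -> (exists M, forall z, `|h z| <= M) ->
  (forall z, L < `|z.1| \/ L < `|z.2| -> h z = 0) ->
  \int[leb]_t (\int[leb]_s h (t, s)) = \int[leb]_s (\int[leb]_t h (t, s)).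
Proof.
move=> mh [M hM] h0; pose J : set (measurableTypeR R) := `[-L, L]%classic.
have mJ : measurable J by exact: measurable_itv.
have Jfin : (leb J < +oo)%E.
  by rewrite lebesgue_measure_itv/=; case: ifP => _; rewrite ltry.
have hJ t : ~ J t -> L < `|t|.
  by rewrite /J /= in_itv/= -ler_norml => /negP; rewrite -ltNge.
have ih : (leb \x leb)%E.-integrable setT (EFin \o h).
  have -> : h = h \_ (J `*` J).
    apply/funext => z; rewrite patchE; case: ifPn => //; rewrite notin_setE /= => nz.
    apply: h0; apply: contrapT => /not_orP[z1 z2]; apply: nz.
    by split; apply: contrapT => /hJ.
  rewrite -restrict_EFin; apply: (@integrable_mkcond _ _ _ (leb \x leb)%E _ (EFin \o h) _).1.
    exact: measurableX.
  apply: measurable_bounded_integrable => //.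
  - exact: measurableX.
  - have := @product_measure1E _ _ _ _ _ leb leb J J mJ mJ => /= ->.
    by rewrite lte_mul_pinfty// ge0_fin_numE.
  - exact: measurable_funTS.
  - by exists M; split; [exact: num_real|move=> x Mx t _; exact: le_trans (hM _) (ltW Mx)].
have b1 t : bdd1 L (fun s => h (t, s)).
  split; [|by exists M|by move=> s sL; apply: h0; right].
  by apply: (measurableT_comp mh); exact: measurable_pair1.
have b2 s : bdd1 L (fun t => h (t, s)).
  split; [|by exists M|by move=> t tL; apply: h0; left].
  by apply: (measurableT_comp mh); exact: measurable_pair2.
rewrite /Rintegral; congr fine.
transitivity (\int[leb]_t \int[leb]_s (h (t, s))%:E)%E.
  by apply: eq_integral => t _; rewrite Rintegral_EFin//; exact: bdd1_integrable (b1 t).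
rewrite (Fubini ih).
by apply: eq_integral => s _; rewrite /= Rintegral_EFin//; exact: bdd1_integrable (b2 s).
Qed.

(** [g] is a partial derivative of [f] in the i-th direction, in the integrated
    form: this makes sense for merely measurable functions and passes through
    partial integration by Fubini's theorem, without differentiating under the
    integral sign. *)
Definition line_prim n (L : R) (i : 'I_n) (f g : 'rV[R]_n -> R) :=
  [/\ bddn L f, bddn L g & forall x (a b : R), a <= b ->
    f (x + b *: delta_mx ord0 i) - f (x + a *: delta_mx ord0 i) =
    \int[leb]_(s in `[a, b]) g (x + s *: delta_mx ord0 i)].

Lemma line_prim_slice n L (j : 'I_n) f g t : line_prim L (lift ord0 j) f g ->
  line_prim L j (fun y => f (rV_cons (t, y))) (fun y => g (rV_cons (t, y))).
Proof.
move=> [bf bg fg]; split; [exact: bddn_slicen|exact: bddn_slicen|].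
move=> y a b ab; have := fg (rV_cons (t, y)) a b ab; rewrite !rV_consDS => ->.
by apply: eq_Rintegral => s _; rewrite rV_consDS.
Qed.

Lemma measurable_line n (x : 'rV[R]_n) i :
  measurable_fun setT (fun s : R => x + s *: delta_mx ord0 i).
Proof.
apply: measurable_fun_rV => k.
under eq_fun do rewrite !mxE.
apply: measurable_funD => //; exact: measurable_funM.
Qed.

Lemma bddn_weight n L (w : R -> R) (f : 'rV[R]_n.+1 -> R) :
  measurable_fun setT w -> (exists K, forall t, `|w t| <= K) -> bddn L f ->
  bddn L (fun x => w (x ord0 ord0) * f x).
Proof.
move=> mw [K hK] [mf [M hM] f0]; split.
- by apply: measurable_funM => //; apply: (measurableT_comp mw); exact: measurable_coord.
- by exists (K * M) => x; rewrite normrM ler_pM.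
- by move=> x /f0 ->; rewrite mulr0.
Qed.

Lemma bddn_avg n L (w : R -> R) (f : 'rV[R]_n.+1 -> R) :
  measurable_fun setT w -> (exists K, forall t, `|w t| <= K) -> bddn L f ->
  bddn L (fun y => \int[leb]_t (w t * f (rV_cons (t, y)))).
Proof.
move=> mw bw bf; have := bddn_int1 (bddn_weight mw bw bf).
by under eq_fun do under eq_Rintegral do rewrite rV_cons0.
Qed.

(** Fubini's theorem exchanges the average in the first coordinate and the
    integration along the line. *)
Lemma line_prim_avg n L (j : 'I_n) (w : R -> R) f g :
  measurable_fun setT w -> (exists K, forall t, `|w t| <= K) ->
  line_prim L (lift ord0 j) f g ->
  line_prim L j (fun y => \int[leb]_t (w t * f (rV_cons (t, y))))
    (fun y => \int[leb]_t (w t * g (rV_cons (t, y)))).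
Proof.
move=> mw bw [bf bg fg]; split; [exact: bddn_avg|exact: bddn_avg|].
move=> y a b ab.
have iw h y' : bddn L h -> leb.-integrable setT (EFin \o (fun t => w t * h (rV_cons (t, y')))).
  move=> bh; apply: (@bdd1_integrable _ L).
  have := bddn_slice1 y' (bddn_weight mw bw bh).
  by under eq_fun do rewrite rV_cons0.
rewrite -RintegralB//; [|exact: iw|exact: iw].
pose J : set (measurableTypeR R) := `[a, b]%classic.
have mJ : measurable J by exact: measurable_itv.
pose h (z : R * R) := w z.1 * g (rV_cons (z.1, y + z.2 *: delta_mx ord0 j)) * \1_J z.2.
have [mg [M hM] g0] := bg; have [K hK] := bw.
transitivity (\int[leb]_t \int[leb]_s h (t, s)).
  apply: eq_Rintegral => t _; rewrite -mulrBr.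
  have := fg (rV_cons (t, y)) a b ab; rewrite !rV_consDS => ->.
  rewrite Rintegral_mkcond -RintegralZl//.
    apply: eq_Rintegral => s _; rewrite /h /= patchE indicE rV_consDS -mulrA.
    by case: ifP => _; rewrite ?mulr1 ?mulr0.
  apply: (bdd1_integrable (bdd1_patch _ _ _ _)); last by exists M.
  by apply: (measurableT_comp mg); exact: measurable_line.
rewrite (@bdd2_fubini (Num.max `|L| (Num.max `|a| `|b|))).
- rewrite [RHS]Rintegral_mkcond; apply: eq_Rintegral => s _; rewrite patchE /h /= indicE.
  case: ifP => _.
    by apply: eq_Rintegral => t _; rewrite mulr1.
  by under eq_Rintegral do rewrite mulr0; rewrite Rintegral_cst ?mul0r.
- apply: measurable_funM; last first.
    by apply: (measurableT_comp (measurable_indic mJ)).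
  apply: measurable_funM; first by apply: (measurableT_comp mw).
  apply: (measurableT_comp mg); apply: (measurableT_comp (@measurable_rV_cons R n)).
  apply/measurable_fun_pairP; split; first exact: measurable_fst.
  by apply: (measurableT_comp (measurable_line y j)).
- exists (K * M) => z; rewrite /h normrM normrM indicE.
  apply: (@le_trans _ _ (K * M * 1)); last by rewrite mulr1.
  apply: ler_pM; [exact: mulr_ge0|exact: normr_ge0|exact: ler_pM|].
  by case: (_ \in _); rewrite ?normr1 ?normr0.
- move=> [t s] /= [tL|sL].
    rewrite /h /= g0 ?mulr0 ?mul0r//; exists ord0; rewrite rV_cons0.
    by apply: le_lt_trans tL; rewrite le_max ler_norm.
  rewrite /h indicE memNset ?mulr0//= => /itv_norm_le; rewrite leNgt => /negP; apply.
  by apply: le_lt_trans sL; rewrite le_max lexx orbT.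
Qed.

(** On each line in the i-th direction the integral of [g] is the increment of
    [f] between two points outside its support. *)
Lemma line_prim_int0 n L (i : 'I_n) f g : line_prim L i f g -> \int[lebn n]_x g x = 0.
Proof.
elim: n => [|n IH] in i f g *; first by case: i.
case: (unliftP ord0 i) => [j ->|->] h.
  rewrite (bddn_fubini1 (let: And3 _ bg _ := h in bg)).
  under eq_Rintegral do rewrite (IH _ _ _ (line_prim_slice _ h)).
  by rewrite Rintegral_cst ?mul0r.
have [[_ _ f0] bg fg] := h; have [_ _ g0] := bg.
rewrite (bddn_fubini2 bg).
rewrite (_ : (fun y => _) = cst 0) ?Rintegral_cst ?mul0r//.
apply/funext => y /=; pose K := `|L| + 1.
have LK : L < K by rewrite /K ltr_pwDr// ler_norm.
have K0 : 0 < K by rewrite ltr_wpDl.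
transitivity (\int[leb]_(t in `[- K, K]) g (rV_cons (t, y))).
  rewrite [RHS]Rintegral_mkcond; apply: eq_Rintegral => t _; rewrite patchE.
  case: ifPn => //; rewrite notin_setE /= in_itv/= -ler_norml => /negP; rewrite -ltNge => Kt.
  by apply: g0; exists ord0; rewrite rV_cons0 (lt_trans LK).
have := fg (rV_cons (0, y)) (- K) K; rewrite !rV_consD0 !add0r.
rewrite !f0 ?subr0; last 2 first.
- by exists ord0; rewrite rV_cons0 normrN gtr0_norm.
- by exists ord0; rewrite rV_cons0 gtr0_norm.
rewrite ge0_cp//; last exact: ltW.
move=> /(_ isT) ->; apply: eq_Rintegral => t _; by rewrite rV_consD0 add0r.
Qed.

End lines.

(** * A quantitative form of Rellich's compactness theorem *)

Section rellich.
Context {R : realType}.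
Local Notation leb := (@lebesgue_measure R).
Local Notation lebn n := (@lebesgue_rV R n).

Section interval.
Variables (p h : R).
Hypothesis h0 : 0 < h.
Let J : set (measurableTypeR R) := `[p, p + h[%classic.

Let mJ : measurable J. Proof. exact: measurable_itv. Qed.

Let lebJ : leb J = h%:E.
Proof.
by rewrite lebesgue_measure_itv/= lte_fin ltrDl h0 -EFinD (addrC p) addrK.
Qed.

Let lebJy : (leb J < +oo)%E. Proof. by rewrite lebJ ltry. Qed.

Let lebJf : fine (leb J) = h. Proof. by rewrite lebJ. Qed.

Lemma bounded_integrable_itv (u : R -> R) : measurable_fun setT u ->
  (exists M, forall t, `|u t| <= M) -> leb.-integrable J (EFin \o u).
Proof.
move=> mu [M hM]; apply: measurable_bounded_integrable => //.
- exact: measurable_funTS.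
by exists M; split; [exact: num_real|move=> x Mx t _; exact: le_trans (hM _) (ltW Mx)].
Qed.

Lemma bounded_L2_itv (u : R -> R) : measurable_fun setT u ->
  (exists M, forall t, `|u t| <= M) -> L2 leb J u.
Proof.
move=> mu [M hM]; split; first exact: measurable_funTS.
apply: bounded_integrable_itv; first exact: measurable_funX.
exists (M ^+ 2) => t; rewrite normrX ler_pXn2r ?nnegrE//.
exact: le_trans (hM 0).
Qed.

Lemma sqr_integral_itv (u : R -> R) : measurable_fun setT u ->
  (exists M, forall t, `|u t| <= M) ->
  (\int[leb]_(t in J) u t) ^+ 2 <= h * \int[leb]_(t in J) u t ^+ 2.
Proof.
move=> mu bu; have lu := bounded_L2_itv mu bu.
have l1 : L2 leb J (cst 1).
  by apply: bounded_L2_itv => //; exists 1 => t; rewrite normr1.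
have := form_cauchy_schwarz (L2_lin leb mJ) (ip_psd leb mJ) l1 lu.
rewrite -ip_sqr; congr (_ ^+ 2 <= _ * _).
  by apply: eq_Rintegral => t _; rewrite mul1r.
by rewrite /ip; under eq_Rintegral do rewrite mulr1; rewrite (Rintegral_cst leb mJ) lebJf mul1r.
Qed.

(** The mean is the best constant, and [u p] is a good one. *)
Lemma poincare_itv (u v : R -> R) : measurable_fun setT u -> measurable_fun setT v ->
  (exists M, forall t, `|u t| <= M) -> (exists M, forall t, `|v t| <= M) ->
  (forall a b, a <= b -> u b - u a = \int[leb]_(s in `[a, b]) v s) ->
  \int[leb]_(t in J) u t ^+ 2 <=
  h^-1 * (\int[leb]_(t in J) u t) ^+ 2 + h ^+ 2 * \int[leb]_(t in J) v t ^+ 2.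
Proof.
move=> mu mv bu bv uv; set V := \int[leb]_(t in J) v t ^+ 2.
have mnv : measurable_fun setT (fun t => `|v t|) by exact: measurableT_comp.
have bnv : exists M, forall t, `| `|v t| | <= M.
  by have [M hM] := bv; exists M => t; rewrite normr_id.
have osc t : J t -> (u t - u p) ^+ 2 <= h * V.
  rewrite /J/= in_itv/= => /andP[pt th]; rewrite uv//.
  have -> : V = \int[leb]_(t in J) `|v t| ^+ 2.
    by apply: eq_Rintegral => s _; rewrite real_normK// num_real.
  apply: le_trans (sqr_integral_itv mnv bnv).
  rewrite -[leLHS]real_normK ?num_real// ler_pXn2r ?nnegrE//; last first.
    by apply: Rintegral_ge0 => s _.
  pose I : set (measurableTypeR R) := `[p, t]%classic.
  have mI : measurable I by exact: measurable_itv.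
  have IJ : I `<=` J.
    move=> s; rewrite /I /J /= !in_itv/= => /andP[-> st] /=; exact: le_lt_trans th.
  have iv := integrableS mJ mI IJ (bounded_integrable_itv mv bv).
  apply: le_trans (le_normr_Rintegral mI iv) _.
  have inv := bounded_integrable_itv mnv bnv.
  rewrite Rintegral_mkcond [leRHS]Rintegral_mkcond.
  have mk (A : set (measurableTypeR R)) : measurable A -> A `<=` J ->
      leb.-integrable setT (EFin \o ((fun s => `|v s|) \_ A)).
    move=> mA AJ; rewrite -restrict_EFin.
    apply: (@integrable_mkcond _ _ _ leb _ (EFin \o (fun s => `|v s|)) mA).1.
    exact: integrableS inv.
  apply: (Rintegral_le_ae measurableT); [exact: mk|exact: mk|].
  apply: ae_all => s _; rewrite !patchE; case: ifPn => [/set_mem/IJ/mem_set ->//|_].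
  by case: ifP => _; [exact: normr_ge0|exact: lexx].
have lu := bounded_L2_itv mu bu.
have l1 : L2 leb J (cst (u p)).
  by apply: bounded_L2_itv => //; exists `|u p| => t.
have LL := L2_lin leb mJ; have PP := ip_psd leb mJ.
have lw := lin_closedB LL lu l1.
set U := \int[leb]_(t in J) u t.
have E1 : ip leb J (u - cst (u p)) (u - cst (u p)) =
    \int[leb]_(t in J) u t ^+ 2 - 2 * (u p * U) + u p ^+ 2 * h.
  rewrite (form_sqrB LL PP)// -ip_sqr; congr (_ - 2 * _ + _).
    rewrite /ip -RintegralZl//; last exact: bounded_integrable_itv.
    by apply: eq_Rintegral => t _; rewrite mulrC.
  by rewrite /ip /= (Rintegral_cst leb mJ) lebJf expr2.
have E2 : ip leb J (u - cst (u p)) (u - cst (u p)) <= h * V * h.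
  rewrite -[X in _ <= _ * X]lebJf -(Rintegral_cst leb mJ) ip_sqr.
  apply: (Rintegral_le_ae mJ); first exact: lw.2.
    by apply: bounded_integrable_itv => //; exists `|h * V| => t.
  by apply: ae_all => t Jt; exact: osc.
have := sqr_ge0 (h * u p - U).
rewrite sqrrB => E3.
have E4 : 0 <= h^-1 * ((h * u p) ^+ 2 - h * u p * U *+ 2 + U ^+ 2).
  by apply: mulr_ge0; [rewrite invr_ge0 ltW|exact: E3].
have E5 : h^-1 * ((h * u p) ^+ 2 - h * u p * U *+ 2 + U ^+ 2) =
    u p ^+ 2 * h - 2 * (u p * U) + h^-1 * U ^+ 2.
  by field; rewrite gt_eqF.
rewrite E5 in E4; rewrite E1 in E2; lra.
Qed.

End interval.

Lemma sum_indic_itv (x0 h t : R) m : 0 <= h ->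
  \sum_(k < m) \1_(`[x0 + k%:R * h, x0 + k.+1%:R * h[%classic : set R) t =
  \1_(`[x0, x0 + m%:R * h[%classic : set R) t :> R.
Proof.
move=> h0; elim: m => [|m IH].
  by rewrite big_ord0 indicE memNset//= in_itv/= mul0r addr0; case: ltP => //; rewrite andbF.
rewrite big_ord_recr/= IH !indicE !mem_setE !in_itv/=.
have m0 : 0 <= m%:R * h by rewrite mulr_ge0.
rewrite -natr1 mulrDl mul1r.
have [x0t|x0t] := leP x0 t; have [a|a] := ltP t (x0 + m%:R * h);
  have [b|b] := ltP t (x0 + (m%:R * h + h)); rewrite ?addr0 ?add0r//=; lra.
Qed.

End rellich.

Section rellich_induction.
Context {R : realType}.
Local Notation leb := (@lebesgue_measure R).
Local Notation lebn n := (@lebesgue_rV R n).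

(** Compactness of the embedding of H1 into L2 in the form in which it serves,
    an inequality with finitely many weights [chi]. Slicing along the first
    coordinate: on each slab the variance is paid for by the first derivative,
    and the means over the slab are functions of the remaining coordinates
    whose derivatives are the means of the derivatives, so that induction on
    the dimension applies to them. *)
Theorem rellich_line n (L e : R) : 0 < L -> 0 < e ->
  exists (T : finType) (chi : T -> 'rV[R]_n -> R),
    (forall k, measurable_fun setT (chi k) /\ exists K, forall x, `|chi k x| <= K) /\
    forall f (g : 'I_n -> 'rV[R]_n -> R), bddn L f ->
      (forall i, line_prim L i f (g i)) ->
      \int[lebn n]_x f x ^+ 2 <= \sum_k (\int[lebn n]_x (chi k x * f x)) ^+ 2 +
        e * \sum_i \int[lebn n]_x g i x ^+ 2.
Proof.
move=> L0 e0; elim: n => [|n [T [chi [hchi IH]]]].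
  exists 'I_1, (fun=> cst 1); split.
    by move=> _; split; [exact: measurable_cst|exists 1 => x; rewrite normr1].
  move=> f g bf _; rewrite big_ord0 mulr0 addr0.
  rewrite big_ord1.
  have E (u : 'rV[R]_0 -> R) : measurable_fun setT u -> \int[lebn 0]_x u x = u 0.
    move=> mu; rewrite /Rintegral integral_dirac//; last exact/measurable_EFinP.
    by rewrite diracT mul1e.
  have [mf _ _] := bf.
  rewrite !E//; first by rewrite mul1r.
    exact: measurable_funM.
  exact: measurable_funX.
(* Slabs of width [h] with [h ^ 2 <= e]; there is one more than [m] of them
   since they are half-open and have to cover the endpoint [L]. *)
pose d := Num.min 1 e.
have d0 : 0 < d by rewrite lt_min ltr01.
pose m := (Num.truncn (2 * L / d)).+1.
pose h := 2 * L / m%:R.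
have m0 : 0 < m%:R :> R by rewrite ltr0n.
have h0 : 0 < h by rewrite divr_gt0// mulr_gt0.
have hd : h <= d.
  by rewrite /h ler_pdivrMr// [leRHS]mulrC -ler_pdivrMr//; exact/ltW/truncnS_gt.
have he : h ^+ 2 <= e.
  have h1 : h <= 1 by rewrite (le_trans hd)// ge_min lexx.
  have h2 : h <= e by rewrite (le_trans hd)// ge_min lexx orbT.
  by rewrite expr2 (le_trans _ h2)// ger_pMr.
pose J (k : 'I_m.+1) : set (measurableTypeR R) :=
  `[- L + k%:R * h, - L + k.+1%:R * h[%classic.
have JE k : J k = `[- L + k%:R * h, (- L + k%:R * h) + h[%classic.
  by rewrite /J -natr1 mulrDl mul1r addrA.
have mJ k : measurable (J k) by exact: measurable_itv.
pose i_ k t : R := \1_(J k) t.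
have mi k : measurable_fun setT (i_ k) by exact: measurable_indic.
have bi k : exists K, forall t, `|i_ k t| <= K.
  by exists 1 => t; rewrite /i_ indicE; case: (_ \in _); rewrite ?normr1 ?normr0.
have ii k t : i_ k t * i_ k t = i_ k t.
  by rewrite /i_ indicE; case: (_ \in _); rewrite ?mulr1 ?mulr0.
(* This constant makes the weight of a slab a unit vector of L2. *)
pose c := (Num.sqrt h)^-1.
have cc : c * c = h^-1 by rewrite /c -invfM -expr2 sqr_sqrtr ?ltW.
pose w k t := c * i_ k t.
have mw k : measurable_fun setT (w k) by apply: measurable_funM => //; exact: measurable_cst.
have bw k : exists K, forall t, `|w k t| <= K.
  have [K hK] := bi k; exists (`|c| * K) => t.
  by rewrite normrM ler_wpM2l.
pose Chi (p : 'I_m.+1 * T) (x : 'rV[R]_n.+1) := w p.1 (x ord0 ord0) * chi p.2 (rV_uncons x).2.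
have hChi p : measurable_fun setT (Chi p) /\ exists K, forall x, `|Chi p x| <= K.
  have [mc [K hK]] := hchi p.2; have [K' hK'] := bw p.1; split.
    apply: measurable_funM; first by apply: (measurableT_comp (mw _)); exact: measurable_coord.
    apply: (measurableT_comp mc); apply: (measurableT_comp measurable_snd).
    exact: measurable_rV_uncons.
  by exists (K' * K) => x; rewrite normrM ler_pM.
exists ('I_m.+1 * T)%type, Chi; split=> // f g bf fg.
have bg i : bddn L (g i) by have [] := fg i.
have slab k (u : 'rV[R]_n.+1 -> R) : bddn L u ->
    \int[lebn n.+1]_x (i_ k (x ord0 ord0) * u x ^+ 2) =
    \int[lebn n]_y (\int[leb]_(t in J k) u (rV_cons (t, y)) ^+ 2).
  move=> bu; rewrite (bddn_fubini2 (bddn_weight (mi k) (bi k) (bddnX bu))).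
  apply: eq_Rintegral => y _; rewrite [RHS]Rintegral_mkcond.
  apply: eq_Rintegral => t _; rewrite rV_cons0 patchE /i_ indicE.
  by case: ifP => _; rewrite ?mul1r ?mul0r.
have bslab k (u : 'rV[R]_n.+1 -> R) : bddn L u ->
    bddn L (fun y => \int[leb]_(t in J k) u (rV_cons (t, y)) ^+ 2).
  move=> bu; have := bddn_avg (mi k) (bi k) (bddnX bu).
  congr (bddn L _); apply/funext => y; rewrite [RHS]Rintegral_mkcond.
  apply: eq_Rintegral => t _; rewrite patchE /i_ indicE.
  by case: ifP => _; rewrite ?mul1r ?mul0r.
pose avg k (u : 'rV[R]_n.+1 -> R) y := \int[leb]_t (w k t * u (rV_cons (t, y))).
have avgE k u y : bddn L u -> avg k u y = c * \int[leb]_(t in J k) u (rV_cons (t, y)).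
  move=> bu; rewrite [X in _ = _ * X]Rintegral_mkcond -RintegralZl//.
    apply: eq_Rintegral => t _; rewrite /w /i_ patchE indicE -mulrA; congr (_ * _).
    by case: ifP => _; rewrite ?mul1r ?mul0r.
  have := bdd1_integrable (bddn_slice1 y (bddn_weight (mi k) (bi k) bu)).
  congr (leb.-integrable _ _); apply/funext => t /=; rewrite rV_cons0 /i_ patchE indicE.
  by case: ifP => _; rewrite ?mul1r ?mul0r.
have bavg k u : bddn L u -> bddn L (avg k u) by exact: bddn_avg (mw k) (bw k).
have slice_bdd (u : 'rV[R]_n.+1 -> R) y : bddn L u -> measurable_fun setT (fun t => u (rV_cons (t, y))) /\
    exists M, forall t, `|u (rV_cons (t, y))| <= M.
  by move=> /(bddn_slice1 y)[].
have avg_le k (u : 'rV[R]_n.+1 -> R) : bddn L u ->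
    \int[lebn n]_y avg k u y ^+ 2 <= \int[lebn n.+1]_x (i_ k (x ord0 ord0) * u x ^+ 2).
  move=> bu; rewrite slab//; apply: (Rintegral_le_ae measurableT).
  - by apply: bddn_integrable; apply: bddnX; exact: bavg.
  - by apply: bddn_integrable; exact: bslab.
  apply: ae_all => y _; rewrite avgE// exprMn expr2 cc JE.
  have [mu bu'] := slice_bdd u y bu.
  by rewrite mulrC ler_pdivrMr// [leRHS]mulrC; exact: sqr_integral_itv.
have f_le k : \int[lebn n.+1]_x (i_ k (x ord0 ord0) * f x ^+ 2) <=
    \int[lebn n]_y avg k f y ^+ 2 +
    e * \int[lebn n.+1]_x (i_ k (x ord0 ord0) * g ord0 x ^+ 2).
  rewrite !slab// -RintegralZl//; last by apply: bddn_integrable; exact: bslab.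
  have ia : (lebn n).-integrable setT (EFin \o (fun y => avg k f y ^+ 2)).
    by apply: bddn_integrable; apply: bddnX; exact: bavg.
  have ib : (lebn n).-integrable setT (EFin \o (fun y => e * \int[leb]_(t in J k) g ord0 (rV_cons (t, y)) ^+ 2)).
    by apply: bddn_integrable; apply: bddnZ; exact: bslab.
  rewrite -RintegralD//; apply: (Rintegral_le_ae measurableT).
  - by apply: bddn_integrable; exact: bslab.
  - exact: integrable_add.
  apply: ae_all => y _; rewrite avgE// exprMn expr2 cc JE.
  have [mu bu] := slice_bdd f y bf; have [mv bv] := slice_bdd (g ord0) y (bg ord0).
  have [_ _ fg0] := fg ord0.
  have P := @poincare_itv R (- L + k%:R * h) h h0 _ _ mu mv bu bv.
  apply: le_trans (P _) _.
    move=> a b ab; have := fg0 (rV_cons (0, y)) a b ab.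
    by rewrite !rV_consD0 !add0r => ->; apply: eq_Rintegral => s _; rewrite rV_consD0 add0r.
  rewrite lerD2l ler_wpM2r//; apply: Rintegral_ge0 => t _; exact: sqr_ge0.
have avgChi k l : \int[lebn n]_y (chi l y * avg k f y) =
    \int[lebn n.+1]_x (Chi (k, l) x * f x).
  have [mC bC] := hChi (k, l); have bwf := bddn_weight (mw k) (bw k) bf.
  rewrite (bddn_fubini2 (bddn_mulb mC bC bf)); apply: eq_Rintegral => y _.
  rewrite /avg -RintegralZl//.
    by apply: eq_Rintegral => t _; rewrite /Chi rV_consK rV_cons0 /= mulrCA mulrA.
  have := bdd1_integrable (bddn_slice1 y bwf).
  by under [X in _.-integrable _ X -> _]funext do rewrite /= rV_cons0.
have IHk k := IH (avg k f) (fun j => avg k (g (lift ord0 j))) (bavg k f bf)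
  (fun j => line_prim_avg (mw k) (bw k) (fg (lift ord0 j))).
have sum_i (x : R) : \sum_k i_ k x = \1_(`[- L, - L + m.+1%:R * h[%classic : set R) x :> R.
  by rewrite -sum_indic_itv ?ltW.
have sum_le (u : 'rV[R]_n.+1 -> R) : bddn L u ->
    \sum_k \int[lebn n.+1]_x (i_ k (x ord0 ord0) * u x ^+ 2) <= \int[lebn n.+1]_x u x ^+ 2.
  move=> bu; rewrite -Rintegral_bigsum//; last first.
    by move=> k; apply: bddn_integrable; exact: bddn_weight (mi k) (bi k) (bddnX bu).
  apply: (Rintegral_le_ae measurableT).
  - apply: integrable_bigsum => // k.
    by apply: bddn_integrable; exact: bddn_weight (mi k) (bi k) (bddnX bu).
  - by apply: bddn_integrable; exact: bddnX bu.
  by apply: ae_all => x _; rewrite -mulr_suml sum_i ler_piMl ?sqr_ge0.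
have sum_eq : \sum_k \int[lebn n.+1]_x (i_ k (x ord0 ord0) * f x ^+ 2) = \int[lebn n.+1]_x f x ^+ 2.
  rewrite -Rintegral_bigsum//; last first.
    by move=> k; apply: bddn_integrable; exact: bddn_weight (mi k) (bi k) (bddnX bf).
  apply: eq_Rintegral => x _; rewrite -mulr_suml sum_i indicE.
  case: (boolP (_ \in _)) => [_|]; first by rewrite mul1r.
  rewrite notin_setE /= in_itv/= => nx.
  have [_ _ ->] := bf; first by rewrite expr0n mulr0.
  exists ord0; rewrite ltNge; apply/negP; rewrite ler_norml => /andP[x1 x2]; apply: nx.
  rewrite x1/= (le_lt_trans x2)// -natr1 mulrDl mul1r /h mulrCA mulfV ?gt_eqF// mulr1.
  have := h0; rewrite /h; lra.
rewrite -sum_eq.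
apply: le_trans (ler_sum _ (fun k _ => f_le k)) _.
rewrite big_split/=.
apply: (@le_trans _ _ (\sum_k (\sum_l (\int[lebn n.+1]_x (Chi (k, l) x * f x)) ^+ 2 +
   e * \sum_(j < n) \int[lebn n.+1]_x (i_ k (x ord0 ord0) * g (lift ord0 j) x ^+ 2)) +
   e * \int[lebn n.+1]_x g ord0 x ^+ 2)).
  apply: lerD.
    apply: ler_sum => k _; apply: le_trans (IHk k) _; apply: lerD.
      by apply: ler_sum => l _; rewrite avgChi.
    by apply: ler_wpM2l; [exact: ltW|apply: ler_sum => j _; exact: avg_le].
  by rewrite -mulr_sumr; apply: ler_wpM2l; [exact: ltW|exact: sum_le].
have -> : \sum_p (\int[lebn n.+1]_x (Chi p x * f x)) ^+ 2 =
    \sum_k \sum_l (\int[lebn n.+1]_x (Chi (k, l) x * f x)) ^+ 2.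
  by rewrite pair_bigA/=; apply: eq_bigr => -[].
rewrite big_split/= -addrA lerD2l -mulr_sumr -mulrDr; apply: ler_wpM2l; first exact: ltW.
by rewrite [leRHS]big_ord_recl [leLHS]addrC lerD2l exchange_big/=; apply: ler_sum => j _; exact: sum_le.
Qed.

End rellich_induction.

(** * Smooth functions and test functions *)

Section directional.
Context {R : realType} {n : nat}.
Implicit Types (f g : 'rV[R]_n -> R) (x v : 'rV[R]_n).

Lemma is_derive_line f x v (s d : R) :
  is_derive s 1 (fun t : R => f (x + t *: v)) d <-> is_derive (x + s *: v) v f d.
Proof.
have E : (fun h : R => h^-1 *: (((fun t : R => f (x + t *: v)) \o shift s) (h *: (1 : R)) -
     f (x + s *: v))) =
   (fun h : R => h^-1 *: ((f \o shift (x + s *: v)) (h *: v) - f (x + s *: v))).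
  apply/funext => h /=; congr (_ *: (f _ - _)).
  by rewrite [h *: 1]mulr1 scalerDl addrCA.
by split => -[h1 h2]; split; rewrite /derivable /derive ?E -?E in h1 h2 *.
Qed.

Lemma is_derive_line0 f x v (d : R) :
  is_derive (0 : R) 1 (fun t : R => f (x + t *: v)) d <-> is_derive x v f d.
Proof. by rewrite is_derive_line scale0r addr0. Qed.

Lemma is_derive_compR (h : R -> R) f x v (a b : R) :
  is_derive (f x) 1 h a -> is_derive x v f b -> is_derive x v (h \o f) (a * b).
Proof.
move=> dh /is_derive_line0 df; apply/is_derive_line0.
by apply: (@is_derive1_comp _ h (fun t => f (x + t *: v))); rewrite scale0r addr0.
Qed.

Lemma is_derive_mulR f g x v (a b : R) :
  is_derive x v f a -> is_derive x v g b ->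
  is_derive x v (fun y => f y * g y) (f x * b + g x * a).
Proof. by move=> df dg; exact: is_deriveM. Qed.

Lemma is_derive_addR f g x v (a b : R) :
  is_derive x v f a -> is_derive x v g b ->
  is_derive x v (fun y => f y + g y) (a + b).
Proof. by move=> df dg; exact: is_deriveD. Qed.

Lemma is_derive_cstR (a : R) x v : is_derive x v (fun=> a) 0.
Proof. exact: is_derive_cst. Qed.

Lemma is_derive_coord i (j : 'I_n) x :
  is_derive x (delta_mx ord0 j) (fun y : 'rV[R]_n => y ord0 i) ((i == j)%:R).
Proof.
apply/is_derive_line0; under eq_fun do rewrite !mxE eqxx /=.
rewrite (_ : (fun t => _) = (cst (x ord0 i) + (i == j)%:R *: (@id R))); last first.
  by apply/funext => t; rewrite /= [RHS]/= mulrC.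
have h := is_deriveD (is_derive_cst (x ord0 i) (0 : R) 1)
  (is_deriveZ (i == j)%:R (is_derive_id (0 : R) 1)).
by apply: is_derive_eq h _; rewrite add0r; exact: mulr1.
Qed.

End directional.

Section smooth.
Context {R : realType} {n : nat}.
Implicit Types (f g : 'rV[R]_n -> R) (x v : 'rV[R]_n).

Local Notation e i := (delta_mx ord0 i : 'rV[R]_n).

Lemma partialE f i x d : is_derive x (e i) f d -> partial i f x = d.
Proof. by move=> df; rewrite /partial derive_val. Qed.

Lemma is_CkW k f : is_Ck k.+1 f -> is_Ck k f.
Proof.
elim: k f => [|k IH] f; first by case.
by move=> [cf df pf]; split => // i; apply: IH.
Qed.

Lemma is_Ck_is_derive k f i x : is_Ck k.+1 f -> is_derive x (e i) f (partial i f x).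
Proof. by move=> [_ df _]; apply: derivableP; exact: df. Qed.

Lemma is_Ck_continuous k f : is_Ck k f -> continuous f.
Proof. by case: k => [//|k []]. Qed.

Lemma is_Ck_S k f (g : 'I_n -> 'rV[R]_n -> R) : continuous f ->
  (forall i x, is_derive x (e i) f (g i x)) -> (forall i, is_Ck k (g i)) ->
  is_Ck k.+1 f.
Proof.
move=> cf df cg; split => [//|i x|i].
  by have [] := df i x.
by rewrite (_ : partial i f = g i)//; apply/funext => x; exact: partialE.
Qed.

Lemma is_Ck_add k f g : is_Ck k f -> is_Ck k g -> is_Ck k (fun x => f x + g x).
Proof.
elim: k f g => [|k IH] f g; first by move=> cf cg x; apply: continuousD; [exact: cf|exact: cg].
move=> cf cg; apply: (@is_Ck_S _ _ (fun i x => partial i f x + partial i g x)).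
- by move=> x; apply: continuousD; [exact: (is_Ck_continuous cf)|exact: (is_Ck_continuous cg)].
- by move=> i x; apply: is_derive_addR; [exact: is_Ck_is_derive cf|exact: is_Ck_is_derive cg].
- move=> i; have [_ _ pf] := cf; have [_ _ pg] := cg.
  exact: IH (pf i) (pg i).
Qed.

Lemma is_Ck_mul k f g : is_Ck k f -> is_Ck k g -> is_Ck k (fun x => f x * g x).
Proof.
elim: k f g => [|k IH] f g; first by move=> cf cg x; apply: continuousM; [exact: cf|exact: cg].
move=> cf cg; apply: (@is_Ck_S _ _ (fun i x => f x * partial i g x + g x * partial i f x)).
- by move=> x; apply: continuousM; [exact: (is_Ck_continuous cf)|exact: (is_Ck_continuous cg)].
- by move=> i x; apply: is_derive_mulR; [exact: is_Ck_is_derive cf|exact: is_Ck_is_derive cg].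
- move=> i; have [_ _ pf] := cf; have [_ _ pg] := cg.
  by apply: is_Ck_add; [exact: IH (is_CkW cf) (pg i)|exact: IH (is_CkW cg) (pf i)].
Qed.

Lemma is_Ck_cst k (a : R) : is_Ck k (fun _ : 'rV[R]_n => a).
Proof.
have ca : continuous (fun _ : 'rV[R]_n => a) by move=> x; exact: cst_continuous.
elim: k a ca => [//|k IH] a ca.
apply: (is_Ck_S ca (fun i x => is_derive_cstR a x (e i))) => i.
by apply: IH => x; exact: cst_continuous.
Qed.

Lemma is_Ck_coord k i : is_Ck k (fun x : 'rV[R]_n => x ord0 i).
Proof.
case: k => [|k]; first exact: coord_continuous.
apply: (is_Ck_S _ (is_derive_coord i)) => [|j]; first exact: coord_continuous.
exact: is_Ck_cst.
Qed.

(** All the derivatives are exhibited at once because the chain rule calls for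
    them in succession. *)
Definition smooth1 (h : R -> R) := exists H : nat -> R -> R,
  H 0%N = h /\ forall k (x : R), is_derive x 1 (H k) (H k.+1 x).

Lemma is_Ck_comp k (H : nat -> R -> R) f :
  (forall k (x : R), is_derive x 1 (H k) (H k.+1 x)) -> is_Ck k f ->
  forall j, is_Ck k (H j \o f).
Proof.
move=> dH; elim: k f => [|k IH] f cf j.
  move=> x; apply: continuous_comp; first exact: cf.
  apply: differentiable_continuous; apply/derivable1_diffP.
  by have [] := dH j (f x).
apply: (@is_Ck_S _ _ (fun i x => H j.+1 (f x) * partial i f x)).
- move=> x; apply: continuous_comp; first exact: (is_Ck_continuous cf).
  apply: differentiable_continuous; apply/derivable1_diffP.
  by have [] := dH j (f x).
- by move=> i x; exact: (is_derive_compR (dH _ _) (is_Ck_is_derive _ _ cf)).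
- move=> i; have [_ _ pf] := cf; apply: is_Ck_mul; last exact: pf.
  exact: IH (is_CkW cf) j.+1.
Qed.

Lemma smooth_add f g : smooth f -> smooth g -> smooth (fun x => f x + g x).
Proof. by move=> sf sg k; exact: is_Ck_add. Qed.

Lemma smooth_mul f g : smooth f -> smooth g -> smooth (fun x => f x * g x).
Proof. by move=> sf sg k; exact: is_Ck_mul. Qed.

Lemma smooth_cst (a : R) : smooth (fun _ : 'rV[R]_n => a).
Proof. by move=> k; exact: is_Ck_cst. Qed.

Lemma smooth_coord i : smooth (fun x : 'rV[R]_n => x ord0 i).
Proof. by move=> k; exact: is_Ck_coord. Qed.

Lemma smooth_comp (h : R -> R) f : smooth1 h -> smooth f -> smooth (fun x => h (f x)).
Proof. by move=> [H [<- dH]] sf k; exact: (is_Ck_comp dH (sf k) 0%N). Qed.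

Lemma smooth_partial i f : smooth f -> smooth (partial i f).
Proof. by move=> sf k; have [_ _ pf] := sf k.+1; exact: pf. Qed.

Lemma smooth_continuous f : smooth f -> continuous f.
Proof. by move=> sf; exact: (sf 0%N). Qed.

Lemma smooth_is_derive f i x : smooth f -> is_derive x (e i) f (partial i f x).
Proof. by move=> sf; exact: (@is_Ck_is_derive 0 f i x (sf 1%N)). Qed.

Lemma partial_add i f g x : smooth f -> smooth g ->
  partial i (fun y => f y + g y) x = partial i f x + partial i g x.
Proof. by move=> sf sg; apply: partialE; apply: is_derive_addR; exact: smooth_is_derive. Qed.

Lemma partial_mul i f g x : smooth f -> smooth g ->
  partial i (fun y => f y * g y) x = f x * partial i g x + g x * partial i f x.
Proof. by move=> sf sg; apply: partialE; apply: is_derive_mulR; exact: smooth_is_derive. Qed.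

Lemma partial_cst i (a : R) x : partial i (fun _ : 'rV[R]_n => a) x = 0.
Proof. by apply: partialE; exact: is_derive_cstR. Qed.

Lemma partial_coord i j x : partial i (fun y : 'rV[R]_n => y ord0 j) x = (j == i)%:R.
Proof. by apply: partialE; exact: is_derive_coord. Qed.

Lemma partial_scale i (a : R) f x : smooth f ->
  partial i (fun y => a * f y) x = a * partial i f x.
Proof.
by move=> sf; rewrite partial_mul ?partial_cst ?mulr0 ?addr0//; exact: smooth_cst.
Qed.

Lemma partial_comp i (h : R -> R) (d : R) f x : is_derive (f x) 1 h d -> smooth f ->
  partial i (fun y => h (f y)) x = d * partial i f x.
Proof.
move=> dh sf; apply: partialE; apply: (@is_derive_compR _ _ h) => //.
exact: smooth_is_derive.
Qed.

End smooth.

Section test_functions.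
Context {R : realType} {n : nat}.
Variable Omega : set 'rV[R]_n.
Implicit Types (f g : 'rV[R]_n -> R) (x : 'rV[R]_n).

Local Notation e i := (delta_mx ord0 i : 'rV[R]_n).
Local Notation leb := (@lebesgue_measure R).
Local Notation lebn := (@lebesgue_rV R n).
Local Notation supp f := (closure [set x | f x != 0]).

Lemma test_smooth f : test_function Omega f -> smooth f.
Proof. by case. Qed.

Lemma test_supp0 f x : test_function Omega f -> ~ Omega x -> f x = 0.
Proof.
move=> [_ _ sO] nO; apply/eqP; apply: contrapT => fx; apply: nO; apply: sO.
by apply: subset_closure; exact/negP.
Qed.

Lemma test_sub_closed f g : test_function Omega f -> smooth g ->
  [set x | g x != 0] `<=` supp f -> test_function Omega g.
Proof.
move=> [_ cf sO] sg gf.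
have cl : supp g `<=` supp f.
  by rewrite (closure_id (supp f)).1; [exact: closure_subset|exact: closed_closure].
split => //; last exact: subset_trans sO.
by apply: subclosed_compact cl => //; exact: closed_closure.
Qed.

Lemma test_sub f g : test_function Omega f -> smooth g ->
  (forall x, f x = 0 -> g x = 0) -> test_function Omega g.
Proof.
move=> tf sg fg; apply: (test_sub_closed tf sg) => x /= gx.
by apply: subset_closure => /=; apply: contra_neq gx => /fg.
Qed.

Lemma test_mul f g : test_function Omega f -> smooth g ->
  test_function Omega (fun x => f x * g x).
Proof.
move=> tf sg; apply: (test_sub tf); first exact: smooth_mul (test_smooth tf) sg.
by move=> x ->; rewrite mul0r.
Qed.

Lemma test_comp (h : R -> R) f : smooth1 h -> h 0 = 0 -> test_function Omega f ->
  test_function Omega (fun x => h (f x)).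
Proof.
move=> sh h0 tf; apply: (test_sub tf); first exact: smooth_comp sh (test_smooth tf).
by move=> x ->.
Qed.

Lemma test_partial i f : test_function Omega f -> test_function Omega (partial i f).
Proof.
move=> tf; have sf := test_smooth tf.
apply: (test_sub_closed tf); first exact: smooth_partial.
move=> x /= /eqP px; apply: contrapT => nx; apply: px; apply: partialE.
have /nbhs_ballP[d /= d0 dx] : nbhs x (~` supp f).
  by apply: open_nbhs_nbhs; split => //; apply: closed_openC; exact: closed_closure.
have f0 y : ball x d y -> f y = 0.
  move=> /dx ny; apply/eqP; apply: contrapT => fy; apply: ny.
  by apply: subset_closure; exact/negP.
have := @is_derive_cst R _ _ (0 : R) x (e i).
apply: near_eq_is_derive.
by apply/nbhs_ballP; exists d => //= y /f0.
Qed.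

Lemma test0 : test_function Omega 0.
Proof.
have -> : (0 : 'rV[R]_n -> R) = (fun=> 0) by [].
have E : [set x : 'rV[R]_n | (0 : R) != 0] = set0.
  by apply/seteqP; split=> x //=; rewrite eqxx.
split; first exact: smooth_cst.
  by rewrite E closure0; exact: compact0.
by rewrite E closure0.
Qed.

Lemma test_lin : lin_closed (test_function Omega).
Proof.
split; first exact: test0.
move=> a f g tf tg; have [sf cf fO] := tf; have [sg cg gO] := tg.
have saf : smooth (fun x => a * f x + g x).
  by apply: smooth_add => //; apply: smooth_mul => //; exact: smooth_cst.
have cl : supp (fun x => a * f x + g x) `<=` supp f `|` supp g.
  rewrite -closureU; apply: closure_subset => x /= h.
  have [fx|fx] := eqVneq (f x) 0; last by left.
  by right; rewrite fx mulr0 add0r in h.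
split => //.
  by apply: (subclosed_compact _ (compactU cf cg) cl); exact: closed_closure.
by apply: subset_trans cl _ => x [/fO|/gO].
Qed.

Lemma test_bounded f : test_function Omega f -> exists M, forall x, `|f x| <= M.
Proof.
move=> [sf cf _]; have cK : compact (f @` supp f).
  by apply: continuous_compact cf; exact: continuous_subspaceT (smooth_continuous sf).
have [M [_ hM]] := compact_bounded cK.
exists (Num.max 0 (M + 1)) => x; have [fx|fx] := eqVneq (f x) 0.
  by rewrite fx normr0 le_max lexx.
rewrite le_max; apply/orP; right; apply: (hM (M + 1)); first by rewrite ltrDl.
by exists x => //; exact: subset_closure.
Qed.

Lemma coord_le_norm x i : `|x ord0 i| <= `|x|.
Proof.
apply/ler_addgt0Pr => d d0.
have : ball (0 : 'rV[R]_n) (`|x| + d) x.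
  by rewrite -ball_normE /= sub0r normrN ltrDl.
have xd : 0 < `|x| + d by rewrite ltr_wpDl.
by move=> /(rV_ballP _ _ xd)/(_ i); rewrite mxE sub0r normrN => /ltW.
Qed.

Lemma bounded_cube : bounded_set Omega ->
  exists2 L : R, 0 < L & forall x, Omega x -> forall i, `|x ord0 i| <= L.
Proof.
move=> [M [_ hM]]; exists (`|M| + 1); first by rewrite ltr_wpDl.
move=> x Ox i; apply: le_trans (coord_le_norm x i) _; apply: hM Ox.
by rewrite (le_lt_trans (ler_norm M))// ltrDl.
Qed.

Section cube.
Variable L : R.
Hypothesis L0 : 0 < L.
Hypothesis OL : forall x, Omega x -> forall i, `|x ord0 i| <= L.

Lemma test_bddn f : test_function Omega f -> bddn L f.
Proof.
move=> tf; split.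
- by apply: continuous_measurable_rV; apply: smooth_continuous; exact: test_smooth.
- exact: test_bounded.
- move=> x [i xi]; apply: (test_supp0 tf) => /OL/(_ i).
  by rewrite leNgt xi.
Qed.

Lemma test_line_prim f i : test_function Omega f -> line_prim L i f (partial i f).
Proof.
move=> tf; have sf := test_smooth tf.
split; [exact: test_bddn|by apply: test_bddn; exact: test_partial|].
move=> x a b; rewrite le_eqVlt => /orP[/eqP ->|ab].
  by rewrite subrr set_itv1 Rintegral_set1.
have dF (s : R) : is_derive s 1 (fun t : R => f (x + t *: e i)) (partial i f (x + s *: e i)).
  by apply/is_derive_line; exact: smooth_is_derive.
have cF (s : R) : {for s, continuous (fun t : R => f (x + t *: e i))}.
  by apply: differentiable_continuous; apply/derivable1_diffP; have [] := dF s.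
have cg : continuous (fun t : R => partial i f (x + t *: e i)).
  move=> s; apply: differentiable_continuous; apply/derivable1_diffP.
  have [//] : is_derive s 1 (fun t : R => partial i f (x + t *: e i))
    (partial i (partial i f) (x + s *: e i)).
  by apply/is_derive_line; apply: smooth_is_derive; exact: smooth_partial.
rewrite /Rintegral (@continuous_FTC2 _ _ (fun t : R => f (x + t *: e i)) a b)//.
- exact: continuous_subspaceT.
- split.
  + by move=> s _; have [] := dF s.
  + by apply: cvg_at_right_filter; exact: cF.
  + by apply: cvg_at_left_filter; exact: cF.
- by move=> s _; rewrite derive1E; have [_ ->] := dF s.
Qed.

Lemma Omega_finite : measurable Omega -> (lebn Omega < +oo)%E.
Proof.
move=> mO; apply: le_lt_trans (lebesgue_rV_cube n L); apply: le_measure.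
- by rewrite inE.
- by rewrite inE; apply: (@measurable_rect _ _ (fun=> `[-L, L]%classic)) => i.
by move=> x Ox i; rewrite in_itv/= -ler_norml; exact: OL.
Qed.

Lemma test_Rintegral f : (forall x, ~ Omega x -> f x = 0) ->
  integral_in Omega f = \int[lebn]_x f x.
Proof.
move=> f0; rewrite /integral_in Rintegral_mkcond; apply: eq_Rintegral => x _.
by rewrite patchE; case: ifPn => //; rewrite notin_setE => /f0 ->.
Qed.

Lemma integral_partial0 f i : test_function Omega f ->
  integral_in Omega (partial i f) = 0.
Proof.
move=> tf; rewrite test_Rintegral; first exact: line_prim_int0 (test_line_prim i tf).
by move=> x; apply: test_supp0; exact: test_partial.
Qed.

Hypothesis mO : measurable Omega.

Lemma test_integrable f : test_function Omega f -> integrable_in Omega f.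
Proof.
move=> tf; have := bddn_integrable (test_bddn tf).
exact: integrableS.
Qed.

Lemma test_L2 f : test_function Omega f -> L2 lebn Omega f.
Proof.
move=> tf; split.
  by apply: measurable_funTS; have [] := test_bddn tf.
have := bddn_integrable (bddnX (test_bddn tf)).
exact: integrableS.
Qed.

Lemma integration_by_parts_test f g i : test_function Omega f -> smooth g ->
  integral_in Omega (fun x => f x * partial i g x) =
  - integral_in Omega (fun x => partial i f x * g x).
Proof.
move=> tf sg; have sf := test_smooth tf.
have t1 : test_function Omega (fun x => f x * partial i g x).
  by apply: test_mul => //; exact: smooth_partial.
have t2 : test_function Omega (fun x => partial i f x * g x).
  by apply: test_mul => //; exact: test_partial.
apply/eqP; rewrite -addr_eq0 /integral_in -RintegralD//; [|exact: test_integrable..].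
rewrite -(integral_partial0 i (test_mul tf sg)); apply/eqP.
by apply: eq_Rintegral => x _; rewrite partial_mul// [X in _ + X]mulrC.
Qed.

End cube.
End test_functions.

(** * The fundamental lemma of the calculus of variations *)

Section bump.
Context {R : realType}.

Lemma horner_expRN_le (p : {poly R}) : exists C, forall s, 0 <= s ->
  `|p.[s]| * expR (- s) <= C.
Proof.
have mono k (s : R) : 0 <= s -> s ^+ k * expR (- s) <= k`!%:R.
  move=> s0; have h : s ^+ k <= k`!%:R * expR s.
    case: k => [|k]; first by rewrite expr0 fact0 mul1r -[leLHS]expR0 ler_expR.
    have := expR_ge1Dxn k s0 => h; rewrite mulrC -ler_pdivrMr ?ltr0n ?fact_gt0//.
    by apply: le_trans h; rewrite lerDr.
  by rewrite expRN ler_pdivrMr ?expR_gt0.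
exists (\sum_(i < size p) `|p`_i| * i`!%:R) => s s0; rewrite horner_coef.
apply: (@le_trans _ _ ((\sum_(i < size p) `|p`_i * s ^+ i|) * expR (- s))).
  by rewrite ler_wpM2r ?expR_ge0// ler_norm_sum.
rewrite mulr_suml; apply: ler_sum => i _.
by rewrite normrM (ger0_norm (exprn_ge0 _ s0)) -mulrA ler_wpM2l// mono.
Qed.

(** The polynomial makes the family stable under differentiation; [cutoff 1]
    is the flat function [exp (- 1 / t)]. *)
Definition cutoff (p : {poly R}) (t : R) : R :=
  if 0 < t then p.[t^-1] * expR (- t^-1) else 0.

(** At the origin the factor [expR (- t^-1)] beats every power of [t^-1], so
    that the function is [O(t ^ 2)]. *)
Lemma is_derive_cutoff (p : {poly R}) (t : R) :
  is_derive t 1 (cutoff p) (cutoff ('X^2 * (p - p^`())) t).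
Proof.
have [t0|t0|->] := ltgtP t 0.
- rewrite /cutoff (ltNge 0) (ltW t0) /=.
  apply: near_eq_is_derive (is_derive_cst 0 t 1).
  by near=> s; rewrite /cutoff ifF//; apply/negbTE; rewrite -leNgt ltW//; near: s; exact: lt_nbhsl.
- rewrite {2}/cutoff t0.
  have dinv : is_derive t 1 (fun s : R => s^-1) (- t ^- 2).
    apply: DeriveDef; first by apply: derivableV => //; rewrite gt_eqF.
    by rewrite deriveV ?gt_eqF// derive_id [_ *: _]mulr1.
  have dp : is_derive (t^-1) 1 (horner p) (p^`()).[t^-1].
    by rewrite derivE derive1E; apply: derivableP; exact: derivable_horner.
  have d1 : is_derive t 1 (fun s : R => p.[s^-1]) ((p^`()).[t^-1] * (- t ^- 2)).
    exact: (is_derive1_comp dp dinv).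
  have d2 : is_derive t 1 (fun s : R => expR (- s^-1)) (expR (- t^-1) * t ^- 2).
    rewrite -[t ^- 2]opprK.
    have dN : is_derive t 1 (fun s : R => - s^-1) (- - t ^- 2) by exact: is_deriveN.
    exact: (@is_derive1_comp _ expR (fun s => - s^-1)).
  have d3 := is_deriveM d1 d2.
  apply: near_eq_is_derive (is_derive_eq d3 _).
    by near=> s; rewrite /cutoff ifT//; near: s; exact: lt_nbhsr.
  rewrite !hornerE /= !expr2 /GRing.scale/= -invfM.
  ring.
rewrite {2}/cutoff ltxx.
have [C hC] := horner_expRN_le ('X^2 * p).
have le2 s : `|cutoff p s| <= C * s ^+ 2.
  have C0 : 0 <= C by apply: le_trans (hC 0 (lexx _)); rewrite mulr_ge0 ?expR_ge0.
  rewrite /cutoff; case: ltP => s0; last by rewrite normr0 mulr_ge0 ?sqr_ge0.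
  have s10 : 0 <= s^-1 by rewrite invr_ge0 ltW.
  rewrite normrM (ger0_norm (expR_ge0 (- s^-1))).
  have := hC _ s10; rewrite hornerM hornerXn normrM (ger0_norm (exprn_ge0 _ s10)).
  by rewrite -mulrA exprVn mulrC ler_pdivrMr ?exprn_gt0.
have cvg0 : h^-1 *: ((cutoff p \o shift 0) (h *: (1 : R)) - cutoff p 0) @[h --> 0^'] --> (0 : R).
  have C0 : 0 < `|C| + 1 by rewrite ltr_wpDl.
  apply/cvgr0Pnorm_le => d d0; near=> h.
  rewrite /= addr0 [h *: 1]mulr1 [cutoff p 0]/cutoff ltxx subr0 normrZ.
  have hn0 : h != 0 by near: h; exact: nbhs_dnbhs_neq.
  have hd : `|h| <= d / (`|C| + 1).
    by near: h; apply: dnbhs0_le; rewrite divr_gt0.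
  apply: (@le_trans _ _ (`|h^-1| * (C * h ^+ 2))); first by rewrite ler_wpM2l.
  rewrite normfV -(real_normK (num_real h)) expr2 mulrCA (mulrA `|h|^-1).
  rewrite mulVf ?normr_eq0// mul1r.
  rewrite ler_pdivlMr// in hd; apply: le_trans hd.
  by rewrite mulrC ler_wpM2l// (le_trans (ler_norm C))// lerDl.
apply: DeriveDef; first by apply/cvg_ex; exists 0.
exact: cvg_lim cvg0.
Unshelve. all: by end_near. Qed.

Lemma smooth1_cutoff p : smooth1 (cutoff p).
Proof.
pose P k := iter k (fun q : {poly R} => 'X^2 * (q - q^`())) p.
by exists (fun k => cutoff (P k)); split => // k x; exact: is_derive_cutoff.
Qed.

End bump.

Section fundamental_lemma.
Context {R : realType} {n : nat}.
Implicit Types (a b : 'I_n -> R) (x : 'rV[R]_n).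
Local Notation lebn := (@lebesgue_rV R n).

Definition obox a b : set 'rV[R]_n := [set x | forall i, a i < x ord0 i < b i].
Definition cbox a b : set 'rV[R]_n := [set x | forall i, a i <= x ord0 i <= b i].

Lemma measurable_obox a b : measurable (obox a b).
Proof.
rewrite (_ : obox a b = [set x | forall i, `]a i, b i[%classic (x ord0 i)]).
  by apply: (@measurable_rect _ _ (fun i => `]a i, b i[%classic)) => i; exact: measurable_itv.
by apply/seteqP; split=> x h i; have := h i; rewrite /= in_itv.
Qed.

Lemma compact_cbox a b : compact (cbox a b).
Proof.
rewrite (_ : cbox a b = [set x | forall i, `[a i, b i]%classic (x ord0 i)]).
  by apply: (@rV_compact _ _ (fun i => `[a i, b i]%classic)) => i; exact: segment_compact.
by apply/seteqP; split=> x h i; have := h i; rewrite /= in_itv.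
Qed.

Definition bump1 (k : nat) (t : R) : R := cutoff 1 (k%:R * t).

Lemma bump1_ge0 k t : 0 <= bump1 k t.
Proof. by rewrite /bump1 /cutoff; case: ifP => // _; rewrite hornerC mul1r expR_ge0. Qed.

Lemma bump1_le1 k t : bump1 k t <= 1.
Proof.
rewrite /bump1 /cutoff; case: ifP => // h.
by rewrite hornerC mul1r -[leRHS]expR0 ler_expR oppr_le0 invr_ge0 ltW.
Qed.

Lemma bump1_eq0 k t : t <= 0 -> bump1 k t = 0.
Proof.
move=> t0; rewrite /bump1 /cutoff ifF//; apply/negbTE.
by rewrite -leNgt mulr_ge0_le0.
Qed.

Lemma bump1_cvg t : bump1 k t @[k --> \oo] --> (((0 < t)%R)%:R : R).
Proof.
have [t0|t0] := ltP 0 t; last first.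
  by under eq_fun do rewrite bump1_eq0//; exact: cvg_cst.
apply/cvgrPdist_le => e e0; near=> k.
have k0 : 0 < k%:R :> R by near: k; exists 1%N => // m /=; rewrite ltr0n.
have kt : 0 < k%:R * t by rewrite mulr_gt0.
rewrite ger0_norm ?subr_ge0 ?bump1_le1//.
rewrite /bump1 /cutoff kt hornerC mul1r.
have := expR_ge1Dx (- (k%:R * t)^-1) => h.
apply: (@le_trans _ _ ((k%:R * t)^-1)); first by rewrite /=; lra.
rewrite -[e]invrK lef_pV2 ?posrE ?invr_gt0// -ler_pdivrMr//.
near: k; exists (Num.truncn (e^-1 / t)).+1 => // m /= hm.
apply: (@le_trans _ _ ((Num.truncn (e^-1 / t)).+1%:R)); last by rewrite ler_nat.
by apply/ltW/truncnS_gt.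
Unshelve. all: by end_near. Qed.

Definition bump a b k x : R :=
  \prod_i (bump1 k (x ord0 i - a i) * bump1 k (b i - x ord0 i)).

Lemma smooth_prod (I : Type) (s : seq I) (F : I -> 'rV[R]_n -> R) :
  (forall i, smooth (F i)) -> smooth (fun x => \prod_(i <- s) F i x).
Proof.
move=> sF; elim: s => [|i s IH].
  by under eq_fun do rewrite big_nil; exact: smooth_cst.
by under eq_fun do rewrite big_cons; exact: smooth_mul.
Qed.

Lemma smooth_bump a b k : smooth (bump a b k).
Proof.
apply: smooth_prod => i.
have sc := smooth_coord i; have s1 := @smooth1_cutoff R 1.
apply: smooth_mul.
  apply: (smooth_comp s1 (f := fun x => k%:R * (x ord0 i - a i))).
  by apply: smooth_mul; [exact: smooth_cst|apply: smooth_add => //; exact: smooth_cst].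
apply: (smooth_comp s1 (f := fun x => k%:R * (b i - x ord0 i))).
apply: smooth_mul; first exact: smooth_cst.
apply: smooth_add; first exact: smooth_cst.
under eq_fun do rewrite -mulN1r.
by apply: smooth_mul => //; exact: smooth_cst.
Qed.

Lemma bump_eq0 a b k x : ~ obox a b x -> bump a b k x = 0.
Proof.
move=> /existsNP[i /negP]; rewrite negb_and -!leNgt => h.
rewrite /bump (bigD1 i)//= (_ : _ * bump1 _ _ = 0) ?mul0r//.
case/orP: h => h; first by rewrite bump1_eq0 ?mul0r// subr_le0.
by rewrite [X in _ * X]bump1_eq0 ?mulr0// subr_le0.
Qed.

Lemma bump_bound a b k x : 0 <= bump a b k x <= 1.
Proof.
rewrite /bump; elim/big_rec: _ => [|i y _ /andP[y0 y1]]; first by rewrite ler01 lexx.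
rewrite !mulr_ge0 ?bump1_ge0//=; apply: mulr_ile1 => //; first by rewrite mulr_ge0 ?bump1_ge0.
by apply: mulr_ile1; rewrite ?bump1_ge0 ?bump1_le1.
Qed.

Lemma bump_cvg a b x : bump a b k x @[k --> \oo] --> (\1_(obox a b) x : R).
Proof.
have [ox|nx] := pselect (obox a b x); last first.
  by under eq_fun do rewrite bump_eq0//; rewrite indicE memNset//; exact: cvg_cst.
rewrite indicE mem_set//.
have -> : (true%:R : R) = \prod_(i < n) (1 * 1) by rewrite big1// => i _; rewrite mul1r.
rewrite /bump; elim: (index_enum _) => [|i s IH].
  by under eq_fun do rewrite big_nil; rewrite big_nil; exact: cvg_cst.
under eq_fun do rewrite big_cons; rewrite big_cons; apply: cvgM => //.
have /andP[ax xb] := ox i.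
by apply: cvgM; [have := @bump1_cvg (x ord0 i - a i)|have := @bump1_cvg (b i - x ord0 i)];
  rewrite subr_gt0 ?ax ?xb.
Qed.

Lemma test_bump Omega a b k : cbox a b `<=` Omega -> test_function Omega (bump a b k).
Proof.
move=> bO.
have cl : closure [set x | bump a b k x != 0] `<=` cbox a b.
  have cc : closed (cbox a b) by apply: compact_closed; [exact: norm_hausdorff|exact: compact_cbox].
  rewrite [X in _ `<=` X](closure_id _).1//; apply: closure_subset => x /= h i.
  have [ox|/bump_eq0 b0] := pselect (obox a b x).
    by have /andP[/ltW -> /ltW ->] := ox i.
  by rewrite b0 eqxx in h.
split; first exact: smooth_bump.
  by apply: subclosed_compact cl; [exact: closed_closure|exact: compact_cbox].
exact: subset_trans bO.
Qed.

Lemma measurable_rV_boxes :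
  @measurable _ 'rV[R]_n = <<s [set A | exists a b, A = obox a b] >>.
Proof.
apply/seteqP; split; last first.
  apply: smallest_sub; first exact: sigma_algebra_measurable.
  by move=> _ [a [b ->]]; exact: measurable_obox.
apply: smallest_sub; first exact: smallest_sigma_algebra.
rewrite -bigcup_seq; apply: bigcup_sub => i _ _ [B mB <-].
pose T' := g_sigma_algebraType [set A : set 'rV[R]_n | exists a b, A = obox a b].
have : measurable_fun setT (fun x : T' => x ord0 i : R).
  apply: (measurability _ (RGenOInfty.measurableE R)) => // _ [_ [t ->] <-].
  rewrite setTI.
  have -> : (fun x : T' => x ord0 i) @^-1` `]t, +oo[ =
     \bigcup_k (obox (fun j => if j == i then t else - k%:R) (fun=> k%:R) : set T').
    apply/seteqP; split => [x /=|x [k _ /(_ i)] /=]; last first.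
      by rewrite eqxx in_itv/= andbT => /andP[].
    rewrite in_itv/= andbT => tx.
    exists (Num.truncn `|x : 'rV[R]_n|).+1 => //= j.
    have h : `|(x : 'rV[R]_n) ord0 j| < (Num.truncn `|x : 'rV[R]_n|).+1%:R.
      exact: le_lt_trans (coord_le_norm _ _) (truncnS_gt _).
    move: h; rewrite ltr_norml => /andP[h1 h2]; rewrite h2 andbT.
    by case: eqP => [->|].
  apply: bigcupT_measurable => k; apply: sub_gen_smallest.
  by eexists; eexists; reflexivity.
by move=> /(_ measurableT B mB); rewrite setTI.
Qed.

Lemma oboxI a b a' b' : obox a b `&` obox a' b' =
  obox (fun i => Num.max (a i) (a' i)) (fun i => Num.min (b i) (b' i)).
Proof.
apply/seteqP; split => [x [h h'] i|x h].
  have /andP[h1 h2] := h i; have /andP[h3 h4] := h' i.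
  by rewrite gt_max lt_min h1 h2 h3 h4.
by split => i; have := h i; rewrite gt_max lt_min => /andP[/andP[h1 h2] /andP[h3 h4]];
  rewrite ?h1 ?h2 ?h3 ?h4.
Qed.

Section vanish.
Variable Omega : set 'rV[R]_n.
Hypothesis oO : open Omega.
Variable g : 'rV[R]_n -> R.
Hypothesis ig : lebn.-integrable Omega (EFin \o g).
Hypothesis g0 : forall phi, test_function Omega phi ->
  integral_in Omega (fun x => g x * phi x) = 0.

Let mO : measurable Omega := open_measurable_rV oO.

Let box0 a b : cbox a b `<=` Omega -> \int[lebn]_(x in Omega) (g x * \1_(obox a b) x) = 0.
Proof.
move=> bO; have mg := integrable_measurable ig.
have mb k : measurable_fun Omega (bump a b k).
  by apply: measurable_funTS; apply: continuous_measurable_rV; apply: smooth_continuous; exact: smooth_bump.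
have [] := @dominated_convergence _ _ _ lebn Omega mO
  (fun k x => (g x * bump a b k x)%:E) (fun x => (g x * \1_(obox a b) x)%:E) (fun x => `|g x|%:E).
- by move=> k; apply/measurable_EFinP; exact: measurable_funM.
- apply/measurable_EFinP; apply: measurable_funM => //.
  by apply: measurable_funTS; apply: measurable_indic; exact: measurable_obox.
- apply: ae_all => x _; apply: cvg_EFin; first exact: nearW.
  by apply: cvgM; [exact: cvg_cst|exact: bump_cvg].
- exact: integrable_norm ig.
- apply: nearW => x k Ox; rewrite /= lee_fin normrM.
  have /andP[b0 b1] := bump_bound a b k x.
  by rewrite (ger0_norm b0) ler_piMr.
move=> i1 _ h; rewrite /Rintegral.
move: h; rewrite [X in X @ \oo](_ : _ = cst 0%E); last first.
  apply/funext => k /=; rewrite Rintegral_EFin//.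
    by have := g0 (test_bump k bO); rewrite /integral_in => ->.
  apply: (integrable_ae_le mO _ (integrable_norm ig)); first exact: measurable_funM.
  apply: ae_all => x Ox; rewrite normrM; have /andP[b0 b1] := bump_bound a b k x.
  by rewrite (ger0_norm b0) ler_piMr.
by move=> /(cvg_unique _ (@cvg_cst _ _ _ _ _)) <-.
Qed.

(** The sets on which [g] integrates to zero form a Dynkin class, inside any box
    of Omega. *)
Theorem fundamental_lemma : {ae lebn, forall x, Omega x -> g x = 0}.
Proof.
have key a b : cbox a b `<=` Omega -> {ae lebn, forall x, obox a b x -> g x = 0}.
  move=> bO; pose B := obox a b.
  have mB : measurable B by exact: measurable_obox.
  have BO : B `<=` Omega.
    by move=> x bx; apply: bO => i; have /andP[/ltW -> /ltW ->] := bx i.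
  have igB : lebn.-integrable B (EFin \o g) by exact: integrableS ig.
  have igS A : measurable A -> A `<=` B -> lebn.-integrable A (EFin \o g).
    by move=> mA AB; exact: integrableS igB.
  have indE A : measurable A -> A `<=` B ->
      (\int[lebn]_(x in Omega) (g x * \1_A x)%:E = \int[lebn]_(x in A) (g x)%:E)%E.
    move=> mA AB; rewrite [LHS]integral_mkcond [RHS]integral_mkcond.
    apply: eq_integral => x _; rewrite !patchE indicE.
    have [xA|xA] := boolP (x \in A).
      by rewrite mem_set ?mulr1//; apply: BO; apply: AB; exact: set_mem.
    by rewrite mulr0; case: ifP.
  pose P A := (\int[lebn]_(x in A `&` B) (g x)%:E = 0)%E.
  have boxP a' b' : P (obox a' b').
    rewrite /P oboxI; set a2 := (fun i => _); set b2 := (fun i => Num.min _ _).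
    have sB : obox a2 b2 `<=` B by rewrite /a2 /b2 -oboxI; exact: subIsetr.
    have mb2 := measurable_obox a2 b2.
    rewrite -indE// Rintegral_EFin//; last first.
      apply: (integrable_ae_le mO _ (integrable_norm ig)).
        apply: measurable_funM; first exact: integrable_measurable ig.
        by apply: measurable_funTS; exact: measurable_indic.
      apply: ae_all => x _; rewrite normrM indicE.
      by rewrite /= ler_piMr// normr_nat lern1 leq_b1.
    rewrite (box0 _)// => x h; apply: bO => i; have := h i.
    by rewrite ge_max le_min => /andP[/andP[_ ->] /andP[_ ->]].
  have PA A : measurable A -> P A.
    move=> mA; apply: (@dynkin_induction _ _ _ P measurable_rV_boxes).
    - by move=> _ _ [a1 [b1 ->]] [a2 [b2 ->]]; rewrite oboxI; eexists; eexists; reflexivity.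
    - by rewrite /P setTI -(setIid B); exact: boxP.
    - by move=> _ [a' [b' ->]]; exact: boxP.
    - move=> S mS PS.
      have := boxP a b; rewrite /P setIid -/B.
      rewrite [X in (\int[lebn]_(x in X) _)%E = _ -> _](_ : B = (S `&` B) `|` (~` S `&` B)); last first.
        by rewrite -setIUl setUv setTI.
      rewrite integral_setU//=.
      + by rewrite PS add0e.
      + exact: measurableI.
      + by apply: measurableI => //; exact: measurableC.
      + by rewrite -setIUl setUv setTI; exact: measurable_int igB.
      + by rewrite disj_set2E setIACA setICr set0I.
    - move=> F mF tF PF; rewrite /P setI_bigcupl integral_bigcup.
      + by apply: eseries0 => k _ _; exact: PF.
      + by apply: trivIset_setIr.
      + by move=> k; exact: measurableI.
      + apply: igS; first by apply: bigcupT_measurable => k; exact: measurableI.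
        by apply: bigcup_sub => k _; exact: subIsetr.
    by rewrite -measurable_rV_boxes.
  have := integral_ae_eq mB igB (measurable_cst (0 : \bar R)).
  have h E : E `<=` B -> measurable E ->
      (\int[lebn]_(x in E) (g x)%:E = \int[lebn]_(x in E) (cst 0 x))%E.
    by move=> EB mE; rewrite integral0; have := PA E mE; rewrite /P setIidl.
  by move=> /(_ h); apply: filterS => x hx /hx [].
have ka k : {ae lebn, forall x, setT x ->
    if unpickle k is Some p then rat_cbox p `<=` Omega -> rat_box p x -> g x = 0 else True}.
  case: (unpickle k) => [p|]; last exact: ae_all.
  have [pO|nO] := pselect (rat_cbox p `<=` Omega); last by apply: ae_all => x _ /nO.
  have := key (fun i => ratr (p.1 ord0 i) - p.2.+1%:R^-1) (fun i => ratr (p.1 ord0 i) + p.2.+1%:R^-1).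
  move=> H; have {}H := H _; apply: filterS (H _).
    move=> x hx _ _ px; apply: hx => i; have := px i.
    rewrite distrC; set r := _^-1; rewrite ltr_norml => /andP[h1 h2].
    by apply/andP; split; lra.
  move=> x hx; apply: pO => i; have := hx i.
  rewrite distrC; set r := _^-1; rewrite ler_norml => /andP[h1 h2].
  by apply/andP; split; lra.
apply: filterS (ae_nat ka) => x h Ox.
have [p px pO] := open_rat_box oO Ox.
by have := h I (pickle p); rewrite pickleK; apply.
Qed.

End vanish.
End fundamental_lemma.

(** * The space H10 *)

Section H10.
Context {R : realType} {n : nat}.
Variable Omega : set 'rV[R]_n.
Hypothesis oO : open Omega.
Hypothesis bO : bounded_set Omega.
Implicit Types (u v f : 'rV[R]_n -> R) (g : 'I_n -> 'rV[R]_n -> R).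

Local Notation lebn := (@lebesgue_rV R n).
Local Notation ae P := {ae lebn, forall x, Omega x -> P x}.
Local Notation L2 := (L2 lebn Omega).
Local Notation ip := (ip lebn Omega).
Local Notation test := (test_function Omega).
Local Notation H10 := (is_H10 Omega).
Local Notation D := (dirichlet Omega).
Local Notation wp := (weak_partial Omega).

Let mO : measurable Omega := open_measurable_rV oO.
Let L2l := L2_lin lebn mO.
Let ipp := ip_psd lebn mO.

Let cube : exists L, 0 < L /\ forall x, Omega x -> forall i, `|x ord0 i| <= L.
Proof. by have [L L0 OL] := bounded_cube bO; exists L. Qed.

Lemma finite_Omega : (lebn Omega < +oo)%E.
Proof. by have [L [L0 OL]] := cube; exact: Omega_finite OL mO. Qed.

Lemma L2_test phi : test phi -> L2 phi.
Proof. by have [L [L0 OL]] := cube; exact: test_L2 OL mO phi. Qed.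

Lemma L2_test_partial phi i : test phi -> L2 (partial i phi).
Proof. by move=> tp; apply: L2_test; exact: test_partial. Qed.

Lemma L2_cst (c : R) : L2 (cst c).
Proof.
split; first exact: measurable_cst.
apply: measurable_bounded_integrable; [exact: mO|exact: finite_Omega|by apply: measurable_funX; exact: measurable_cst|].
by exists `|c ^+ 2|; split; [exact: num_real|move=> x Mx t _; exact: ltW].
Qed.

Lemma L2_integrable f : L2 f -> lebn.-integrable Omega (EFin \o f).
Proof.
move=> lf; have := L2_mul mO lf (L2_cst 1).
by congr (lebn.-integrable _ _); apply/funext => x /=; rewrite mulr1.
Qed.

Lemma ibp_ip phi psi i : test phi -> test psi ->
  ip phi (partial i psi) = - ip (partial i phi) psi.
Proof.
have [L [L0 OL]] := cube; move=> tp ts.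
exact: (integration_by_parts_test OL mO i tp (test_smooth ts)).
Qed.

(** The class [P] is that of all test functions, or of the nonnegative ones. *)
Definition approx (P : ('rV[R]_n -> R) -> Prop) f g := forall e : R, 0 < e ->
  exists phi, [/\ test phi, P phi, ip (phi - f) (phi - f) <= e &
    forall i, ip (partial i phi - g i) (partial i phi - g i) <= e].

(** The gradient is carried along with the function because [weak_partial] is
    only a chosen representative of it. *)
Definition H10g f g := [/\ L2 f, forall i, L2 (g i) & approx (fun=> True) f g].

(** Integration by parts against a test function passes to the limit in L2. *)
Lemma weak_partial_of_H10g f g i : H10g f g -> weak_partial_of Omega i f (g i).
Proof.
move=> [lf lg ap]; split; first exact: lg.
move=> psi tpsi.
have lpsi := L2_test tpsi; have ldpsi := L2_test_partial i tpsi.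
suff : ip f (partial i psi) + ip (g i) psi = 0.
  by move/eqP; rewrite addr_eq0 => /eqP.
apply/eqP; rewrite -normr_eq0 eq_le normr_ge0 andbT.
apply/ler_addgt0Pr => d d0; rewrite add0r.
have d20 : 0 < d / 2 by rewrite divr_gt0.
have [e1 e10 h1] := form_small L2l ipp (ip (partial i psi) (partial i psi)) d20.
have [e2 e20 h2] := form_small L2l ipp (ip psi psi) d20.
have [|phi [tphi _ hf hg]] := ap (Num.min e1 e2); first by rewrite lt_min e10.
have lphi := L2_test tphi; have ldphi := L2_test_partial i tphi.
have lf' := lin_closedB L2l lphi lf; have lg' := lin_closedB L2l ldphi (lg i).
have := h1 _ _ lf' ldpsi (le_trans hf _) (lexx _); rewrite ge_min lexx => /(_ isT).
have := h2 _ _ lg' lpsi (le_trans (hg i) _) (lexx _); rewrite ge_min lexx orbT => /(_ isT).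
rewrite !(formBl L2l ipp)//.
have -> : ip f (partial i psi) + ip (g i) psi =
   - (ip phi (partial i psi) - ip f (partial i psi))
   - (ip (partial i phi) psi - ip (g i) psi).
  by rewrite (ibp_ip i tphi tpsi); ring.
move=> k1 k2; apply: le_trans (ler_normB _ _) _; rewrite normrN; lra.
Qed.

Lemma weak_partial_unique i f (g g' : 'rV[R]_n -> R) : weak_partial_of Omega i f g ->
  weak_partial_of Omega i f g' -> ae (fun x => g x = g' x).
Proof.
move=> [lg hg] [lg' hg'].
have ld := lin_closedB L2l lg lg'.
have := @fundamental_lemma _ _ _ oO _ (L2_integrable ld).
move=> H; have {}H := H _; apply: ae_imp (H _) => [x _|phi tphi].
  by move/eqP; rewrite subr_eq0 => /eqP.
have h1 := hg _ tphi; have h2 := hg' _ tphi; rewrite h1 in h2.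
rewrite -[LHS]/(ip (g - g') phi) (formBl L2l ipp)//; last exact: L2_test.
by apply/eqP; rewrite subr_eq0; apply/eqP; exact: oppr_inj h2.
Qed.

Lemma weak_partialP i f (g : 'rV[R]_n -> R) : weak_partial_of Omega i f g ->
  weak_partial_of Omega i f (wp i f) /\ ae (fun x => wp i f x = g x).
Proof.
move=> h; have hw : weak_partial_of Omega i f (wp i f) by apply: xgetPex; exists g.
by split=> //; exact: weak_partial_unique h.
Qed.

Lemma ip_sub_ae u v v' : L2 u -> L2 v -> L2 v' -> ae (fun x => v x = v' x) ->
  ip (u - v) (u - v) = ip (u - v') (u - v').
Proof.
move=> lu lv lv' vv'; have l1 := lin_closedB L2l lu lv; have l2 := lin_closedB L2l lu lv'.
have h : ae (fun x => (u - v) x = (u - v') x).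
  by apply: ae_imp vv' => x _; rewrite /GRing.add/GRing.opp/= => ->.
exact: ip_eq_ae.
Qed.

Lemma H10_H10g f : H10 f -> H10g f (fun i => wp i f).
Proof.
move=> [[lf hw] [phi [tphi cf cg]]].
have lw i : L2 (wp i f) by have [g hg] := hw i; have [[]] := weak_partialP hg.
split => // e e0.
have ev (a : nat -> R) : a k @[k --> \oo] --> (0 : R) -> \forall k \near \oo, a k <= e.
  move=> /cvgrPdist_le/(_ e e0); apply: filterS => k; rewrite sub0r normrN.
  by apply: le_trans; exact: ler_norm.
have [k _ hk] : \forall k \near \oo, integral_in Omega (fun x => (phi k x - f x) ^+ 2) <= e /\
    forall i, integral_in Omega (fun x => (partial i (phi k) x - wp i f x) ^+ 2) <= e.
  near=> k; split; first by near: k; exact: ev.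
  by near: k; apply: filter_forall => i; exact: ev.
have [h1 h2] := hk k (leqnn k).
by exists (phi k); split.
Unshelve. all: by end_near. Qed.

Lemma H10g_H10 f g : H10g f g -> H10 f /\ forall i, ae (fun x => wp i f x = g i x).
Proof.
move=> hf; have [lf lg ap] := hf.
have hw i := weak_partialP (weak_partial_of_H10g i hf).
split; last by move=> i; exact: (hw i).2.
split; first by split=> // i; exists (g i); exact: weak_partial_of_H10g.
pose inv (k : nat) : R := k.+1%:R^-1.
have inv0 k : 0 < inv k by rewrite invr_gt0.
have [phi hphi] := choice (fun k => ap (inv k) (inv0 k)).
have to0 (a : nat -> R) : (forall k, 0 <= a k <= inv k) -> a k @[k --> \oo] --> (0 : R).
  move=> ha; apply: (@squeeze_cvgr _ _ _ _ (cst 0) inv).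
  - by apply: nearW => k; exact: ha.
  - exact: cvg_cst.
  - exact: cvg_harmonic.
exists phi; split.
- by move=> k; have [] := hphi k.
- apply: to0 => k; have [t _ h _] := hphi k.
  have ld := lin_closedB L2l (L2_test t) lf.
  by have := form_ge0 ipp ld; rewrite ip_sqr in h *; rewrite /integral_in => -> /=.
- move=> i; apply: to0 => k; have [t _ _ /(_ i)h] := hphi k.
  have lw : L2 (wp i f) by have [[]] := hw i.
  rewrite (ip_sub_ae _ (lg i) lw) in h; last 2 first.
  + exact: L2_test_partial.
  + by apply: ae_imp (hw i).2 => x _ ->.
  have ld := lin_closedB L2l (L2_test_partial i t) lw.
  by have := form_ge0 ipp ld; rewrite ip_sqr in h *; rewrite /integral_in => -> /=.
Qed.

Lemma H10_L2 f : H10 f -> L2 f.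
Proof. by case=> -[]. Qed.

Lemma H10_wp f i : H10 f -> L2 (wp i f).
Proof. by move=> /H10_H10g[_ lg _]; exact: lg. Qed.

Lemma H10g_lin a f g f' g' : H10g f g -> H10g f' g' ->
  H10g (a *: f + f') (fun i => a *: g i + g' i).
Proof.
move=> [lf lg ap] [lf' lg' ap']; split.
- exact: L2l.2.
- by move=> i; exact: L2l.2.
move=> e e0; pose d := e / (2 * (a ^+ 2 + 1)).
have a0 : 0 < a ^+ 2 + 1 by rewrite ltr_wpDl// sqr_ge0.
have d0 : 0 < d by rewrite divr_gt0// mulr_gt0.
have [phi [t _ h1 h2]] := ap d d0; have [phi' [t' _ h1' h2']] := ap' d d0.
have st := test_smooth t; have st' := test_smooth t'.
have key u v u' v' : L2 u -> L2 v -> L2 u' -> L2 v' -> ip (u - v) (u - v) <= d ->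
    ip (u' - v') (u' - v') <= d ->
    ip ((a *: u + u') - (a *: v + v')) ((a *: u + u') - (a *: v + v')) <= e.
  move=> lu lv lu' lv' k1 k2.
  have -> : (a *: u + u') - (a *: v + v') = (u' - v') + a *: (u - v).
    by rewrite scalerBr opprD addrACA addrC.
  have w := lin_closedB L2l lu lv; have w' := lin_closedB L2l lu' lv'.
  have aw := lin_closedZ L2l a w.
  have := form_ge0 ipp (lin_closedB L2l w' aw).
  rewrite (form_sqrB L2l ipp w' aw) (form_sqrD L2l ipp w' aw) (form_sqrZ L2l ipp a w).
  have -> : e = 2 * (a ^+ 2 * d + d) by rewrite /d; field; rewrite gt_eqF.
  have := ler_wpM2l (sqr_ge0 a) k1; lra.
exists (a *: phi + phi'); split => //.
- exact: (test_lin Omega).2.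
- by apply: key => //; exact: L2_test.
- move=> i; have -> : partial i (a *: phi + phi') = a *: partial i phi + partial i phi'.
    apply/funext => x; rewrite [LHS]partial_add//; last exact: smooth_mul (smooth_cst a) st.
    by rewrite partial_scale.
  by apply: key => //; exact: L2_test_partial.
Qed.

Lemma H10g_test phi : test phi -> H10g phi (fun i => partial i phi).
Proof.
move=> tp; split; [exact: L2_test|by move=> i; exact: L2_test_partial|].
move=> e e0; exists phi; split => // [|i]; rewrite subrr (form0l L2l ipp) ?ltW//; exact: L2l.1.
Qed.

Lemma H10_test phi : test phi -> H10 phi.
Proof. by move=> /H10g_test/H10g_H10[]. Qed.

Lemma H10_lin : lin_closed H10.
Proof.
split; first by apply: H10_test; exact: (test_lin Omega).1.
move=> a f f' /H10_H10g hf /H10_H10g hf'.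
by have [] := H10g_H10 (H10g_lin a hf hf').
Qed.

Lemma dirichletE u v : H10 u -> H10 v -> D u v = \sum_i ip (wp i u) (wp i v).
Proof.
move=> hu hv; rewrite /dirichlet /integral_in Rintegral_bigsum// => i.
by apply: (L2_mul mO); exact: H10_wp.
Qed.

Lemma dirichlet_H10g u g v g' : H10g u g -> H10g v g' -> D u v = \sum_i ip (g i) (g' i).
Proof.
move=> hu hv; have [u10 gu] := H10g_H10 hu; have [v10 gv] := H10g_H10 hv.
have [_ lg _] := hu; have [_ lg' _] := hv.
rewrite dirichletE//; apply: eq_bigr => i _.
by apply: ip_eq_ae => //; exact: H10_wp.
Qed.

Lemma dirichlet_psd : psd_form H10 D.
Proof.
split.
- move=> u v hu hv; rewrite (dirichletE hu hv) (dirichletE hv hu); apply: eq_bigr => i _.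
  by apply: (form_sym ipp); exact: H10_wp.
- move=> a u v w hu hv hw.
  have := H10g_lin a (H10_H10g hu) (H10_H10g hv) => huv.
  rewrite (dirichlet_H10g huv (H10_H10g hw)) (dirichletE hu hw) (dirichletE hv hw) mulr_sumr -big_split/=.
  by apply: eq_bigr => i _; apply: (formPl ipp); exact: H10_wp.
- move=> u hu; rewrite (dirichletE hu hu); apply: sumr_ge0 => i _.
  by apply: (form_ge0 ipp); exact: H10_wp.
Qed.

Lemma ip_H10_psd : psd_form H10 ip.
Proof.
split=> [u v /H10_L2 hu /H10_L2 hv|a u v w /H10_L2 hu /H10_L2 hv /H10_L2 hw|u /H10_L2 hu].
- exact: (form_sym ipp).
- exact: (formPl ipp).
- exact: (form_ge0 ipp).
Qed.

Lemma H10g_eq_ae f f' g : measurable_fun Omega f' -> ae (fun x => f x = f' x) ->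
  H10g f g -> H10g f' g.
Proof.
move=> mf' ff' [lf lg ap]; have lf' : L2 f' by exact: L2_eq_ae lf.
split => // e /ap[phi [t _ h1 h2]]; exists phi; split => //.
by rewrite -(ip_sub_ae _ lf)//; exact: L2_test.
Qed.

Lemma dirichlet_dist u g v g' : H10g u g -> H10g v g' ->
  D (u - v) (u - v) = \sum_i ip (g i - g' i) (g i - g' i).
Proof.
move=> hu hv; have h := H10g_lin (-1) hv hu.
have -> : u - v = (-1) *: v + u by rewrite scaleN1r addrC.
rewrite (dirichlet_H10g h h); apply: eq_bigr => i _.
by rewrite scaleN1r addrC.
Qed.

Lemma H10_dense u e : H10 u -> 0 < e ->
  exists2 phi, test phi & ip (phi - u) (phi - u) <= e /\ D (phi - u) (phi - u) <= e.
Proof.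
move=> hu e0; have hg := H10_H10g hu; have [_ _ ap] := hg.
have d0 : 0 < e / n.+1%:R by rewrite divr_gt0.
have [phi [t _ h1 h2]] := ap _ d0.
exists phi => //; split.
  apply: le_trans h1 _; rewrite ler_pdivrMr//.
  by apply: ler_peMr; [exact: ltW|rewrite ler1n].
rewrite (dirichlet_dist (H10g_test t) hg).
apply: le_trans (ler_sum _ (fun i _ => h2 i)) _.
rewrite sumr_const card_ord -[leLHS]mulr_natr mulrAC ler_pdivrMr//.
by apply: ler_wpM2l; [exact: ltW|rewrite ler_nat].
Qed.

Lemma H10_test_seq u : H10 u -> exists phi : nat -> 'rV[R]_n -> R,
  [/\ forall k, test (phi k), form_lim ip phi u, form_lim D phi u &
   forall k, ip (phi k - u) (phi k - u) <= 8^-1 ^+ k].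
Proof.
move=> hu.
have e0 k : 0 < 8^-1 ^+ k :> R by rewrite exprn_gt0// invr_gt0.
have hk k : exists phi, test phi /\
    (ip (phi - u) (phi - u) <= 8^-1 ^+ k /\ D (phi - u) (phi - u) <= 8^-1 ^+ k).
  by have [phi t h] := H10_dense hu (e0 k); exists phi.
have [phi hphi] := choice hk.
have ev e : 0 < e -> exists N, forall k, (N <= k)%N -> 8^-1 ^+ k <= e :> R.
  move=> de; have /cvgrPdist_le/(_ _ de)[N _ hN] : geometric 1 (8^-1 : R) @ \oo --> (0 : R).
    by apply: cvg_geometric; rewrite ger0_norm// invf_lt1// ltr1n.
  exists N => k /hN; rewrite sub0r normrN /= mul1r; apply: le_trans.
  exact: ler_norm.
exists phi; split.
- by move=> k; have [] := hphi k.
- move=> e /ev[N hN]; exists N => k /hN; apply: le_trans.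
  by have [_ []] := hphi k.
- move=> e /ev[N hN]; exists N => k /hN; apply: le_trans.
  by have [_ []] := hphi k.
- by move=> k; have [_ []] := hphi k.
Qed.

End H10.

Section H10_theory.
Context {R : realType} {n : nat}.
Variable Omega : set 'rV[R]_n.
Hypothesis oO : open Omega.
Hypothesis bO : bounded_set Omega.
Implicit Types (u v f : 'rV[R]_n -> R) (g : 'I_n -> 'rV[R]_n -> R).

Local Notation lebn := (@lebesgue_rV R n).
Local Notation ae P := {ae lebn, forall x, Omega x -> P x}.
Local Notation L2 := (L2 lebn Omega).
Local Notation ip := (ip lebn Omega).
Local Notation test := (test_function Omega).
Local Notation H10 := (is_H10 Omega).
Local Notation D := (dirichlet Omega).
Local Notation wp := (weak_partial Omega).

Let mO : measurable Omega := open_measurable_rV oO.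
Let L2l := L2_lin lebn mO.
Let ipp := ip_psd lebn mO.
Let H10l := H10_lin oO bO.
Let Dp := dirichlet_psd oO bO.
Let ip1 := ip_H10_psd oO.

(** The i-th derivative of [phi ^ 2 * x_i] has integral zero, and is [phi ^ 2
    + 2 * x_i * phi * partial i phi]; Young's inequality absorbs the mixed
    term. *)
Lemma poincare_test (L : R) i phi : 0 < L ->
  (forall x, Omega x -> forall i, `|x ord0 i| <= L) -> test phi ->
  ip phi phi <= 4 * L ^+ 2 * ip (partial i phi) (partial i phi).
Proof.
move=> L0 OL tphi; have sphi := test_smooth tphi.
have tpp : test (fun x => phi x * phi x) by exact: test_mul.
have sc := smooth_coord i : smooth (fun x : 'rV[R]_n => x ord0 i).
have h0 := integral_partial0 OL i (test_mul tpp sc).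
have ld := L2_test_partial oO bO i tphi; have lphi := L2_test oO bO tphi.
have pp := L2_mul mO lphi lphi; have dd := L2_mul mO ld ld.
have h1 : lebn.-integrable Omega (EFin \o (fun x => 2^-1 * (phi x * phi x) -
    2 * L ^+ 2 * (partial i phi x * partial i phi x))).
  by apply: (integrable_sub mO); exact: (integrable_scale mO).
have : \int[lebn]_(x in Omega) (2^-1 * (phi x * phi x) -
    2 * L ^+ 2 * (partial i phi x * partial i phi x)) <= 0.
  rewrite -h0; apply: (Rintegral_le_ae mO) => //.
    by apply: (test_integrable OL mO); apply: test_partial; exact: test_mul.
  apply: ae_all => x Ox; rewrite (partial_mul _ _ (test_smooth tpp) sc).
  rewrite partial_coord eqxx mulr1 partial_mul//.
  have := OL x Ox i; set t := x ord0 i; set a := phi x; set b := partial i phi x => tL.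
  have t2 : t ^+ 2 <= L ^+ 2 by rewrite -(real_normK (num_real t)) ler_pXn2r ?nnegrE ?(ltW L0).
  have := sqr_ge0 (a + 2 * t * b); have := ler_wpM2r (sqr_ge0 b) t2; nra.
rewrite RintegralB//; [|exact: (integrable_scale mO)|exact: (integrable_scale mO)].
rewrite RintegralZl// RintegralZl//.
by rewrite !ipE; lra.
Qed.

Lemma poincare (i : 'I_n) : exists C, forall u, H10 u -> ip u u <= C * D u u.
Proof.
have [L L0 OL] := bounded_cube bO; exists (4 * L ^+ 2) => u hu.
have [phi [tphi l1 l2 _]] := H10_test_seq oO bO hu.
have hphi k : H10 (phi k) by exact: H10_test.
have c1 := form_lim_cvg H10l ip1 hphi hu l1.
have c2 := form_lim_cvg H10l Dp hphi hu l2.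
have c3 : 4 * L ^+ 2 * D (phi k) (phi k) @[k --> \oo] --> 4 * L ^+ 2 * D u u.
  by apply: cvgM => //; exact: cvg_cst.
apply: (ler_cvg_to c1 c3); apply: nearW => k /=.
apply: le_trans (poincare_test i L0 OL (tphi k)) _; apply: ler_wpM2l.
  by rewrite mulr_ge0 ?sqr_ge0.
have ht := H10g_test oO bO (tphi k).
rewrite (dirichlet_H10g oO bO ht ht) (bigD1 i)//= lerDl sumr_ge0// => j _.
by apply: (form_ge0 ipp); exact: L2_test_partial.
Qed.

(** By Poincare's inequality a Cauchy sequence for the Dirichlet form is
    Cauchy in L2 together with its gradients, and the L2 limits are a function
    of H10 and its gradient. *)
Theorem H10_complete (i0 : 'I_n) : form_complete H10 D.
Proof.
move=> x hx cx.
have [C hC] := poincare i0.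
have C1 : 0 < `|C| + 1 by rewrite ltr_wpDl.
have lx k : L2 (x k) by exact: H10_L2 (hx k).
have lwx i k : L2 (wp i (x k)) by exact: H10_wp.
have hgx k := H10_H10g oO bO (hx k).
have cip : form_cauchy ip x.
  move=> e e0; have [|N hN] := cx (e / (`|C| + 1)); first by rewrite divr_gt0.
  exists N => j k Nj Nk; have := hN j k Nj Nk; rewrite ler_pdivlMr// => h.
  have hd := lin_closedB H10l (hx j) (hx k).
  have := hC _ hd; have := form_ge0 Dp hd; have := ler_norm C; nra.
have cwp i : form_cauchy ip (fun k => wp i (x k)).
  move=> e e0; have [N hN] := cx e e0; exists N => j k Nj Nk.
  apply: le_trans (hN j k Nj Nk); rewrite (dirichlet_dist oO bO (hgx j) (hgx k)).
  rewrite (bigD1 i)//= lerDl sumr_ge0// => k' _.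
  by apply: (form_ge0 ipp); exact: (lin_closedB L2l).
have [f lf xf] := L2_complete mO lx cip.
have hh i : exists g : 'rV[R]_n -> R, L2 g /\ form_lim ip (fun k => wp i (x k)) g.
  by have [g lg h] := L2_complete mO (lwx i) (cwp i); exists g.
have [g hg] := choice hh.
have hfg : H10g Omega f g.
  split => // [i|e e0]; first exact: (hg i).1.
  have e4 : 0 < e / 4 by rewrite divr_gt0.
  have [N1 h1] := xf _ e4.
  have hN i : exists N, forall k, (N <= k)%N -> ip (wp i (x k) - g i) (wp i (x k) - g i) <= e / 4.
    exact: (hg i).2.
  have [N2 h2] := choice hN.
  pose k := maxn N1 (\max_i N2 i).
  have [_ _ ap] := hgx k.
  have [phi [t _ k1 k2]] := ap _ e4.
  have key a b c : L2 a -> L2 b -> L2 c -> ip (a - b) (a - b) <= e / 4 ->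
      ip (b - c) (b - c) <= e / 4 -> ip (a - c) (a - c) <= e.
    move=> la lb lc; have ab := lin_closedB L2l la lb; have bc := lin_closedB L2l lb lc.
    have -> : a - c = (a - b) + (b - c) by rewrite addrA subrK.
    have := form_ge0 ipp (lin_closedB L2l ab bc).
    by rewrite (form_sqrD L2l ipp ab bc) (form_sqrB L2l ipp ab bc); lra.
  exists phi; split => //.
    apply: (key _ (x k)) => //; first exact: L2_test.
    by apply: h1; exact: leq_maxl.
  move=> i; apply: (key _ (wp i (x k))) => //.
  - exact: L2_test_partial.
  - exact: (hg i).1.
  - by apply: h2; apply: leq_trans (leq_maxr _ _); exact: leq_bigmax.
have [hf _] := H10g_H10 oO bO hfg.
exists f => // e e0.
have en : 0 < e / n.+1%:R by rewrite divr_gt0.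
have hN i : exists N, forall k, (N <= k)%N -> ip (wp i (x k) - g i) (wp i (x k) - g i) <= e / n.+1%:R.
  exact: (hg i).2.
have [N hN'] := choice hN.
exists (\max_i N i) => k hk; rewrite (dirichlet_dist oO bO (hgx k) hfg).
apply: (@le_trans _ _ (\sum_(i < n) e / n.+1%:R)).
  by apply: ler_sum => i _; apply: hN'; apply: leq_trans hk; exact: leq_bigmax.
rewrite sumr_const card_ord -[leLHS]mulr_natr mulrAC ler_pdivrMr//.
by apply: ler_wpM2l; [exact: ltW|rewrite ler_nat].
Qed.

(** The test functions of [P] with energy at most [M] and at L2 distance at
    most [1 / (k + 1)] (squared) from [f] form a decreasing sequence of
    midpoint convex sets. Near minimizers of the energy over them converge in
    H1, although only their convergence in L2 is assumed: this does the work
    of weak compactness. *)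
Lemma H10_closure (P : ('rV[R]_n -> R) -> Prop) f (M : R) : L2 f ->
  (forall phi psi, P phi -> P psi -> P (2^-1 *: (phi + psi))) ->
  (forall e : R, 0 < e -> exists phi, [/\ test phi, P phi, ip (phi - f) (phi - f) <= e &
    D phi phi <= M]) ->
  exists g, [/\ forall i, L2 (g i), approx Omega P f g & \sum_i ip (g i) (g i) <= M].
Proof.
move=> lf Pmid ap.
pose inv (k : nat) : R := k.+1%:R^-1.
have inv0 k : 0 < inv k by rewrite invr_gt0.
pose A k := [set phi | [/\ test phi, P phi, ip (phi - f) (phi - f) <= inv k & D phi phi <= M]].
have tl := test_lin Omega.
have tD : psd_form test D by apply: psd_form_sub Dp => phi; exact: H10_test.
have half (b : ('rV[R]_n -> R) -> ('rV[R]_n -> R) -> R) S u v c :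
    lin_closed S -> psd_form S b -> S u -> S v ->
    b u u <= c -> b v v <= c -> b (2^-1 *: (u + v)) (2^-1 *: (u + v)) <= c.
  move=> Sl hb Su Sv bu bv; rewrite (form_sqrZ Sl hb); last exact: lin_closedD.
  have := form_ge0 hb (lin_closedB Sl Su Sv); rewrite (form_parallelogram Sl hb Su Sv).
  have -> : 2^-1 ^+ 2 = 4^-1 :> R by field.
  by set z := b (u + v) _; move: bu bv; set b1 := b u u; set b2 := b v v; lra.
have [x Ax cx] : exists2 x, forall k, A k (x k) & form_cauchy D x.
  apply: (nested_midconvex_cauchy tl tD (M := M)).
  - by move=> k phi [].
  - move=> j k jk phi [h1 h2 h3 h4]; split => //; apply: le_trans h3 _.
    by rewrite lef_pV2 ?posrE// ler_nat ltnS.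
  - by move=> k; have [phi h] := ap _ (inv0 k); exists phi.
  - move=> k u v [tu Pu iu Du] [tv Pv iv Dv]; split.
    + by apply: (lin_closedZ tl); exact: (lin_closedD tl).
    + exact: Pmid.
    + have lu := lin_closedB L2l (L2_test oO bO tu) lf.
      have lv := lin_closedB L2l (L2_test oO bO tv) lf.
      have -> : 2^-1 *: (u + v) - f = 2^-1 *: ((u - f) + (v - f)).
        rewrite [in RHS]addrACA -opprD [in RHS]scalerBr; congr (_ - _).
        have h2 : 2^-1 + 2^-1 = 1 :> R by field.
        by rewrite scalerDr -scalerDl h2 scale1r.
      exact: (half ip L2 (u - f) (v - f) (inv k) L2l ipp lu lv iu iv).
    + exact: (half D test u v M tl tD tu tv Du Dv).
  - by move=> u [].
have tx k : test (x k) by have [] := Ax k.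
have lp i k : L2 (partial i (x k)) by exact: L2_test_partial.
have htx k := H10g_test oO bO (tx k).
have cp i : form_cauchy ip (fun k => partial i (x k)).
  move=> e e0; have [N hN] := cx e e0; exists N => j k Nj Nk.
  apply: le_trans (hN j k Nj Nk); rewrite (dirichlet_dist oO bO (htx j) (htx k)).
  rewrite (bigD1 i)//= lerDl sumr_ge0// => k' _.
  by apply: (form_ge0 ipp); exact: (lin_closedB L2l).
have hh i : exists g : 'rV[R]_n -> R, L2 g /\ form_lim ip (fun k => partial i (x k)) g.
  by have [g lg h] := L2_complete mO (lp i) (cp i); exists g.
have [g hg] := choice hh.
exists g; split.
- by move=> i; exact: (hg i).1.
- move=> e e0.
  have hN i : exists N, forall k, (N <= k)%N ->
      ip (partial i (x k) - g i) (partial i (x k) - g i) <= e.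
    exact: (hg i).2.
  have [N hN'] := choice hN.
  pose k := maxn (Num.truncn e^-1) (\max_i N i).
  have [t Px h _] := Ax k; exists (x k); split => //.
    apply: le_trans h _; rewrite -[e]invrK lef_pV2 ?posrE ?invr_gt0//.
    apply: (@le_trans _ _ ((Num.truncn e^-1).+1%:R)); first exact/ltW/truncnS_gt.
    by rewrite ler_nat ltnS leq_maxl.
  by move=> i; apply: hN'; apply: leq_trans (leq_maxr _ _); exact: leq_bigmax.
- have c i : ip (partial i (x k)) (partial i (x k)) @[k --> \oo] --> ip (g i) (g i).
    by apply: (form_lim_cvg L2l ipp); [exact: lp|exact: (hg i).1|exact: (hg i).2].
  have cs : \sum_i ip (partial i (x k)) (partial i (x k)) @[k --> \oo] --> \sum_i ip (g i) (g i).
    elim: (index_enum _) => [|i s IH].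
      by under eq_fun do rewrite big_nil; rewrite big_nil; exact: cvg_cst.
    by under eq_fun do rewrite big_cons; rewrite big_cons; apply: cvgD; [exact: c|exact: IH].
  apply: (ler_cvg_to cs (cvg_cst M)); apply: nearW => k.
  by have [_ _ _] := Ax k; rewrite (dirichlet_H10g oO bO (htx k) (htx k)).
Qed.

Lemma approx_wp P f g : H10g Omega f g -> approx Omega P f g ->
  approx Omega P f (fun i => wp i f).
Proof.
move=> hf ap e /ap[phi [t Pp h1 h2]]; exists phi; split => // i.
have [hf1 hw] := H10g_H10 oO bO hf; have [_ lg _] := hf.
rewrite -(ip_sub_ae oO _ (lg i)) //; first exact: L2_test_partial.
  exact: H10_wp.
by apply: ae_imp (hw i) => x _ ->.
Qed.

End H10_theory.

(** * Absolute values and compactness in H10 *)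

Section sabs.
Context {R : realType}.
Variable d : R.
Hypothesis d0 : 0 < d.

Definition root (s : R) : R := Num.sqrt (s ^+ 2 + d ^+ 2).

(** A smooth approximation of the absolute value with slopes in [[-1, 1]].
    Subtracting [d] makes it vanish at the origin, hence preserve compact
    supports. *)
Definition sabs (s : R) : R := root s - d.

Let pos s : 0 < s ^+ 2 + d ^+ 2.
Proof. by rewrite ltr_wpDl ?sqr_ge0// exprn_gt0. Qed.

Lemma root_gt0 s : 0 < root s.
Proof. by rewrite sqrtr_gt0. Qed.

Lemma root_sqr s : root s ^+ 2 = s ^+ 2 + d ^+ 2.
Proof. by rewrite sqr_sqrtr// ltW. Qed.

Lemma is_derive_root (s : R) : is_derive s 1 root (s / root s).
Proof.
have h1 : is_derive s 1 (fun t : R => t ^+ 2 + d ^+ 2) (2 * s).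
  have -> : (fun t : R => t ^+ 2 + d ^+ 2) = (@id R) ^+ 2 + cst (d ^+ 2) by [].
  by apply: is_derive_eq; rewrite addr0 expr1 /GRing.scale/= mulr1 mulr_natl.
have h2 := is_derive1_sqrt (pos s).
have h3 := @is_derive1_comp _ (@Num.sqrt R) (fun t => t ^+ 2 + d ^+ 2) s _ _ h2 h1.
suff -> : s / root s = (2 * Num.sqrt (s ^+ 2 + d ^+ 2))^-1 * (2 * s) by exact: h3.
by rewrite -/(root s); field; rewrite gt_eqF// root_gt0.
Qed.

Lemma is_derive_sabs (s : R) : is_derive s 1 sabs (s / root s).
Proof.
have h := @is_deriveD _ _ _ root (cst (- d)) s 1 _ _ (is_derive_root s) (is_derive_cst _ _ _).
by rewrite addr0 in h.
Qed.

(** The derivatives of [root] are polynomials times odd powers of [root^-1]. *)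
Lemma is_derive_poly_root (p : {poly R}) k (s : R) :
  is_derive s 1 (fun t => p.[t] * (root t)^-1 ^+ k)
   ((p^`() * ('X^2 + (d ^+ 2)%:P) - k%:R *: ('X * p)).[s] * (root s)^-1 ^+ k.+2).
Proof.
have r0 := root_gt0 s.
have d1 : is_derive s 1 (fun t => (root t)^-1) (- (root s) ^- 2 * (s / root s)).
  have [hd hv] := is_derive_root s.
  apply: DeriveDef; first by apply: derivableV => //; rewrite gt_eqF.
  by rewrite deriveV ?gt_eqF// hv.
have dp : is_derive s 1 (horner p) (p^`()).[s].
  by rewrite derivE derive1E; apply: derivableP; exact: derivable_horner.
have := @is_deriveX _ _ (fun t => (root t)^-1) k s 1 _ d1.
rewrite exprfctE => d2.
have d3 := is_deriveM dp d2.
have [hd hv] := d3; apply: DeriveDef; [exact: hd|apply: (etrans hv)].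
rewrite [LHS]/= hornerD hornerN hornerM hornerD hornerXn hornerC hornerZ hornerM hornerX -(root_sqr s) -[root s ^- 2]exprVn.
have rq : root s * (root s)^-1 = 1 by rewrite mulfV// gt_eqF.
move: rq; set r := root s; set q := r^-1; set a := p.[s]; set b := (p^`()).[s] => rq.
have scaleE (x y : R) : x *: y = x * y by [].
rewrite !scaleE; case: k {d2 d3 hd hv} => [|k].
  have -> : (b * r ^+ 2 - 0%:R * (s * a)) * q ^+ 2 = b * (r * q) ^+ 2 by ring.
  by rewrite rq expr1n mulr0n !mul0r mulr0 add0r expr0 mul1r mulr1.
rewrite -pred_Sn !exprS expr0; set Q := q ^+ k; set m := k.+1%:R.
have -> : (b * (r * (r * 1)) - m * (s * a)) * (q * (q * (q * Q))) =
  b * (r * q) ^+ 2 * (q * Q) - m * (s * a) * (q * (q * (q * Q))) by ring.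
by rewrite rq; ring.
Qed.

Lemma smooth1_sabs : smooth1 sabs.
Proof.
pose step (q : {poly R} * nat) : {poly R} * nat :=
  (q.1^`() * ('X^2 + (d ^+ 2)%:P) - q.2%:R *: ('X * q.1), q.2.+2).
pose F (q : {poly R} * nat) t := q.1.[t] * (root t)^-1 ^+ q.2.
pose Q k := iter k step ('X, 1%N).
exists (fun k => if k is j.+1 then F (Q j) else sabs); split => // -[|k] s.
  have -> : F (Q 0%N) s = s / root s by rewrite /F /= hornerX expr1.
  exact: is_derive_sabs.
exact: is_derive_poly_root.
Qed.

Lemma sabs_bound s t : `|sabs s - `|t| | <= `|s - t| + d.
Proof.
have r0 := root_gt0 s; have r2 := root_sqr s.
have h1 : `|s| <= root s.
  rewrite -(@ler_pXn2r _ 2) ?nnegrE ?(ltW r0)// r2 real_normK ?num_real//.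
  by rewrite lerDl sqr_ge0.
have h2 : root s <= `|s| + d.
  rewrite -(@ler_pXn2r _ 2) ?nnegrE ?(ltW r0) ?addr_ge0 ?(ltW d0)// r2.
  rewrite sqrrD real_normK ?num_real// -addrA lerD2l lerDr mulrn_wge0//.
  by rewrite mulr_ge0// ltW.
have h3 := ler_dist_dist s t.
move: h3; rewrite /sabs !ler_norml => /andP[h3 h4].
by apply/andP; split; move: h3 h4; set a := `|s| in h1 h2 *; set b := `|t|; lra.
Qed.

Lemma sabs_ge0 s : 0 <= sabs s.
Proof.
rewrite subr_ge0 -(@ler_pXn2r _ 2) ?nnegrE ?(ltW d0) ?(ltW (root_gt0 _))//.
by rewrite root_sqr lerDr sqr_ge0.
Qed.

Lemma sabs0 : sabs 0 = 0.
Proof. by rewrite /sabs /root expr0n add0r sqrtr_sqr gtr0_norm// subrr. Qed.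

Lemma sabs_contract s a : `|s / root s * a| <= `|a|.
Proof.
have r0 := root_gt0 s.
rewrite normrM ler_piMl// normrM normfV (gtr0_norm r0) ler_pdivrMr// mul1r.
rewrite -(@ler_pXn2r _ 2) ?nnegrE ?(ltW r0)// root_sqr real_normK ?num_real//.
by rewrite lerDl sqr_ge0.
Qed.

End sabs.

Section H10_abs.
Context {R : realType} {n : nat}.
Variable Omega : set 'rV[R]_n.
Hypothesis oO : open Omega.
Hypothesis bO : bounded_set Omega.
Implicit Types (u v f : 'rV[R]_n -> R) (g : 'I_n -> 'rV[R]_n -> R).

Local Notation lebn := (@lebesgue_rV R n).
Local Notation ae P := {ae lebn, forall x, Omega x -> P x}.
Local Notation L2 := (L2 lebn Omega).
Local Notation ip := (ip lebn Omega).
Local Notation test := (test_function Omega).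
Local Notation H10 := (is_H10 Omega).
Local Notation D := (dirichlet Omega).
Local Notation wp := (weak_partial Omega).

Let mO : measurable Omega := open_measurable_rV oO.
Let L2l := L2_lin lebn mO.
Let ipp := ip_psd lebn mO.
Let H10l := H10_lin oO bO.
Let Dp := dirichlet_psd oO bO.
Let ip1 := ip_H10_psd oO.

Definition nonneg (phi : 'rV[R]_n -> R) := forall x, 0 <= phi x.

Lemma dirichlet_sabs_test d phi : 0 < d -> test phi ->
  test (fun x => sabs d (phi x)) /\
  D (fun x => sabs d (phi x)) (fun x => sabs d (phi x)) <= D phi phi.
Proof.
move=> d0 tphi.
have ts : test (fun x => sabs d (phi x)).
  by apply: test_comp => //; [exact: smooth1_sabs|exact: sabs0].
split; first exact: ts.
have h1 := H10g_test oO bO ts; have h2 := H10g_test oO bO tphi.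
rewrite (dirichlet_H10g oO bO h1 h1) (dirichlet_H10g oO bO h2 h2).
apply: ler_sum => i _; apply: (ip_le mO); [exact: L2_test_partial|exact: L2_test_partial|].
apply: ae_all => x _.
rewrite (partial_comp _ (is_derive_sabs d0 (phi x)) (test_smooth tphi)).
exact: sabs_contract.
Qed.

Lemma sum_quarters (a b c e : R) :
  0 <= a - 2 * b + c -> a <= e / 4 -> c <= e / 4 -> a + 2 * b + c <= e.
Proof. by lra. Qed.

(** Composing with [sabs d] does not increase the energy of a test function
    and keeps it at a small L2 distance from [`|u|], so that [H10_closure]
    applies. *)
Lemma H10_abs_approx u : H10 u ->
  [/\ H10 (fun x => `|u x|), D (fun x => `|u x|) (fun x => `|u x|) <= D u u &
   approx Omega nonneg (fun x => `|u x|) (fun i => wp i (fun x => `|u x|))].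
Proof.
move=> hu; have lu := H10_L2 hu; have lau := L2_norm mO lu.
pose au := fun x => `|u x|; rewrite -/au.
have closure M : D u u < M -> exists g,
    [/\ forall i, L2 (g i), approx Omega nonneg au g & \sum_i ip (g i) (g i) <= M].
  move=> uM; apply: (H10_closure oO bO) => //.
    move=> phi psi p1 p2 x; apply: mulr_ge0; first by rewrite invr_ge0.
    by rewrite addr_ge0.
  move=> e e0.
  pose V := fine (lebn Omega).
  have V0 : 0 <= V by rewrite fine_ge0.
  have [phi [tphi l1 l2 _]] := H10_test_seq oO bO hu.
  have hphi k : H10 (phi k) by exact: H10_test.
  have uM0 : 0 < M - D u u by rewrite subr_gt0.
  have [N1 h1] := form_lim_sqr H10l Dp hphi hu l2 uM0.
  have e4 : 0 < e / 4 by rewrite divr_gt0.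
  have [N2 h2] := l1 _ e4.
  pose k := maxn N1 N2.
  pose d := Num.min 1 (e / (4 * (V + 1))).
  have V1 : 0 < V + 1 by rewrite ltr_wpDl.
  have d0 : 0 < d by rewrite lt_min ltr01 divr_gt0// mulr_gt0.
  have [ts Ds] := dirichlet_sabs_test d0 (tphi k).
  exists (fun x => sabs d (phi k x)); split; first exact: ts.
  - by move=> x; exact: sabs_ge0.
  - have ld := lin_closedB L2l (L2_test oO bO ts) lau.
    have lw := lin_closedB L2l (L2_test oO bO (tphi k)) lu.
    have lw' : L2 (fun x => `|(phi k - u) x|) by exact: L2_norm.
    have lc := L2_cst oO bO d.
    have lb := lin_closedD L2l lw' lc.
    apply: (@le_trans _ _ (ip ((fun x => `|(phi k - u) x|) + cst d) ((fun x => `|(phi k - u) x|) + cst d))).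
      apply: (ip_le mO) => //; apply: ae_all => x _.
      apply: le_trans (sabs_bound d0 (phi k x) (u x)) _.
      exact: ler_norm.
    have := form_ge0 ipp (lin_closedB L2l lw' lc).
    rewrite (form_sqrD L2l ipp lw' lc) (form_sqrB L2l ipp lw' lc).
    have E1 : ip (fun x => `|(phi k - u) x|) (fun x => `|(phi k - u) x|) = ip (phi k - u) (phi k - u).
      by rewrite !ip_sqr; apply: eq_Rintegral => x _; rewrite real_normK// num_real.
    have E2 : ip (cst d) (cst d) = d * d * V by rewrite !ipE /= (Rintegral_cst lebn mO).
    have E3 : d * d * V <= e / 4.
      apply: (@le_trans _ _ (d * (V + 1))).
        apply: ler_pM => //; [by rewrite mulr_ge0 ?ltW| |by rewrite lerDl].
        by rewrite ger_pMr// ge_min lexx.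
      rewrite -ler_pdivlMr//; apply: (@le_trans _ _ (e / (4 * (V + 1)))).
        by rewrite ge_min lexx orbT.
      by rewrite invfM mulrA.
    have := h2 k (leq_maxr _ _).
    by rewrite E1 E2 => q3 q0; exact: sum_quarters q0 q3 E3.
  - have := h1 k (leq_maxl _ _); rewrite ler_norml => /andP[_].
    by rewrite lerBlDl subrKC => /(le_trans Ds).
have [g [lg apg _]] := closure (D u u + 1) (ltr_pwDr ltr01 (lexx _)).
have hg : H10g Omega au g.
  by split => // e /apg[phi [t _ k1 k2]]; exists phi.
have [hau _] := H10g_H10 oO bO hg.
split; [exact: hau| |exact: (approx_wp oO bO hg)].
apply/ler_addgt0Pr => e e0.
have [g' [lg' apg' hM]] := closure (D u u + e) (ltr_pwDr e0 (lexx _)).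
have hg' : H10g Omega au g'.
  by split => // e' /apg'[phi [t _ k1 k2]]; exists phi.
by rewrite (dirichlet_H10g oO bO hg' hg').
Qed.

Lemma H10_abs u : H10 u -> H10 (fun x => `|u x|).
Proof. by move=> /H10_abs_approx[]. Qed.

Lemma dirichlet_abs u : H10 u ->
  D (fun x => `|u x|) (fun x => `|u x|) <= D u u.
Proof. by move=> /H10_abs_approx[]. Qed.

Lemma H10_nonneg_approx u : H10 u -> ae (fun x => 0 <= u x) ->
  approx Omega nonneg u (fun i => wp i u).
Proof.
move=> hu u0; have [hau _ ap] := H10_abs_approx hu.
have lu := H10_L2 hu; have lau := L2_norm mO lu.
have uE : ae (fun x => `|u x| = u x) by apply: ae_imp u0 => x _; exact: ger0_norm.
have hg : H10g Omega u (fun i => wp i (fun x => `|u x|)).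
  by apply: (H10g_eq_ae oO bO _ uE); [case: lu|exact: H10_H10g].
apply: (approx_wp oO bO hg) => e /ap[phi [t p0 h1 h2]].
by exists phi; split => //; rewrite -(ip_sub_ae oO _ lau lu)//; exact: L2_test.
Qed.

(** [rellich_line] for test functions, extended by density. *)
Theorem rellich_H10 (e : R) : 0 < e -> exists M (l : 'I_M -> ('rV[R]_n -> R) -> R) (K : R),
  [/\ forall i a u v, H10 u -> H10 v -> l i (a *: u + v) = a * l i u + l i v,
      forall i v, H10 v -> l i v ^+ 2 <= K * ip v v &
      forall v, H10 v -> ip v v <= \sum_i l i v ^+ 2 + e * D v v].
Proof.
move=> e0; have [L L0 OL] := bounded_cube bO.
have [T [chi [hchi ineq]]] := rellich_line n L0 e0.
have lchi k : L2 (chi k).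
  have [mk [K hK]] := hchi k.
  apply: (L2_le mO _ (L2_cst oO bO K)); first exact: measurable_funTS.
  by apply: ae_all => x _; apply: le_trans (hK x) (ler_norm _).
exists #|T|, (fun i v => ip (chi (enum_val i)) v), (\sum_k ip (chi k) (chi k)); split.
- move=> i a u v /H10_L2 lu /H10_L2 lv.
  by rewrite (formDr L2l ipp)//; [rewrite (formZr L2l ipp)|exact: lin_closedZ].
- move=> i v /H10_L2 lv; apply: le_trans (form_cauchy_schwarz L2l ipp _ lv) _ => //.
  apply: ler_wpM2r; first exact: (form_ge0 ipp).
  by rewrite (bigD1 (enum_val i))//= lerDl sumr_ge0// => k _; exact: (form_ge0 ipp).
move=> v hv; have lv := H10_L2 hv.
have [phi [tphi l1 l2 _]] := H10_test_seq oO bO hv.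
have hphi k : H10 (phi k) by exact: H10_test.
have lphi k : L2 (phi k) by exact: L2_test.
have c1 := form_lim_cvg H10l ip1 hphi hv l1.
have c2 := form_lim_cvg H10l Dp hphi hv l2.
have c3 : \sum_(i < #|T|) ip (chi (enum_val i)) (phi k) ^+ 2 + e * D (phi k) (phi k) @[k --> \oo] -->
    \sum_(i < #|T|) ip (chi (enum_val i)) v ^+ 2 + e * D v v.
  apply: cvgD; last by apply: cvgM => //; exact: cvg_cst.
  elim: (index_enum _) => [|i s IH].
    by under eq_fun do rewrite big_nil; rewrite big_nil; exact: cvg_cst.
  under eq_fun do rewrite big_cons; rewrite big_cons; apply: cvgD; last exact: IH.
  have := form_lim_cvgl L2l ipp (lchi (enum_val i)) lphi lv l1 => c.
  by under eq_fun do rewrite expr2; rewrite expr2; exact: cvgM.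
apply: (ler_cvg_to c1 c3); apply: nearW => k /=.
have t0 := test_bddn OL (tphi k).
have := ineq (phi k) (fun i => partial i (phi k)) t0 (fun i => test_line_prim OL i (tphi k)).
have z x : ~ Omega x -> phi k x = 0 by exact: test_supp0.
have E1 : \int[lebn]_x phi k x ^+ 2 = ip (phi k) (phi k).
  by rewrite ip_sqr -(@test_Rintegral _ _ Omega)// => x /z ->; rewrite expr0n.
have E2 j : \int[lebn]_x (chi j x * phi k x) = ip (chi j) (phi k).
  by rewrite !ipE -(@test_Rintegral _ _ Omega)// => x /z ->; rewrite mulr0.
have E3 i : \int[lebn]_x partial i (phi k) x ^+ 2 = ip (partial i (phi k)) (partial i (phi k)).
  rewrite ip_sqr -(@test_Rintegral _ _ Omega)// => x nx.
  by rewrite (test_supp0 (test_partial i (tphi k)) nx) expr0n.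
have ht := H10g_test oO bO (tphi k).
rewrite E1 (dirichlet_H10g oO bO ht ht).
under [in X in _ + _ * X]eq_bigr do rewrite E3.
under [in X in X + _]eq_bigr do rewrite E2.
by rewrite -(big_enum_val (A := T) (fun j => ip (chi j) (phi k) ^+ 2)).
Qed.

End H10_abs.

(** * A Hardy inequality from a positive supersolution *)

Section smooth_inv.
Context {R : realType} {n : nat}.
Implicit Types f : 'rV[R]_n -> R.

Lemma is_derive_invR f x v (d : R) : f x != 0 -> is_derive x v f d ->
  is_derive x v (fun y => (f y)^-1) (- (d * ((f x)^-1 * (f x)^-1))).
Proof.
move=> f0 [hd hv]; apply: DeriveDef; first exact: derivableV.
by rewrite deriveV// hv /GRing.scale/= expr2 invfM mulNr mulrC.
Qed.

Lemma smooth_inv f : smooth f -> (forall x, 0 < f x) -> smooth (fun x => (f x)^-1).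
Proof.
move=> sf f0; have fn0 x : f x != 0 by rewrite gt_eqF.
have ci : continuous (fun x => (f x)^-1).
  by move=> x; apply: continuousV => //; exact: smooth_continuous.
elim=> [//|k IH].
apply: (@is_Ck_S _ _ _ _ (fun i x => -1 * (partial i f x * ((f x)^-1 * (f x)^-1)))) => //.
  by move=> i x; rewrite mulN1r; apply: is_derive_invR => //; exact: smooth_is_derive.
move=> i; apply: is_Ck_mul; first exact: is_Ck_cst.
by apply: is_Ck_mul; [exact: smooth_partial|exact: is_Ck_mul].
Qed.

Lemma partial_inv i f x : smooth f -> (forall x, 0 < f x) ->
  partial i (fun y => (f y)^-1) x = - (partial i f x * ((f x)^-1 * (f x)^-1)).
Proof.
move=> sf f0; apply: partialE; apply: is_derive_invR; first by rewrite gt_eqF.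
exact: smooth_is_derive.
Qed.

End smooth_inv.

Section hardy.
Context {R : realType} {n : nat}.
Variable Omega : set 'rV[R]_n.
Hypothesis oO : open Omega.
Hypothesis bO : bounded_set Omega.
Implicit Types (u v f : 'rV[R]_n -> R) (g : 'I_n -> 'rV[R]_n -> R).

Local Notation lebn := (@lebesgue_rV R n).
Local Notation ae P := {ae lebn, forall x, Omega x -> P x}.
Local Notation intg f := (lebn.-integrable Omega (EFin \o f)).
Local Notation I f := (\int[lebn]_(x in Omega) f x).
Local Notation L2 := (L2 lebn Omega).
Local Notation ip := (ip lebn Omega).
Local Notation test := (test_function Omega).
Local Notation H10 := (is_H10 Omega).
Local Notation D := (dirichlet Omega).
Local Notation wp := (weak_partial Omega).

Let mO : measurable Omega := open_measurable_rV oO.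
Let L2l := L2_lin lebn mO.
Let ipp := ip_psd lebn mO.
Let H10l := H10_lin oO bO.
Let Dp := dirichlet_psd oO bO.

Variables (u omega rho : 'rV[R]_n -> R).
Hypothesis hu : H10 u.
Hypothesis u0 : ae (fun x => 0 < u x).
Hypothesis m_rho : measurable_fun Omega rho.
Hypothesis omega0 : forall x, 0 <= omega x.
Hypothesis rhoE : ae (fun x => rho x = omega x / u x).
Hypothesis super : forall v, test v -> (forall x, 0 <= v x) ->
  intg (fun x => omega x * v x) /\ I (fun x => omega x * v x) <= D u v.

(** [phi ^ 2 / (psi + d)], where [psi] is a nonnegative test function close to
    [u] and the shift [d] keeps the denominator away from zero. *)
Let quot (phi psi : 'rV[R]_n -> R) (d : R) x := phi x * phi x * (psi x + d)^-1.

Let test_quot phi psi d : 0 < d -> test phi -> test psi -> nonneg psi ->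
  test (quot phi psi d).
Proof.
move=> d0 tphi tpsi psi0; have sphi := test_smooth tphi.
have sd := smooth_add (test_smooth tpsi) (smooth_cst d).
apply: (test_mul (test_mul tphi sphi)); apply: (smooth_inv sd) => x.
by rewrite ltr_wpDl.
Qed.

Let partial_quot phi psi d i x : 0 < d -> test phi -> test psi -> nonneg psi ->
  partial i (quot phi psi d) x =
  2 * phi x * partial i phi x * (psi x + d)^-1 -
  phi x ^+ 2 * partial i psi x * ((psi x + d)^-1) ^+ 2.
Proof.
move=> d0 tphi tpsi psi0.
have sphi := test_smooth tphi; have spsi := test_smooth tpsi.
have sc : smooth (fun _ : 'rV[R]_n => d) by exact: smooth_cst.
have sd := smooth_add spsi sc.
have p0 y : 0 < psi y + d by rewrite ltr_wpDl.
rewrite (partial_mul _ _ (smooth_mul sphi sphi) (smooth_inv sd p0)).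
rewrite (partial_inv _ _ sd p0) (partial_add _ _ spsi sc) partial_cst addr0.
rewrite (partial_mul _ _ sphi sphi).
by set q := (psi x + d)^-1; ring.
Qed.

(** In Picone's inequality, [grad psi . grad (phi ^ 2 / psi) <= |grad phi| ^
    2], the difference of the two sides is a perfect square. *)
Let picone phi psi d : 0 < d -> test phi -> test psi -> nonneg psi ->
  D psi (quot phi psi d) <= D phi phi.
Proof.
move=> d0 tphi tpsi psi0; have tq := test_quot d0 tphi tpsi psi0.
rewrite (dirichlet_H10g oO bO (H10g_test oO bO tpsi) (H10g_test oO bO tq)).
rewrite (dirichlet_H10g oO bO (H10g_test oO bO tphi) (H10g_test oO bO tphi)).
apply: ler_sum => i _; apply: (Rintegral_le_ae mO).
- by apply: (L2_mul mO); exact: L2_test_partial.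
- by apply: (L2_mul mO); exact: L2_test_partial.
apply: ae_all => x _; rewrite partial_quot//.
set a := partial i psi x; set b := partial i phi x; set q := (psi x + d)^-1.
rewrite -subr_ge0.
have -> : b * b - a * (2 * phi x * b * q - phi x ^+ 2 * a * q ^+ 2) = (b - phi x * a * q) ^+ 2.
  by ring.
exact: sqr_ge0.
Qed.

Let sqr_subr_le (x y a b : R) : x ^+ 2 <= a ^+ 2 -> y ^+ 2 <= b ->
  (x - y) * (x - y) <= 2 * (a * a) + 2 * b.
Proof. by have := sqr_ge0 (x + y); rewrite -!expr2; lra. Qed.

(** A bound uniform in [psi], needed to replace [psi] by [u] in the form [D
    psi (quot phi psi d)] at a small cost. *)
Let quot_bounded phi d : 0 < d -> test phi -> exists K, forall psi, test psi -> nonneg psi ->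
  D psi psi <= 2 * D u u + 2 -> D (quot phi psi d) (quot phi psi d) <= K.
Proof.
move=> d0 tphi.
have [M hM] := test_bounded tphi.
have hM' i := test_bounded (test_partial i tphi).
have [M' hM2] := choice hM'.
pose V := fine (lebn Omega).
pose A i := 2 * M * M' i / d; pose B := M ^+ 2 / d ^+ 2.
exists (\sum_i 2 * (A i ^+ 2 * V) + 2 * B ^+ 2 * (2 * D u u + 2)) => psi tpsi psi0 Dpsi.
have tq := test_quot d0 tphi tpsi psi0.
rewrite (dirichlet_H10g oO bO (H10g_test oO bO tq) (H10g_test oO bO tq)).
apply: (@le_trans _ _ (\sum_i (2 * (A i ^+ 2 * V) + 2 * B ^+ 2 * ip (partial i psi) (partial i psi)))).
  apply: ler_sum => i _.
  have lc := L2_cst oO bO (A i); have lp := L2_test_partial oO bO i tpsi.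
  have ic : intg (fun x => 2 * (A i * A i)).
    by apply: (L2_integrable oO bO); exact: (L2_cst oO bO (2 * (A i * A i))).
  have ipp' := integrable_scale mO (2 * B ^+ 2) (L2_mul mO lp lp).
  have -> : 2 * (A i ^+ 2 * V) = I (fun x => 2 * (A i * A i)).
    by rewrite (Rintegral_cst lebn mO) mulrA expr2.
  have -> : 2 * B ^+ 2 * ip (partial i psi) (partial i psi) =
      I (fun x => 2 * B ^+ 2 * (partial i psi x * partial i psi x)).
    by rewrite RintegralZl//; exact: (L2_mul mO).
  rewrite -RintegralD//; apply: (Rintegral_le_ae mO).
  - by apply: (L2_mul mO); exact: L2_test_partial.
  - exact: (integrable_add mO).
  apply: ae_all => x _; rewrite partial_quot//.
  set a := partial i psi x; set b := partial i phi x; set q := (psi x + d)^-1.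
  have q0 : 0 <= q by rewrite invr_ge0 addr_ge0// ltW.
  have qd : q <= d^-1 by rewrite lef_pV2 ?posrE ?lerDr// ltr_wpDl.
  have M0 : 0 <= M by exact: le_trans (hM x).
  have e1 : `|2 * phi x * b * q| <= A i.
    rewrite !normrM (ger0_norm q0) (@ger0_norm _ 2)// /A.
    apply: ler_pM => //; apply: ler_pM => //; last exact: hM2.
    by apply: ler_wpM2l => //; exact: hM.
  have e2 : `|phi x ^+ 2 * a * q ^+ 2| <= B * `|a|.
    rewrite (normrM (_ * a)) (normrM (_ ^+ 2)) (ger0_norm (sqr_ge0 q)) (ger0_norm (sqr_ge0 (phi x))) mulrAC.
    rewrite ler_wpM2r// /B; apply: ler_pM; rewrite ?sqr_ge0//.
      by rewrite -(real_normK (num_real (phi x))) ler_pXn2r ?nnegrE.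
    by rewrite -exprVn; apply: lerXn2r => //; rewrite nnegrE invr_ge0 ltW.
  set X := 2 * phi x * b * q in e1 *; set Y := phi x ^+ 2 * a * q ^+ 2 in e2 *.
  have B0 : 0 <= B by rewrite /B divr_ge0// sqr_ge0.
  have f1 : X ^+ 2 <= A i ^+ 2.
    rewrite -(real_normK (num_real X)); apply: lerXn2r => //.
    by rewrite nnegrE (le_trans _ e1).
  have f2 : Y ^+ 2 <= B ^+ 2 * (a * a).
    have -> : B ^+ 2 * (a * a) = (B * `|a|) ^+ 2 by rewrite [RHS]exprMn (real_normK (num_real a)) (expr2 a).
    rewrite -(real_normK (num_real Y)); apply: lerXn2r => //.
    by rewrite nnegrE mulr_ge0.
  by rewrite -[2 * B ^+ 2 * _]mulrA; exact: sqr_subr_le f1 f2.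
rewrite big_split/= lerD2l -mulr_sumr; apply: ler_wpM2l.
  by rewrite mulr_ge0// sqr_ge0.
by rewrite (dirichlet_H10g oO bO (H10g_test oO bO tpsi) (H10g_test oO bO tpsi)) in Dpsi.
Qed.

Let sum_le_double (a b c : R) : a <= 1 -> 0 <= a - 2 * b + c ->
  a + 2 * b + c <= 2 * c + 2.
Proof. by lra. Qed.

(** Picone's inequality bounds [D psi (quot phi psi d)], and the supersolution
    inequality concerns [D u (quot phi psi d)]; they differ by the form of the
    small [psi - u] against a function of bounded energy. *)
Let hardy_step phi (d eta e : R) : 0 < d -> 0 < eta -> 0 < e -> test phi ->
  exists psi, [/\ test psi, nonneg psi, ip (psi - u) (psi - u) <= e,
    intg (fun x => omega x * quot phi psi d x) &
    I (fun x => omega x * quot phi psi d x) <= D phi phi + eta].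
Proof.
move=> d0 eta0 e0 tphi.
have uge0 : ae (fun x => 0 <= u x) by apply: ae_imp u0 => x _; exact: ltW.
have ap := H10_nonneg_approx oO bO hu uge0.
have [K hK] := quot_bounded d0 tphi.
have [c c0 hc] := form_small H10l Dp K eta0.
pose r := Num.min e (Num.min 1 c / n.+1%:R).
have r0 : 0 < r by rewrite lt_min e0 divr_gt0// lt_min ltr01.
have [psi [tpsi psi0 h1 h2]] := ap r r0.
have hpsi : H10 psi by exact: H10_test.
have Dsmall : D (psi - u) (psi - u) <= Num.min 1 c.
  rewrite (dirichlet_dist oO bO (H10g_test oO bO tpsi) (H10_H10g oO bO hu)).
  apply: (@le_trans _ _ (\sum_(i < n) (Num.min 1 c / n.+1%:R))).
    apply: ler_sum => i _; apply: le_trans (h2 i) _.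
    by rewrite /r ge_min lexx orbT.
  rewrite sumr_const card_ord -[leLHS]mulr_natr mulrAC ler_pdivrMr//.
  apply: ler_wpM2l; last by rewrite ler_nat.
  by rewrite le_min ler01 ltW.
have hd := lin_closedB H10l hpsi hu.
have Dpsi : D psi psi <= 2 * D u u + 2.
  have s1 : D (psi - u) (psi - u) <= 1 by apply: le_trans Dsmall _; rewrite ge_min lexx.
  have h3 := form_ge0 Dp (lin_closedB H10l hd hu).
  have E := form_sqrD H10l Dp hd hu; rewrite subrK in E.
  rewrite E; move: h3; rewrite (form_sqrB H10l Dp hd hu).
  by move: s1; exact: sum_le_double.
have tq := test_quot d0 tphi tpsi psi0.
have q0 x : 0 <= quot phi psi d x.
  by rewrite /quot -expr2 mulr_ge0 ?sqr_ge0// invr_ge0 addr_ge0// ltW.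
have [iq Iq] := super tq q0.
exists psi; split => //; first by apply: le_trans h1 _; rewrite ge_min lexx.
apply: (le_trans Iq).
have hq : H10 (quot phi psi d) by exact: H10_test.
have -> : D u (quot phi psi d) = D psi (quot phi psi d) - D (psi - u) (quot phi psi d).
  by rewrite (formBl H10l Dp hpsi hu hq) subKr.
have := hc _ _ hd hq (le_trans Dsmall _) (hK _ tpsi psi0 Dpsi).
rewrite ge_min lexx orbT => /(_ isT); rewrite ler_norml => /andP[h3 _].
apply: lerD; first exact: picone.
by rewrite lerNl.
Qed.

(** [hardy_step] is the inequality with [phi ^ 2 / (psi + d)] in place of [w ^
    2 / u]; Fatou's lemma applies along test functions [phi] and [psi] that
    converge almost everywhere to [w] and to [u]. *)
Theorem hardy w : H10 w ->
  intg (fun x => rho x * (w x * w x)) /\ I (fun x => rho x * (w x * w x)) <= D w w.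
Proof.
move=> hw.
have [phi [tphi l1 l2 fast]] := H10_test_seq oO bO hw.
have hphi k : H10 (phi k) by exact: H10_test.
pose d (k : nat) : R := k.+1%:R^-1.
have d0 k : 0 < d k by rewrite invr_gt0.
have e0 k : 0 < 8^-1 ^+ k :> R by rewrite exprn_gt0// invr_gt0.
have step k := hardy_step (d0 k) (d0 k) (e0 k) (tphi k).
have [psi hpsi] := choice step.
have lu := H10_L2 hu; have lw := H10_L2 hw.
have lphi k : L2 (phi k) by exact: L2_test.
have lpsi k : L2 (psi k) by have [t _ _ _ _] := hpsi k; exact: L2_test.
have cphi := L2_fast_cvg mO lphi lw fast.
have cpsi : ae (fun x => psi k x @[k --> \oo] --> u x).
  by apply: (L2_fast_cvg mO lpsi lu) => k; have [] := hpsi k.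
apply: (@fatou_ae _ _ _ lebn Omega mO (fun k x => omega x * quot (phi k) (psi k) (d k) x)).
- by move=> k; have [] := hpsi k.
- move=> k x _; have [_ p0 _ _ _] := hpsi k.
  by rewrite mulr_ge0// /quot -expr2 mulr_ge0 ?sqr_ge0// invr_ge0 addr_ge0// ltW.
- by apply: measurable_funM => //; apply: measurable_funM; exact: L2_measurable lw.
- have pos := ae_and u0 rhoE; have conv := ae_and cphi cpsi.
  apply: ae_imp2 pos conv => x _ [ux ->] [c1 c2].
  have -> : omega x / u x * (w x * w x) = omega x * (w x * w x * (u x + 0)^-1).
    by rewrite addr0; ring.
  apply: cvgM; first exact: cvg_cst.
  apply: cvgM; first exact: cvgM.
  apply: cvgV; first by rewrite addr0 gt_eqF.
  by apply: cvgD => //; exact: cvg_harmonic.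
- move=> e ee.
  have e2 : 0 < e / 2 by rewrite divr_gt0.
  have [N hN] := form_lim_sqr H10l Dp hphi hw l2 e2.
  exists (maxn N (Num.truncn (2 / e)).+1) => k; rewrite geq_max => /andP[Nk ek].
  have [_ _ _ _ h] := hpsi k; apply: (le_trans h).
  have dk : d k <= e / 2.
    rewrite -[e / 2]invf_div lef_pV2 ?posrE ?divr_gt0//.
    apply: (@le_trans _ _ (Num.truncn (2 / e)).+1%:R); first exact/ltW/truncnS_gt.
    by rewrite ler_nat (leq_trans ek).
  have := hN k Nk; rewrite ler_norml lerBlDr => /andP[_ h2].
  apply: (le_trans (lerD h2 dk)).
  by rewrite addrAC -splitr addrC.
Qed.

End hardy.

(** * Minimization of a convex energy *)

Section dominated.
Context d {T : measurableType d} {R : realType}.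
Variables (mu : {measure set T -> \bar R}) (D : set T).
Hypothesis mD : measurable D.

Local Notation ae P := {ae mu, forall x, D x -> P x}.
Local Notation intg f := (mu.-integrable D (EFin \o f)).
Local Notation I f := (\int[mu]_(x in D) f x).

Lemma Rintegral_dominated_cvg (f : nat -> T -> R) (l g : T -> R) :
  (forall k, measurable_fun D (f k)) -> measurable_fun D l -> intg g ->
  ae (fun x => f k x @[k --> \oo] --> l x) ->
  ae (fun x => forall k, `|f k x| <= g x) ->
  I (f k) @[k --> \oo] --> I l.
Proof.
move=> mf ml ig fl fg.
have mf' k : measurable_fun D (EFin \o f k) by exact/measurable_EFinP.
have ml' : measurable_fun D (EFin \o l) by exact/measurable_EFinP.
have fl' : {ae mu, forall x, D x -> (EFin \o f k) x @[k --> \oo] --> (EFin \o l) x}.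
  by apply: ae_imp fl => x _ h; apply: cvg_EFin => //; exact: nearW.
have fg' : {ae mu, forall x k, D x -> (`|(EFin \o f k) x| <= (EFin \o g) x)%E}.
  by apply: filterS fg => x h k Dx; rewrite /= lee_fin; exact: h.
have [il _ cvg] := dominated_convergence mD mf' ml' fl' ig fg'.
apply: fine_cvg; rewrite /= fineK//; exact: integrable_fin_num.
Qed.

End dominated.

Section minimization.
Context {R : realType} {n : nat}.
Variable Omega : set 'rV[R]_n.
Hypothesis oO : open Omega.
Hypothesis bO : bounded_set Omega.
Implicit Types (u v f : 'rV[R]_n -> R).

Local Notation lebn := (@lebesgue_rV R n).
Local Notation ae P := {ae lebn, forall x, Omega x -> P x}.
Local Notation intg f := (lebn.-integrable Omega (EFin \o f)).
Local Notation I f := (\int[lebn]_(x in Omega) f x).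
Local Notation L2 := (L2 lebn Omega).
Local Notation ip := (ip lebn Omega).
Local Notation H10 := (is_H10 Omega).
Local Notation D := (dirichlet Omega).

Let mO : measurable Omega := open_measurable_rV oO.
Let H10l := H10_lin oO bO.
Let Dp := dirichlet_psd oO bO.

Variables (h : 'rV[R]_n -> R) (K : R) (G g : 'rV[R]_n -> R -> R).
Hypothesis hK : forall v, H10 v ->
  intg (fun x => h x * `|v x|) /\ I (fun x => h x * `|v x|) ^+ 2 <= K * D v v.
Hypothesis K0 : 0 <= K.
Hypothesis G_meas : forall u, measurable_fun Omega u -> measurable_fun Omega (fun x => G x (u x)).
Hypothesis g_meas : forall u, measurable_fun Omega u -> measurable_fun Omega (fun x => g x (u x)).
Hypothesis g_le : ae (fun x => forall t, `|g x t| <= h x).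
Hypothesis g_cont : ae (fun x => continuous (g x)).
Hypothesis G0 : ae (fun x => G x 0 = 0).
Hypothesis G_sub : ae (fun x => forall s t, G x s + g x s * (t - s) <= G x t).

Let H10_meas u : H10 u -> measurable_fun Omega u.
Proof. by move=> /H10_L2/L2_measurable. Qed.

Let gv_le u v : ae (fun x => `|g x (u x) * v x| <= h x * `|v x|).
Proof. by apply: ae_imp g_le => x _ gh; rewrite normrM ler_wpM2r. Qed.

Let gv_int u v : H10 u -> H10 v -> intg (fun x => g x (u x) * v x).
Proof.
move=> hu hv; apply: (integrable_ae_le mO _ (hK hv).1 (gv_le u v)).
by apply: measurable_funM; [apply: g_meas; exact: H10_meas|exact: H10_meas].
Qed.

Let gv_bound u v : H10 u -> H10 v -> `|I (fun x => g x (u x) * v x)| <= I (fun x => h x * `|v x|).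
Proof.
by move=> hu hv; apply: (normr_Rintegral_le mO (gv_int hu hv) (hK hv).1); exact: gv_le.
Qed.

Let G_le u : ae (fun x => `|G x (u x)| <= h x * `|u x|).
Proof.
apply: (ae_imp2 _ (ae_and g_le G0) G_sub) => x _ [gh G00] Gs.
have h1 := Gs 0 (u x); have h2 := Gs (u x) 0.
have b s : `|g x s * u x| <= h x * `|u x| by rewrite normrM ler_wpM2r.
have := b 0; have := b (u x); move: h1 h2.
rewrite G00 add0r subr0 sub0r mulrN subr_le0 !ler_norml => h1 h2 /andP[_ h3] /andP[h4 _].
by rewrite (le_trans h4 h1) (le_trans h2 h3).
Qed.

Let G_int u : H10 u -> intg (fun x => G x (u x)).
Proof.
by move=> hu; apply: (integrable_ae_le mO (G_meas (H10_meas hu)) (hK hu).1); exact: G_le.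
Qed.

Let J u := D u u / 2 + I (fun x => G x (u x)).

Let le_of_sqr (y a : R) : y ^+ 2 <= K * a -> 0 <= a -> y <= a / 4 + K.
Proof.
move=> ya a0; rewrite leNgt; apply/negP => h0.
have s0 : 0 <= a / 4 + K by rewrite addr_ge0// divr_ge0.
have : (a / 4 + K) ^+ 2 < y ^+ 2 by rewrite ltrXn2r// -?topredE/= ?nnegrE// (le_trans s0 (ltW h0)).
have := sqr_ge0 (a / 4 - K); move: ya; rewrite !expr2; nra.
Qed.

Let coerc (a b c : R) : - b <= a -> b <= c / 4 + K -> c / 4 - K <= c / 2 + a.
Proof. by lra. Qed.

Let J_coercive u : H10 u -> D u u / 4 - K <= J u.
Proof.
move=> hu; have [ih hb] := hK hu.
have := normr_Rintegral_le mO (G_int hu) ih (G_le u); rewrite ler_norml => /andP[h1 _].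
have h2 := le_of_sqr hb (form_ge0 Dp hu).
exact: coerc h1 h2.
Qed.

Let midpoint (a b c d p q : R) : c + d * (p - 2^-1 * (p + q)) <= a ->
  c + d * (q - 2^-1 * (p + q)) <= b -> c <= 2^-1 * (a + b).
Proof. by lra. Qed.

Let quarter (a b c : R) : 0 <= 2 * a + 2 * b - c -> 2^-1 ^+ 2 * c <= 2^-1 * (a + b).
Proof. by rewrite expr2; lra. Qed.

Let halves (a b c p q r : R) : a <= 2^-1 * (b + c) -> p <= 2^-1 * (q + r) ->
  p / 2 + a <= (q / 2 + b + (r / 2 + c)) / 2.
Proof. by lra. Qed.

Let lsc (p q e m i gu gk gd : R) : `|p - q| <= e / 4 -> i <= e / 4 -> `|gd| <= e / 4 ->
  gu + gd <= gk -> p / 2 + gk <= m + i -> q / 2 + gu <= m + e.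
Proof. by rewrite !ler_norml => /andP[h1 h2] h3 /andP[h4 h5]; lra. Qed.

Let descent (t p q r a b c : R) : 0 < t -> p / 2 + a <= (p + 2 * t * q + t ^+ 2 * r) / 2 + b ->
  b <= a + t * c -> 0 <= q + t / 2 * r + c.
Proof. by move=> t0 h1 h2; rewrite -(pmulr_rge0 _ t0); move: h1 h2; rewrite expr2; lra. Qed.

(** Midpoint convexity of the energy is that of the Dirichlet form and that of
    [G], which follows from the subgradient inequality at the midpoint. *)
Let J_mid u v : H10 u -> H10 v -> J (2^-1 *: (u + v)) <= (J u + J v) / 2.
Proof.
move=> hu hv; have huv := lin_closedD H10l hu hv.
have hm := lin_closedZ H10l 2^-1 huv.
have iu := G_int hu; have iv := G_int hv; have im := G_int hm.
have i2 := integrable_scale mO 2^-1 (integrable_add mO iu iv).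
have h1 : I (fun x => G x ((2^-1 *: (u + v)) x)) <= 2^-1 * (I (fun x => G x (u x)) + I (fun x => G x (v x))).
  rewrite -RintegralD// -RintegralZl//; last exact: integrable_add.
  apply: (Rintegral_le_ae mO im i2); apply: ae_imp G_sub => x _ Gs.
  exact: midpoint (Gs ((2^-1 *: (u + v)) x) (u x)) (Gs ((2^-1 *: (u + v)) x) (v x)).
have h2 : D (2^-1 *: (u + v)) (2^-1 *: (u + v)) <= 2^-1 * (D u u + D v v).
  rewrite (form_sqrZ H10l Dp _ huv).
  have h3 := form_parallelogram H10l Dp hu hv.
  have h4 := form_ge0 Dp (lin_closedB H10l hu hv).
  by move: h4; rewrite h3; exact: quarter.
exact: halves h1 h2.
Qed.

(** Almost minimizers form a Cauchy sequence for the Dirichlet form since the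
    energy is convex and coercive. *)
Let minimizer_exists (i0 : 'I_n) : exists2 u, H10 u & forall v, H10 v -> J u <= J v.
Proof.
pose inv (k : nat) : R := k.+1%:R^-1.
have inv0 k : 0 < inv k by rewrite invr_gt0.
pose E := [set J v | v in H10].
have Elb : has_lbound E.
  exists (- K) => _ [u hu <-]; apply: le_trans (J_coercive hu).
  by rewrite lerDr divr_ge0// (form_ge0 Dp hu).
have Einf : has_inf E by split=> //; exists (J 0), 0 => //; exact: H10l.1.
pose m := inf E.
have mJ v : H10 v -> m <= J v by move=> hv; apply: ge_inf => //; exists v.
pose A k := [set u | H10 u /\ J u <= m + inv k].
have [x Ax cx] : exists2 x, forall k, A k (x k) & form_cauchy D x.
  apply: (@nested_midconvex_cauchy _ _ _ H10l D Dp A (4 * (m + 1 + K))).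
  - by move=> k u [].
  - move=> j k jk u [hu Ju]; split=> //; apply: le_trans Ju _.
    by rewrite lerD2l lef_pV2 ?posrE// ler_nat ltnS.
  - move=> k; have [_ [u hu <-] Ju] := inf_adherent (inv0 k) Einf.
    by exists u; split=> //; exact: ltW.
  - move=> k u v [hu Ju] [hv Jv]; split.
      by apply: (lin_closedZ H10l); exact: lin_closedD.
    apply: (le_trans (J_mid hu hv)); rewrite ler_pdivrMr// mulr_natr mulr2n.
    exact: lerD.
  - move=> u [hu Ju]; rewrite -ler_pdivrMl// mulrC -lerBlDr.
    apply: (le_trans (J_coercive hu)); apply: (le_trans Ju).
    by rewrite lerD2l /inv invr1.
have hx k : H10 (x k) by have [] := Ax k.
have [u hu xu] := H10_complete oO bO i0 hx cx.
exists u => // v hv; apply: le_trans (mJ v hv).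
apply/ler_addgt0Pr => e e0.
have e4 : 0 < e / 4 by rewrite divr_gt0.
have [N1 h1] := form_lim_sqr H10l Dp hx hu xu e4.
(* The tolerance comes from [I (h * |v|) ^ 2 <= K * D v v]. *)
have [N2 h2] := xu _ (divr_gt0 (exprn_gt0 2 e4) (ltr_wpDl K0 ltr01)).
pose k := maxn (maxn N1 N2) (Num.truncn (4 / e)).+1.
have k1 := h1 k (leq_trans (leq_maxl _ _) (leq_maxl _ _)).
have k2 := h2 k (leq_trans (leq_maxr _ _) (leq_maxl _ _)).
have k3 : inv k <= e / 4.
  rewrite -[e / 4]invf_div lef_pV2 ?posrE ?divr_gt0//.
  apply: (@le_trans _ _ (Num.truncn (4 / e)).+1%:R); first exact/ltW/truncnS_gt.
  by rewrite ler_nat (leq_trans (leq_maxr _ _) (leqnSn _)).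
have hd := lin_closedB H10l (hx k) hu.
have b : I (fun y => h y * `|(x k - u) y|) <= e / 4.
  have s0 : 0 <= e / 4 by exact: ltW.
  rewrite leNgt; apply/negP => lt.
  have : (e / 4) ^+ 2 < I (fun y => h y * `|(x k - u) y|) ^+ 2.
    by rewrite ltrXn2r// nnegrE// (le_trans s0 (ltW lt)).
  rewrite ltNge => /negP; apply; apply: (le_trans (hK hd).2).
  apply: (@le_trans _ _ ((K + 1) * D (x k - u) (x k - u))).
    by rewrite ler_wpM2r ?lerDl// (form_ge0 Dp hd).
  by rewrite mulrC -ler_pdivlMr// ltr_wpDl.
have b' := le_trans (gv_bound hu hd) b.
(* Lower semicontinuity of the energy, from the subgradient at the limit. *)
have Gk : I (fun y => G y (u y)) + I (fun y => g y (u y) * (x k - u) y) <= I (fun y => G y (x k y)).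
  rewrite -RintegralD//; [|exact: (G_int hu)|exact: (gv_int hu hd)].
  apply: (Rintegral_le_ae mO (integrable_add mO (G_int hu) (gv_int hu hd)) (G_int (hx k))).
  by apply: ae_imp G_sub => y _ Gs; exact: (Gs (u y) (x k y)).
have [_ Jk] := Ax k.
exact: lsc k1 k3 b' Gk Jk.
Qed.

(** The Euler equation holds because the derivative of the energy in a direction
    [v] is nonnegative, for [v] as for [- v]. *)
Theorem semilinear_solution (i0 : 'I_n) : exists2 u, H10 u & forall v, H10 v ->
  intg (fun x => g x (u x) * v x) /\ D u v + I (fun x => g x (u x) * v x) = 0.
Proof.
have [u hu Ju] := minimizer_exists i0; exists u; first exact: hu.
move=> v hv; split; first exact: (gv_int hu hv).
have ge w : H10 w -> 0 <= D u w + I (fun x => g x (u x) * w x).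
  move=> hw; pose inv (k : nat) : R := k.+1%:R^-1.
  have inv0 k : 0 < inv k by rewrite invr_gt0.
  pose uw k : 'rV[R]_n -> R := u + inv k *: w.
  have huw k : H10 (uw k) by exact: (lin_closedD H10l hu (lin_closedZ H10l (inv k) hw)).
  have step k : 0 <= D u w + inv k / 2 * D w w + I (fun x => g x (uw k x) * w x).
    have := Ju _ (huw k); rewrite /J /uw (form_sqr H10l Dp _ hu hw) -/(uw k).
    have i1 := gv_int (huw k) hw.
    have h2 : I (fun x => G x (uw k x)) <= I (fun x => G x (u x)) + inv k * I (fun x => g x (uw k x) * w x).
      rewrite -RintegralZl// -RintegralD//; [|exact: (G_int hu)|exact: (integrable_scale mO _ i1)].
      apply: (Rintegral_le_ae mO (G_int (huw k)) (integrable_add mO (G_int hu) (integrable_scale mO _ i1))).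
      apply: ae_imp G_sub => x _ Gs; have := Gs (uw k x) (u x).
      have -> : u x - uw k x = - (inv k * w x).
        by change (u x - (u x + inv k * w x) = - (inv k * w x)); ring.
      by rewrite mulrN lerBlDr mulrCA.
    move=> h1; exact: descent (inv0 k) h1 h2.
  have c1 : I (fun x => g x (uw k x) * w x) @[k --> \oo] --> I (fun x => g x (u x) * w x).
    apply: (Rintegral_dominated_cvg mO _ _ (hK hw).1).
    - by move=> k; exact: (integrable_measurable (gv_int (huw k) hw)).
    - exact: (integrable_measurable (gv_int hu hw)).
    - apply: ae_imp g_cont => x _ gc; apply: cvgM; last exact: cvg_cst.
      have c0 : u x + inv k * w x @[k --> \oo] --> u x + 0 * w x.
        apply: cvgD; first exact: cvg_cst.
        by apply: cvgM; [exact: cvg_harmonic|exact: cvg_cst].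
      rewrite mul0r addr0 in c0.
      exact: (cvg_comp _ _ c0 (gc (u x))).
    - by apply: ae_nat => k; exact: gv_le.
  have c2 : D u w + inv k / 2 * D w w + I (fun x => g x (uw k x) * w x) @[k --> \oo] -->
      D u w + 0 / 2 * D w w + I (fun x => g x (u x) * w x).
    apply: cvgD => //; apply: cvgD; first exact: cvg_cst.
    apply: cvgM; last exact: cvg_cst.
    by apply: cvgM; [exact: cvg_harmonic|exact: cvg_cst].
  rewrite !mul0r addr0 in c2.
  rewrite -(cvg_lim _ c2)//; apply: limr_ge; first exact: cvgP c2.
  exact: nearW.
apply/eqP; rewrite eq_le (ge v hv) andbT.
have hNv := lin_closedN H10l hv.
have := ge _ hNv; rewrite -[- v]scaleN1r (formZr H10l Dp _ hu hv) mulN1r.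
have -> : I (fun x => g x (u x) * ((-1) *: v) x) = - I (fun x => g x (u x) * v x).
  rewrite -[RHS]mulN1r -RintegralZl//; last exact: (gv_int hu hv).
  apply: eq_Rintegral => x _.
  by change (g x (u x) * (-1 * v x) = -1 * (g x (u x) * v x)); ring.
by rewrite -opprD oppr_ge0.
Qed.

End minimization.

(** * The truncated nonlinearity *)

Section truncation.
Context {R : realType}.
Variable alpha : R.
Hypothesis alpha1 : 1 < alpha.
Implicit Types a p q s t : R.

Let alpha0 : 0 < alpha. Proof. exact: lt_trans alpha1. Qed.

Lemma le_powRN p q : 0 < p -> p <= q -> q `^ (- alpha) <= p `^ (- alpha).
Proof.
move=> p0 pq; have q0 : 0 < q := lt_le_trans p0 pq.
rewrite !powRN lef_pV2 ?posrE ?powR_gt0//.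
by apply: (ge0_ler_powR (ltW alpha0)) => //; rewrite nnegrE ltW.
Qed.

(** The graph of the convex function [x `^ (1 - alpha)] lies above its
    tangents; the ratio [p / q] reduces this to Bernoulli's inequality. *)
Lemma powR_tangent p q : 0 < p -> 0 < q ->
  alpha * (q * q `^ (- alpha)) <= p * p `^ (- alpha) + (alpha - 1) * (q `^ (- alpha) * p).
Proof.
move=> p0 q0; pose r := p / q; have r0 : 0 < r by rewrite divr_gt0.
have pE : p = q * r by rewrite /r mulrCA mulfV ?mulr1// gt_eqF.
have bern : alpha - (alpha - 1) * r <= r * r `^ (- alpha).
  rewrite /powR gt_eqF// -[X in X * expR _]lnK// -expRD.
  apply: le_trans (expR_ge1Dx _).
  have h : ln r <= r - 1.
    by rewrite -[X in ln X](subrKC 1); apply: le_ln1Dx; rewrite ltrBDl addrN.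
  by move: h alpha1; move: (ln r) => l; nra.
rewrite pE powRM ?(ltW q0) ?(ltW r0)//; have := ler_wpM2l (ltW (mulr_gt0 q0 (powR_gt0 (- alpha) q0))) bern.
by move: (q `^ _) (r `^ _) => x y; lra.
Qed.

Definition trunc_pow a t := Num.max a t `^ (- alpha).

(** A primitive of [t |-> - trunc_pow a t] that vanishes at the origin, with
    [p * p `^ (- alpha)] in place of [p `^ (1 - alpha)]. *)
Definition trunc_prim a t :=
  alpha / (alpha - 1) * (Num.max a t * trunc_pow a t - a * a `^ (- alpha)) - trunc_pow a t * t.

Lemma trunc_pow_ge0 a t : 0 <= trunc_pow a t.
Proof. exact: powR_ge0. Qed.

Lemma trunc_pow_le a t : 0 < a -> trunc_pow a t <= a `^ (- alpha).
Proof. by move=> a0; apply: le_powRN => //; rewrite le_max lexx. Qed.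

Lemma trunc_prim0 a : 0 < a -> trunc_prim a 0 = 0.
Proof. by move=> a0; rewrite /trunc_prim /trunc_pow max_l ?ltW// subrr !mulr0 subr0. Qed.

(** With [p] and [q] the truncations of [t] and [s], the difference of the two
    sides is, up to the factor [alpha - 1], the defect in [powR_tangent] plus
    [alpha - 1] times the nonnegative [(p `^ (- alpha) - q `^ (- alpha)) * (p
    - t)]. *)
Lemma trunc_prim_sub a s t : 0 < a ->
  trunc_prim a s + - trunc_pow a s * (t - s) <= trunc_prim a t.
Proof.
move=> a0; rewrite /trunc_prim /trunc_pow.
set q := Num.max a s; set p := Num.max a t.
have ap : a <= p by rewrite le_max lexx.
have aq : a <= q by rewrite le_max lexx.
have p0 := lt_le_trans a0 ap; have q0 := lt_le_trans a0 aq.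
have tan := powR_tangent p0 q0.
(* Where [t < a] the truncation [p] is [a], the least value of [q]. *)
have mono : 0 <= (p `^ (- alpha) - q `^ (- alpha)) * (p - t).
  have [ta|/ltW at'] := leP t a; last by rewrite /p max_r// subrr mulr0.
  apply: mulr_ge0; last by rewrite subr_ge0 le_max lexx orbT.
  by rewrite subr_ge0; apply: le_powRN => //; rewrite /p max_l.
have d0 : 0 < alpha - 1 by rewrite subr_gt0.
have dE : (alpha - 1) * (alpha - 1)^-1 = 1 by rewrite mulfV ?gt_eqF.
rewrite -subr_ge0 -(pmulr_rge0 _ d0).
move: tan mono dE d0; move: (p `^ _) (q `^ _) (a `^ _) ((alpha - 1)^-1) => P Q A i.
move: p q ap aq p0 q0 => p q _ _ _ _ tan mono dE d0.
have -> : (alpha - 1) * (alpha * i * (p * P - a * A) - P * t -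
      (alpha * i * (q * Q - a * A) - Q * s + - Q * (t - s))) =
    (p * P + (alpha - 1) * (Q * p) - alpha * (q * Q)) + (alpha - 1) * ((P - Q) * (p - t)) +
    ((alpha - 1) * i - 1) * alpha * (p * P - q * Q) by ring.
by rewrite dE subrr !mul0r addr0 addr_ge0// ?subr_ge0// mulr_ge0// ltW.
Qed.

Lemma trunc_pow_continuous a : 0 < a -> continuous (fun t => - trunc_pow a t).
Proof.
move=> a0 t; apply: continuousN.
have m0 : 0 < Num.max a t by rewrite lt_max a0.
have c1 : {for Num.max a t, continuous (fun x => x `^ (- alpha))}.
  apply: differentiable_continuous; apply/derivable1_diffP.
  by apply: derivable_powR; rewrite in_itv/= m0.
apply: (continuous_comp _ c1).
rewrite (_ : Num.max a = fun x => (a + x + `|a - x|) / 2); last first.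
  by apply/funext => x; rewrite maxr_absE.
apply: cvgM; last exact: cvg_cst.
apply: cvgD; first by apply: cvgD; [exact: cvg_cst|exact: cvg_id].
by apply: cvg_norm; apply: cvgB; [exact: cvg_cst|exact: cvg_id].
Qed.

Lemma measurable_trunc_pow d {T : measurableType d} (E : set T) (f g : T -> R) :
  measurable_fun E f -> measurable_fun E g ->
  measurable_fun E (fun x => trunc_pow (f x) (g x)).
Proof.
by move=> mf mg; exact: (measurableT_comp (measurable_powR _) (measurable_maxr mf mg)).
Qed.

Lemma measurable_trunc_prim d {T : measurableType d} (E : set T) (f g : T -> R) :
  measurable_fun E f -> measurable_fun E g ->
  measurable_fun E (fun x => trunc_prim (f x) (g x)).
Proof.
move=> mf mg; have mt := measurable_trunc_pow mf mg.
have mh := measurableT_comp (measurable_powR (- alpha)) mf.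
apply: measurable_funB; last exact: measurable_funM mt mg.
apply: measurable_funM; first exact: measurable_cst.
apply: measurable_funB; last exact: measurable_funM mf mh.
exact: measurable_funM (measurable_maxr mf mg) mt.
Qed.

End truncation.

(** * The singular problem *)

Section singular.
Context {R : realType} {n : nat}.
Variable Omega : set 'rV[R]_n.
Hypothesis oO : open Omega.
Hypothesis bO : bounded_set Omega.
Variable i0 : 'I_n.
Implicit Types (u v w f : 'rV[R]_n -> R).

Local Notation lebn := (@lebesgue_rV R n).
Local Notation ae P := {ae lebn, forall x, Omega x -> P x}.
Local Notation intg f := (lebn.-integrable Omega (EFin \o f)).
Local Notation I f := (\int[lebn]_(x in Omega) f x).
Local Notation L2 := (L2 lebn Omega).
Local Notation ip := (ip lebn Omega).
Local Notation H10 := (is_H10 Omega).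
Local Notation D := (dirichlet Omega).

Let mO : measurable Omega := open_measurable_rV oO.
Let L2l := L2_lin lebn mO.
Let ipp := ip_psd lebn mO.
Let H10l := H10_lin oO bO.
Let Dp := dirichlet_psd oO bO.

Definition pos_part w : 'rV[R]_n -> R := 2^-1 *: ((fun x => `|w x|) + w).

Lemma pos_partE w x : pos_part w x = 2^-1 * (`|w x| + w x).
Proof. by []. Qed.

Lemma pos_part_ge0 w x : 0 <= pos_part w x.
Proof.
by rewrite pos_partE mulr_ge0// -lerBlDr sub0r -normrN ler_norm.
Qed.

Lemma pos_part_le0 w x : w x <= 0 -> pos_part w x = 0.
Proof. by move=> w0; rewrite pos_partE ler0_norm// addNr mulr0. Qed.

Lemma pos_part_eq0 w x : pos_part w x = 0 -> w x <= 0.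
Proof.
rewrite pos_partE => /eqP; rewrite mulf_eq0 invr_eq0 pnatr_eq0/= addr_eq0 => /eqP h.
by rewrite -oppr_ge0 -h.
Qed.

Lemma H10_pos_part w : H10 w -> H10 (pos_part w).
Proof.
by move=> hw; exact: (lin_closedZ H10l _ (lin_closedD H10l (H10_abs oO bO hw) hw)).
Qed.

Lemma dirichlet_null w : H10 w -> D w w <= 0 -> ae (fun x => w x = 0).
Proof.
move=> hw Dw; have [C hC] := poincare oO bO i0.
have D0 : D w w = 0 by apply/eqP; rewrite eq_le Dw (form_ge0 Dp hw).
have lw := H10_L2 hw; apply: (ip_eq0 mO lw); apply/eqP.
by rewrite eq_le (form_ge0 ipp lw) andbT; have := hC _ hw; rewrite D0 mulr0.
Qed.

Let pos_bound (a b c : R) : b <= a -> 2^-1 * (c + a) <= 0 -> 2^-1 ^+ 2 * (b + 2 * c + a) <= 0.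
Proof. by rewrite expr2; lra. Qed.

(** The form of [w] with its positive part dominates the energy of the
    positive part, since [`|w|] has no more energy than [w]. *)
Lemma weak_maximum_principle w : H10 w -> D w (pos_part w) <= 0 -> ae (fun x => w x <= 0).
Proof.
move=> hw Dw; have haw := H10_abs oO bO hw.
have hs := lin_closedD H10l haw hw; have hp := H10_pos_part hw.
suff : D (pos_part w) (pos_part w) <= 0.
  move=> /(dirichlet_null hp); apply: ae_imp => x _; exact: pos_part_eq0.
rewrite (form_sqrZ H10l Dp _ hs) (form_sqrD H10l Dp haw hw).
apply: (pos_bound (dirichlet_abs oO bO hw)).
by rewrite (form_sym Dp haw hw) -(formDr H10l Dp haw hw hw) -(formZr H10l Dp _ hw hs).
Qed.

Variables (alpha C : R) (usub usup : 'rV[R]_n -> R).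
Hypothesis alpha1 : 1 < alpha.
Hypothesis usub_sol : subsolution Omega alpha usub.
Hypothesis usup_sol : supersolution Omega alpha usup.
Hypothesis usub_pos : ae (fun x => 0 < usub x).
Hypothesis usub_le : ae (fun x => usub x <= usup x).
Hypothesis usup_le : ae (fun x => usup x <= C * usub x).

Let hsub : H10 usub. Proof. by case: usub_sol. Qed.
Let hsup : H10 usup. Proof. by case: usup_sol. Qed.
Let alpha0 : 0 < alpha := lt_trans ltr01 alpha1.
Let H10_meas u : H10 u -> measurable_fun Omega u.
Proof. by move=> /H10_L2/L2_measurable. Qed.
Let powR_meas p u : measurable_fun Omega u -> measurable_fun Omega (fun x => u x `^ p).
Proof. by move=> mu; exact: (measurableT_comp (measurable_powR p) mu). Qed.

Lemma supersolution_test v : H10 v -> ae (fun x => 0 <= v x) ->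
  intg (fun x => usup x `^ (- alpha) * v x) /\
  I (fun x => usup x `^ (- alpha) * v x) <= D usup v.
Proof.
move=> hv v0; have [_ _ super] := usup_sol; have := super v hv v0.
rewrite sube_ge0; last by apply/orP; right.
move=> le; apply: (integrable_lee mO _ _ le).
  by apply: measurable_funM; [apply: powR_meas; exact: H10_meas|exact: H10_meas].
by apply: ae_imp v0 => x _ vx; rewrite mulr_ge0// powR_ge0.
Qed.

Lemma subsolution_test v : H10 v -> ae (fun x => 0 <= v x) ->
  intg (fun x => usub x `^ (- alpha) * v x) ->
  D usub v <= I (fun x => usub x `^ (- alpha) * v x).
Proof.
move=> hv v0 iv; have [_ _ sub] := usub_sol; have := sub v hv v0.
by rewrite sube_le0 /eintegral_in Rintegral_EFin// lee_fin.
Qed.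

Let usub_powR_le : ae (fun x => usub x `^ (- alpha) <= `|C| `^ alpha * usup x `^ (- alpha)).
Proof.
have h := ae_and usub_pos (ae_and usub_le usup_le).
apply: ae_imp h => x _ [s0 [s1 s2]].
have C0 : 0 < C by rewrite -(pmulr_lgt0 _ s0); apply: lt_le_trans s2; exact: lt_le_trans s1.
have s3 := le_powRN alpha1 (lt_le_trans s0 s1) s2.
rewrite powRM ?(ltW C0) ?(ltW s0)// in s3.
rewrite (gtr0_norm C0); apply: le_trans (ler_wpM2l (powR_ge0 C alpha) s3).
by rewrite mulrA -powRD ?(gt_eqF C0) ?implybT// subrr powRr0 mul1r.
Qed.

(** The singular term defines a functional that is continuous for the Dirichlet
    norm: the supersolution controls its integral against [|v|]. *)
Lemma singular_bound : exists2 K, 0 <= K & forall v, H10 v ->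
  intg (fun x => usub x `^ (- alpha) * `|v x|) /\
  I (fun x => usub x `^ (- alpha) * `|v x|) ^+ 2 <= K * D v v.
Proof.
pose B := `|C| `^ alpha; have B0 : 0 <= B by exact: powR_ge0.
exists (B ^+ 2 * D usup usup); first by rewrite mulr_ge0 ?sqr_ge0// (form_ge0 Dp hsup).
move=> v hv; have hav := H10_abs oO bO hv.
have v0 : ae (fun x => 0 <= `|v x|) by exact: ae_all.
have [ia Ia] := supersolution_test hav v0.
have ib := integrable_scale mO B ia.
have le : ae (fun x => usub x `^ (- alpha) * `|v x| <= B * (usup x `^ (- alpha) * `|v x|)).
  by apply: ae_imp usub_powR_le => x _ h; rewrite mulrA; apply: ler_wpM2r.
have ge : ae (fun x => 0 <= usub x `^ (- alpha) * `|v x|).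
  by apply: ae_all => x _; rewrite mulr_ge0// powR_ge0.
have iv : intg (fun x => usub x `^ (- alpha) * `|v x|).
  apply: (integrable_ae_le mO _ ib).
    apply: measurable_funM; first by apply: powR_meas; exact: (H10_meas hsub).
    exact: (H10_meas hav).
  by apply: (ae_imp2 _ ge le) => x _ g l; rewrite (ger0_norm g).
split; first exact: iv.
have I0 := Rintegral_ge0_ae mO iv ge.
have I1 := Rintegral_le_ae mO iv ib le; rewrite RintegralZl// in I1.
have I2 : I (fun x => usub x `^ (- alpha) * `|v x|) <= B * D usup (fun x => `|v x|).
  by apply: (le_trans I1); exact: ler_wpM2l.
apply: (@le_trans _ _ ((B * D usup (fun x => `|v x|)) ^+ 2)).
  by apply: lerXn2r => //; rewrite nnegrE ?(le_trans I0 I2).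
rewrite [leLHS]exprMn -[leRHS]mulrA; apply: ler_wpM2l; first exact: sqr_ge0.
apply: (le_trans (form_cauchy_schwarz H10l Dp hsup hav)).
by apply: ler_wpM2l; [exact: (form_ge0 Dp hsup)|exact: dirichlet_abs].
Qed.

Let singular_int v (f : 'rV[R]_n -> R) : H10 v -> measurable_fun Omega f ->
  ae (fun x => `|f x| <= usub x `^ (- alpha)) -> intg (fun x => f x * v x).
Proof.
move=> hv mf fle; have [K _ hK] := singular_bound.
apply: (integrable_ae_le mO _ (hK v hv).1).
  by apply: measurable_funM => //; exact: (H10_meas hv).
by apply: ae_imp fle => x _ h; rewrite normrM; apply: ler_wpM2r.
Qed.

(** Truncating the nonlinearity below the subsolution makes it bounded by
    [usub `^ (- alpha)] and monotone, so that the energy is convex. *)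
Let truncated_solution : exists2 u, H10 u & forall v, H10 v ->
  intg (fun x => trunc_pow alpha (usub x) (u x) * v x) /\
  D u v = I (fun x => trunc_pow alpha (usub x) (u x) * v x).
Proof.
have [K K0 hK] := singular_bound.
have ms := H10_meas hsub.
have mg u : measurable_fun Omega u -> measurable_fun Omega (fun x => trunc_pow alpha (usub x) (u x)).
  by move=> mu; exact: measurable_trunc_pow.
have g_le : ae (fun x => forall t, `|- trunc_pow alpha (usub x) t| <= usub x `^ (- alpha)).
  apply: ae_imp usub_pos => x _ s0 t.
  by rewrite normrN ger0_norm ?trunc_pow_ge0//; exact: trunc_pow_le.
have [u hu E] : exists2 u, H10 u & forall v, H10 v ->
    intg (fun x => - trunc_pow alpha (usub x) (u x) * v x) /\
    D u v + I (fun x => - trunc_pow alpha (usub x) (u x) * v x) = 0.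
  apply: (@semilinear_solution _ _ _ oO bO (fun x => usub x `^ (- alpha)) K
    (fun x t => trunc_prim alpha (usub x) t) (fun x t => - trunc_pow alpha (usub x) t) hK K0 _ _ g_le).
  - by move=> u mu; exact: measurable_trunc_prim.
  - by move=> u mu; apply: measurableT_comp => //; exact: mg.
  - by apply: ae_imp usub_pos => x _ s0; exact: trunc_pow_continuous.
  - by apply: ae_imp usub_pos => x _ s0; exact: trunc_prim0.
  - by apply: ae_imp usub_pos => x _ s0 s t; exact: trunc_prim_sub.
  - exact: i0.
exists u; first exact: hu.
move=> v hv; have [iv Ev] := E v hv.
have EN : (fun x => trunc_pow alpha (usub x) (u x) * v x) =
    (fun x => -1 * (- trunc_pow alpha (usub x) (u x) * v x)).
  by apply/funext => x; ring.
split; first by rewrite EN; exact: (integrable_scale mO).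
rewrite EN RintegralZl// mulN1r; apply/eqP.
by rewrite -addr_eq0; exact/eqP.
Qed.

(** The subsolution lies below the solution of the truncated problem, which
    makes the truncation inactive, and the supersolution lies above it. *)
Lemma singular_solution : exists u, solution_in_interval Omega alpha usub usup u.
Proof.
have [u hu E] := truncated_solution; exists u.
have below : ae (fun x => usub x <= u x).
  have hw := lin_closedB H10l hsub hu; have hp := H10_pos_part hw.
  have p0 : ae (fun x => 0 <= pos_part (usub - u) x) by apply: ae_all => x _; exact: pos_part_ge0.
  have [iE Ep] := E _ hp.
  have is1 : intg (fun x => usub x `^ (- alpha) * pos_part (usub - u) x).
    apply: (singular_int hp); first by apply: powR_meas; exact: (H10_meas hsub).
    by apply: ae_all => x _; rewrite ger0_norm// powR_ge0.
  have Dw : D (usub - u) (pos_part (usub - u)) <= 0.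
    rewrite (formBl H10l Dp hsub hu hp) Ep subr_le0.
    apply: (le_trans (subsolution_test hp p0 is1)).
    rewrite (eq_Rintegral_ae mO is1 iE)//.
    apply: ae_all => x _; have [su|us] := leP (u x) (usub x); last first.
      rewrite pos_part_le0 ?mulr0//.
      by change (usub x - u x <= 0); rewrite subr_le0 ltW.
    by rewrite /trunc_pow max_l.
  by apply: ae_imp (weak_maximum_principle hw Dw) => x _ h; rewrite -subr_le0.
have above : ae (fun x => u x <= usup x).
  have hw := lin_closedB H10l hu hsup; have hp := H10_pos_part hw.
  have p0 : ae (fun x => 0 <= pos_part (u - usup) x) by apply: ae_all => x _; exact: pos_part_ge0.
  have [iE Ep] := E _ hp.
  have [is1 Is1] := supersolution_test hp p0.
  have Dw : D (u - usup) (pos_part (u - usup)) <= 0.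
    rewrite (formBl H10l Dp hu hsup hp) Ep subr_le0; apply: le_trans Is1.
    apply: (Rintegral_le_ae mO iE is1).
    apply: (ae_imp2 _ (ae_and usub_pos usub_le) p0) => x _ [s0 s1] p1.
    have [su|us] := leP (usup x) (u x); last first.
      rewrite pos_part_le0 ?mulr0//.
      by change (u x - usup x <= 0); rewrite subr_le0 ltW.
    apply: ler_wpM2r => //; apply: le_powRN => //; first exact: lt_le_trans s1.
    by rewrite le_max su orbT.
  by apply: ae_imp (weak_maximum_principle hw Dw) => x _ h; rewrite -subr_le0.
split.
- exact: hu.
- by apply: (ae_imp2 _ below above) => x _ -> ->.
move=> v hv; have [iv Ev] := E v hv.
have eqv : ae (fun x => trunc_pow alpha (usub x) (u x) * v x = u x `^ (- alpha) * v x).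
  by apply: ae_imp below => x _ su; rewrite /trunc_pow max_r.
have iu : intg (fun x => u x `^ (- alpha) * v x).
  apply: (integrable_eq_ae mO _ eqv iv).
  by apply: measurable_funM; [apply: powR_meas; exact: (H10_meas hu)|exact: (H10_meas hv)].
split; first exact: iu.
rewrite Ev; exact: (eq_Rintegral_ae mO iv iu eqv).
Qed.

Lemma solution_pos u : solution_in_interval Omega alpha usub usup u -> ae (fun x => 0 < u x).
Proof.
by move=> [_ su _]; apply: (ae_imp2 _ usub_pos su) => x _ s0 /andP[s1 _]; exact: lt_le_trans s1.
Qed.

(** The nonlinearity is decreasing, so the difference of two solutions has no
    energy. *)
Lemma singular_unique u u' : solution_in_interval Omega alpha usub usup u ->
  solution_in_interval Omega alpha usub usup u' -> ae (fun x => u' x = u x).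
Proof.
move=> su su'; have [hu _ E] := su; have [hu' _ E'] := su'.
have hw := lin_closedB H10l hu' hu.
have [i1 e1] := E _ hw; have [i2 e2] := E' _ hw.
have Dw : D (u' - u) (u' - u) <= 0.
  rewrite (formBl H10l Dp hu' hu hw) e1 e2 subr_le0.
  apply: (Rintegral_le_ae mO i2 i1).
  apply: (ae_imp2 _ (solution_pos su) (solution_pos su')) => x _ p p'.
  change (u' x `^ (- alpha) * (u' x - u x) <= u x `^ (- alpha) * (u' x - u x)).
  have [uu|/ltW uu] := leP (u x) (u' x).
    by apply: ler_wpM2r; [rewrite subr_ge0|exact: le_powRN].
  by apply: ler_wnM2r; [rewrite subr_le0|exact: le_powRN].
apply: ae_imp (dirichlet_null hw Dw) => x _ h.
by apply/eqP; rewrite -subr_eq0; exact/eqP.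
Qed.

End singular.

(** * The linearized operator *)

Lemma form_complete_equiv (R : realType) (V : lmodType R) (S : set V) (b q : V -> V -> R) (c : R) :
  lin_closed S -> 0 < c -> (forall v, S v -> b v v <= q v v) ->
  (forall v, S v -> q v v <= c * b v v) -> form_complete S b -> form_complete S q.
Proof.
move=> SL c0 bq qb cb x Sx cx.
have [l Sl xl] : exists2 l, S l & form_lim b x l.
  apply: cb => // e /cx[N hN]; exists N => j k Nj Nk.
  by apply: le_trans (hN j k Nj Nk); apply: bq; exact: (lin_closedB SL).
exists l => // e e0; have [N hN] := xl _ (divr_gt0 e0 c0).
exists N => k Nk; apply: (le_trans (qb _ (lin_closedB SL (Sx k) Sl))).
by rewrite mulrC -ler_pdivlMr//; exact: hN.
Qed.

Lemma open_not_null (R : realType) (n : nat) (U : set 'rV[R]_n) :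
  open U -> U !=set0 -> ~ {ae (@lebesgue_rV R n), forall x, ~ U x}.
Proof.
move=> oU [x Ux] [A [mA A0 UA]]; have [p px pU] := open_rat_box oU Ux.
pose r : R := p.2.+1%:R^-1; have r0 : 0 < r by rewrite invr_gt0.
pose J (i : 'I_n) : set R := `]ratr (p.1 ord0 i) - r, ratr (p.1 ord0 i) + r[%classic.
have JA : [set y : 'rV[R]_n | forall i, J i (y ord0 i)] `<=` A.
  move=> y Jy; apply: UA => /=; apply; apply: pU => i.
  have := Jy i; rewrite /J/= in_itv/= => /andP[h1 h2].
  by rewrite ler_norml lerBlDr lerBrDr; apply/andP; split; [move: h2|move: h1]; rewrite -/r; lra.
have mJ : measurable [set y : 'rV[R]_n | forall i, J i (y ord0 i)].
  by apply: measurable_rect => i; exact: measurable_itv.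
have : (lebesgue_rV n [set y : 'rV[R]_n | forall i, J i (y ord0 i)] <= 0)%E.
  by rewrite -A0; apply: le_measure => //; rewrite inE.
suff pos : (0 < \prod_(i < n) lebesgue_measure (J i))%E.
  rewrite lebesgue_rV_box; last by move=> i; exact: measurable_itv.
  by move=> /le_lt_trans/(_ pos); rewrite ltxx.
elim/big_ind : _ => //; first exact: mule_gt0.
move=> i _; rewrite lebesgue_measure_itv/= lte_fin ltrD2l gtrN// -EFinD lte_fin.
by rewrite opprD addrACA subrr add0r opprK addr_gt0.
Qed.

Section linearized.
Context {R : realType} {n : nat}.
Variable Omega : set 'rV[R]_n.
Hypothesis oO : open Omega.
Hypothesis bO : bounded_set Omega.
Hypothesis Omega0 : Omega !=set0.
Variable i0 : 'I_n.
Implicit Types (v w f : 'rV[R]_n -> R).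

Local Notation lebn := (@lebesgue_rV R n).
Local Notation ae P := {ae lebn, forall x, Omega x -> P x}.
Local Notation intg f := (lebn.-integrable Omega (EFin \o f)).
Local Notation I f := (\int[lebn]_(x in Omega) f x).
Local Notation L2 := (L2 lebn Omega).
Local Notation ip := (ip lebn Omega).
Local Notation H10 := (is_H10 Omega).
Local Notation D := (dirichlet Omega).

Let mO : measurable Omega := open_measurable_rV oO.
Let L2l := L2_lin lebn mO.
Let ipp := ip_psd lebn mO.
Let H10l := H10_lin oO bO.
Let Dp := dirichlet_psd oO bO.
Let ip1 := ip_H10_psd oO.

Variables (alpha : R) (u : 'rV[R]_n -> R).
Hypothesis alpha0 : 0 < alpha.
Hypothesis hu : H10 u.
Hypothesis u_pos : ae (fun x => 0 < u x).
Hypothesis u_sol : forall v, H10 v -> intg (fun x => u x `^ (- alpha) * v x) /\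
  D u v = I (fun x => u x `^ (- alpha) * v x).

Let rho x := (u x `^ (1 + alpha))^-1.

Let m_rho : measurable_fun Omega rho.
Proof.
rewrite (_ : rho = fun x => u x `^ (- (1 + alpha))).
  exact: (measurableT_comp (measurable_powR _) (L2_measurable (H10_L2 hu))).
by apply/funext => x; rewrite powRN.
Qed.

Let hardy_rho w : H10 w -> intg (fun x => rho x * (w x * w x)) /\
  I (fun x => rho x * (w x * w x)) <= D w w.
Proof.
apply: (@hardy _ _ _ oO bO u (fun x => u x `^ (- alpha)) rho hu u_pos m_rho).
- by move=> x; exact: powR_ge0.
- apply: ae_imp u_pos => x _ u0.
  by rewrite /rho -powRN opprD addrC powRD ?(gt_eqF u0) ?implybT// powR_inv1// ltW.
- move=> v tv _; have [iv Ev] := u_sol (H10_test oO bO tv).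
  by split; [exact: iv|rewrite Ev].
Qed.

(** The square root of the weight [rho], which makes the weighted product an
    L2 product. *)
Let srho x := u x `^ (- (1 + alpha) / 2).
Let wt v : 'rV[R]_n -> R := fun x => srho x * v x.

Let wtE v w x : wt v x * wt w x = v x * w x / u x `^ (1 + alpha).
Proof.
have s0 : - (1 + alpha) / 2 + - (1 + alpha) / 2 != 0.
  by rewrite -splitr oppr_eq0 gt_eqF// addr_gt0.
by rewrite /wt mulrACA /srho -powRD ?(negPf s0)// -splitr powRN mulrC.
Qed.

Let wt_L2 v : H10 v -> L2 (wt v).
Proof.
move=> hv; have [iv _] := hardy_rho hv; split.
  apply: measurable_funM; last exact: (L2_measurable (H10_L2 hv)).
  exact: (measurableT_comp (measurable_powR _) (L2_measurable (H10_L2 hu))).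
rewrite (_ : (fun x => wt v x ^+ 2) = fun x => rho x * (v x * v x))//.
by apply/funext => x; rewrite expr2 wtE mulrC.
Qed.

Let wtP a v w : wt (a *: v + w) = a *: wt v + wt w.
Proof.
apply/funext => x.
by change (srho x * (a * v x + w x) = a * (srho x * v x) + srho x * w x); ring.
Qed.

Let Q v w := D v w + alpha * ip (wt v) (wt w).

Let QE v w : Q v w = D v w + alpha * I (fun x => v x * w x / u x `^ (1 + alpha)).
Proof. by rewrite /Q !ipE; under eq_Rintegral do rewrite wtE. Qed.

Let Q_psd : psd_form H10 Q.
Proof.
split.
- by move=> v w hv hw; rewrite /Q (form_sym Dp hv hw) (form_sym ipp (wt_L2 hv) (wt_L2 hw)).
- move=> a v w z hv hw hz.
  rewrite /Q (formPl Dp a hv hw hz) wtP (formPl ipp a (wt_L2 hv) (wt_L2 hw) (wt_L2 hz)).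
  by move: (D _ _) (D _ _) (ip _ _) (ip _ _) => p q r s; ring.
- move=> v hv; apply: addr_ge0; first exact: (form_ge0 Dp).
  by apply: mulr_ge0; [exact: ltW|exact: (form_ge0 ipp (wt_L2 hv))].
Qed.

Let DQ v : H10 v -> D v v <= Q v v.
Proof.
by move=> hv; rewrite lerDl; apply: mulr_ge0; [exact: ltW|exact: (form_ge0 ipp (wt_L2 hv))].
Qed.

Let QD v : H10 v -> Q v v <= (1 + alpha) * D v v.
Proof.
move=> hv; rewrite QE mulrDl mul1r; apply: lerD => //.
apply: ler_wpM2l; first exact: ltW.
have [_ h] := hardy_rho hv; apply: le_trans h.
by rewrite le_eqVlt; apply/orP; left; apply/eqP; apply: eq_Rintegral => x _; rewrite mulrC.
Qed.

Let u_nonnull : 0 < ip u u.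
Proof.
have lu := H10_L2 hu; rewrite lt_neqAle (form_ge0 ipp lu) andbT eq_sym; apply/negP => /eqP.
move=> /(ip_eq0 mO lu) un; apply: (open_not_null oO Omega0).
by apply: (filterS2 _ _ u_pos un) => x p z Ox; move: (p Ox); rewrite (z Ox) ltxx.
Qed.

Let ip_neq0 w : H10 w -> ~ ae (fun x => w x = 0) -> 0 < ip w w.
Proof.
move=> hw w0; have lw := H10_L2 hw.
rewrite lt_neqAle (form_ge0 ipp lw) andbT eq_sym; apply/negP => /eqP h.
by apply: w0; exact: ip_eq0 h.
Qed.

(** By the Hardy inequality the quadratic form [Q] of the linearized operator
    lies between [D] and [(1 + alpha) * D]; it inherits from [D] completeness
    and compactness, which yield a least eigenvalue, and the Poincare
    inequality, which makes it positive. *)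
Theorem linearly_stable : linearly_asymptotically_stable Omega alpha u.
Proof.
have [C hC] := poincare oO bO i0.
have sC v : H10 v -> ip v v <= `|C| * Q v v.
  move=> hv; apply: (le_trans (hC v hv)); apply: (@le_trans _ _ (`|C| * D v v)).
    by apply: ler_wpM2r; [exact: (form_ge0 Dp hv)|exact: ler_norm].
  by apply: ler_wpM2l => //; exact: DQ.
have Qc : form_complete H10 Q.
  by apply: (form_complete_equiv H10l _ DQ QD (H10_complete oO bO i0)); rewrite addr_gt0.
have comp e : 0 < e -> exists M (l : 'I_M -> ('rV[R]_n -> R) -> R) (K : R),
    [/\ forall i a v w, H10 v -> H10 w -> l i (a *: v + w) = a * l i v + l i w,
        forall i v, H10 v -> l i v ^+ 2 <= K * ip v v &
        forall v, H10 v -> ip v v <= \sum_i l i v ^+ 2 + e * Q v v].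
  move=> e0; have [M [l [K [l1 l2 l3]]]] := rellich_H10 oO bO e0.
  exists M, l, K; split; [exact: l1|exact: l2|] => v hv.
  apply: (le_trans (l3 v hv)); apply: lerD => //.
  by apply: ler_wpM2l; [exact: ltW|exact: DQ].
have [w [m [hw w1 wm mle]]] :=
  least_eigenvector H10l Q_psd ip1 Qc sC comp (ex_intro2 _ _ u hu u_nonnull).
exists m; split.
- exists w; split; first exact: hw.
    move=> w0; have lw := H10_L2 hw; have l0 := L2_0 lebn Omega.
    have z : ip w w = ip 0 0 by apply: (ip_eq_ae mO).
    move: w1; rewrite z (form0l L2l ipp)// => /esym/eqP; rewrite oner_eq0//.
  move=> v hv; split.
    have := L2_mul mO (wt_L2 hw) (wt_L2 hv).
    by congr (lebn.-integrable _ _); apply/funext => x /=; rewrite wtE.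
  by have := wm v hv; rewrite QE.
- move=> mu [w' [hw' w'0 E]].
  have p := ip_neq0 hw' w'0.
  have [_ Ew] := E w' hw'; rewrite -(ler_pM2r p).
  by apply: (le_trans (mle w' hw')); rewrite QE Ew.
- have h := sC w hw; rewrite (wm w hw) w1 mulr1 in h.
  rewrite ltNge; apply/negP => m0.
  have : `|C| * m <= 0 by rewrite mulr_ge0_le0.
  by move=> /(le_trans h); rewrite ler10.
Qed.

End linearized.

Theorem theorem3p4 (R : realType) (N : nat) (Omega : set 'rV[R]_N)
    (alpha c1 c2 : R) (usub usup : 'rV[R]_N -> R) :
  (0 < N)%N ->
  smooth_bounded_domain Omega ->
  1 < alpha < 3 ->
  subsolution Omega alpha usub ->
  supersolution Omega alpha usup ->
  ae_in Omega (fun x =>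
    let dpow := dist_boundary Omega x `^ (2 / (1 + alpha)) in
    [/\ 0 < c1 * dpow, c1 * dpow <= usub x, usub x <= usup x & usup x <= c2 * dpow]) ->
  exists u : 'rV[R]_N -> R,
    [/\ solution_in_interval Omega alpha usub usup u,
        forall u' : 'rV[R]_N -> R,
          solution_in_interval Omega alpha usub usup u' ->
          ae_in Omega (fun x => u' x = u x) &
        linearly_asymptotically_stable Omega alpha u].
Proof.
move=> N0 [nO oO _ bO _] /andP[a1 _] sub super bounds.
pose i0 : 'I_N := Ordinal N0.
have upos : ae_in Omega (fun x => 0 < usub x).
  by apply: ae_imp bounds => x _ [h1 h2 _ _]; exact: lt_le_trans h2.
have ule : ae_in Omega (fun x => usub x <= usup x) by apply: ae_imp bounds => x _ [].
(* Both bounds are multiples of the same positive power of the distance. *)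
have uleC : ae_in Omega (fun x => usup x <= c2 / c1 * usub x).
  apply: ae_imp bounds => x _ /= [h1 h2 h3 h4].
  move: h1 h2 h4; have := powR_ge0 (dist_boundary Omega x) (2 / (1 + alpha)).
  set d := (_ `^ _); move=> d0 h1 h2 h4.
  have dp : 0 < d by rewrite lt_neqAle d0 andbT; apply: contraTneq h1 => <-; rewrite mulr0 ltxx.
  have c10 : 0 < c1 by rewrite -(pmulr_lgt0 _ dp).
  have c20 : 0 < c2.
    rewrite -(pmulr_lgt0 _ dp); apply: lt_le_trans h4; apply: lt_le_trans h3.
    exact: lt_le_trans h2.
  apply: (le_trans h4); apply: (@le_trans _ _ (c2 / c1 * (c1 * d))).
    by rewrite mulrA mulfVK// gt_eqF.
  by apply: ler_wpM2l => //; rewrite ltW// divr_gt0.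
have [u su] := singular_solution oO bO i0 a1 sub super upos ule uleC.
exists u; split; first exact: su.
  by move=> u' su'; exact: (singular_unique oO bO i0 a1 upos su su').
have [hu _ E] := su.
exact: (linearly_stable oO bO nO i0 (lt_trans ltr01 a1) hu (solution_pos upos su) E).
Qed.
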